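(* Let $(L,Q)$ be a flat $L_\infty$-algebra and let $\pi\in\mathcal{F}^1L^1$ be a Maurer-Cartan element homotopy equivalent to zero via $\pi(t)$ and a constant $\lambda(t)=\lambda$ (so $\pi(0)=0$, $\pi(1)=\pi$). Let $\kappa\colon(M,\phi)\to(N,\phi')$ be a morphism of $L_\infty$-modules over $(L,Q)$. Let $\Phi_t\colon(L,Q)\to(L,Q^{\pi(t)})$ be the $L_\infty$-isomorphisms associated with $(\pi(t),\lambda)$, let $\Phi_1^*\kappa^{\pi}\colon(M,\Phi_1^*\phi^\pi)\to(N,\Phi_1^*\phi'^\pi)$ be the pull-back of the twisted morphism, and let $\Psi_{M,1}\colon(M,\phi)\to(M,\Phi_1^*\phi^{\pi})$ and $\Psi_{N,1}\colon(N,\phi')\to(N,\Phi_1^*\phi'^{\pi})$ be the $L_\infty$-module isomorphisms defined in the context. Then the $L_\infty$-module morphisms $\kappa$ and $\Psi_{N,1}^{-1}\circ(\Phi_1^*\kappa^\pi)\circ\Psi_{M,1}$ from $(M,\phi)$ to $(N,\phi')$ over $(L,Q)$ are homotopic.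
   Context: $\mathbb{K}$ is a field of characteristic zero; vector spaces are $\mathbb{Z}$-graded, $V[i]^k=V^{i+k}$, Koszul sign rule. $\mathrm{Sym}(V)$ is the graded symmetric coalgebra with product $\vee$ and shuffle coproduct $\Delta_{sh}$. A flat $L_\infty$-algebra $(L,Q)$ is a graded vector space with a degree $1$ coderivation $Q$ of $\mathrm{Sym}(L[1])$, $Q^2=0$, $Q(1)=0$; $Q^1=\mathrm{pr}_{L[1]}\circ Q$ and $Q^1_n$ is its restriction to $\mathrm{Sym}^n(L[1])$. An $L_\infty$-module over $(L,Q)$ is a graded vector space $M$ with a degree $1$ map $\phi$ on $\mathrm{Sym}(L[1])\otimes M$ with $\phi^2=0$ and $a\circ\phi=(\mathrm{id}\otimes\phi+Q\otimes\mathrm{id}\otimes\mathrm{id})\circ a$, $a=\Delta_{sh}\otimes\mathrm{id}$; it is determined by $\phi^1\colon\mathrm{Sym}(L[1])\otimes M\to M[1]$ via $\phi=Q\otimes\mathrm{id}+(\mathrm{id}\otimes\phi^1)\circ(\Delta_{sh}\otimes\mathrm{id})$. A morphism $\kappa\colon(M,\phi)\to(N,\phi')$ is a degree $0$ map $\kappa\colon\mathrm{Sym}(L[1])\otimes M\to\mathrm{Sym}(L[1])\otimes N$ with $(\mathrm{id}\otimes\kappa)a=a\kappa$ and $\kappa\phi=\phi'\kappa$; $\kappa=(\mathrm{id}\otimes\kappa^1)\circ(\Delta_{sh}\otimes\mathrm{id})$ for a unique $\kappa^1\colon\mathrm{Sym}(L[1])\otimes M\to N$. $L$, $M$, $N$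 carry complete descending exhaustive filtrations and all structures are compatible with them. $\widehat{L[t]}$ is the completion of $L\otimes\mathbb{K}[t]$ w.r.t. $\mathcal{F}^kL\otimes\mathbb{K}[t]$. $\exp(\pi)=\sum_n\frac1{n!}\pi^{\vee n}$. A Maurer-Cartan element is $\pi\in\mathcal{F}^1L^1$ with $Q^1(\exp\pi)=0$; it is homotopy equivalent to $0$ via $\pi(t)\in\mathcal{F}^1\widehat{L^1[t]}$, $\lambda(t)\in\mathcal{F}^1\widehat{L^0[t]}$ if $\frac{d}{dt}\pi(t)=Q^1(\lambda(t)\vee\exp\pi(t))$, $\pi(0)=0$, $\pi(1)=\pi$. Twisting by $\pi$: $Q^\pi=\exp(-\pi\vee)Q\exp(\pi\vee)$, $\phi^\pi=\exp(-\pi\vee)\phi\exp(\pi\vee)$, $\kappa^\pi=\exp(-\pi\vee)\kappa\exp(\pi\vee)$; $(M,\phi^\pi)$ is an $L_\infty$-module over $(L,Q^\pi)$ and $\kappa^\pi$ a morphism $(M,\phi^\pi)\to(N,\phi'^\pi)$ of such. $\Phi_t$ is the coalgebra morphism of $\mathrm{Sym}(L[1])$ with Taylor coefficients uniquely determined by $\frac{d}{dt}(\Phi_t)^1_i(a)=\sum_{k=1}^i(Q^{\pi(t)})^1_{k+1}(\lambda\vee(\Phi_t)^k_i(a))$, $(\Phi_0)^1_i(a)=\mathrm{pr}_{L[1]}(a)$, $a\in\mathrm{Sym}^i(L[1])$ (with $(\Phi_t)^k_i=\mathrm{pr}_{\mathrm{Sym}^k}\circ\Phi_t|_{\mathrm{Sym}^i}$);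 it is an $L_\infty$-isomorphism $(L,Q)\to(L,Q^{\pi(t)})$. Pull-backs: $\Phi_t^*\phi^{\pi(t)}$ is the $L_\infty$-module structure over $(L,Q)$ on $M$ with $(\Phi_t^*\phi^{\pi(t)})^1=(\phi^{\pi(t)})^1\circ(\Phi_t\otimes\mathrm{id})$, and $\Phi_t^*\kappa^{\pi(t)}$ is the morphism over $(L,Q)$ with $(\Phi_t^*\kappa^{\pi(t)})^1=(\kappa^{\pi(t)})^1\circ(\Phi_t\otimes\mathrm{id})$. $\Psi_{M,t}=\Psi_t\colon(M,\phi)\to(M,\Phi_t^*\phi^{\pi(t)})$ is the $L_\infty$-module isomorphism over $(L,Q)$ whose structure maps $(\Psi_t)^1_i\colon\mathrm{Sym}^i(L[1])\otimes M\to M$, $i\ge0$, are defined by $\frac{d}{dt}(\Psi_t)^1_i=\big((\Phi_t^*\phi^{\pi(t)})\circ(\lambda\vee\cdot)\big)^1\circ(\Psi_t)_i$, $(\Psi_0)^1_i=\mathrm{pr}_M$ (i.e. $\mathrm{id}_M$ for $i=0$ and $0$ for $i>0$), where $(\Psi_t)_i$ denotes the restriction of the induced comodule map $\Psi_t$ to $\mathrm{Sym}^i(L[1])\otimes M$; $\Psi_{N,t}$ is defined analogously from $\phi'$. Two morphisms $\kappa_1,\kappa_2\colon(M,\phi)\to(N,\phi')$ are homotopic if $\kappa_2^1=\kappa_1^1-\partial h$ for some $h$ of degree zero in the complex $\mathrm{Hom}(\mathrm{Sym}(L[1])\otimes M,N)[-1]$, with $\partial X=\phi'^{1}\circ(\mathrm{id}\otimes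 X)\circ(\Delta_{sh}\otimes\mathrm{id})+(-1)^{|X|}X\circ\phi$, $|X|$ the degree in this shifted complex. *)

(* Defs.v *)
From HB Require Import structures.
From mathcomp Require Import all_boot all_order all_algebra.
From mathcomp Require Import boolp.

Set Implicit Arguments.
Unset Strict Implicit.
Unset Printing Implicit Defensive.

Import GRing.Theory.
Local Open Scope ring_scope.
Local Open Scope quotient_scope.

(* Locked, so that simplification and unification do not look inside. *)
HB.lock Definition mklin (K : fieldType) (A B : lmodType K) (f : A -> B)
    (Hf : linear f) : {linear A -> B} :=
  HB.pack f (GRing.isLinear.Build K A B *:%R f Hf).
Arguments mklin {K A B f} Hf.

Lemma mklinE (K : fieldType) (A B : lmodType K) (f : A -> B)
  (Hf : linear f) x : mklin Hf x = f x.
Proof. by rewrite mklin.unlock. Qed.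

Lemma idlin_subproof (K : fieldType) (A : lmodType K) : linear (fun x : A => x).
Proof. by []. Qed.

Definition idlin (K : fieldType) (A : lmodType K) : {linear A -> A} :=
  mklin (@idlin_subproof K A).

Lemma idlinE (K : fieldType) (A : lmodType K) (x : A) : idlin A x = x.
Proof. exact: mklinE. Qed.

Lemma zerolin_subproof (K : fieldType) (A B : lmodType K) :
  linear (fun _ : A => 0 : B).
Proof. by move=> c x y; rewrite scaler0 addr0. Qed.

Definition zerolin (K : fieldType) (A B : lmodType K) : {linear A -> B} :=
  mklin (@zerolin_subproof K A B).

Lemma zerolinE (K : fieldType) (A B : lmodType K) (x : A) : zerolin A B x = 0.
Proof. exact: mklinE. Qed.

Lemma complin_subproof (K : fieldType) (A B C : lmodType K)
  (g : {linear B -> C}) (f : {linear A -> B}) : linear (fun x => g (f x)).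
Proof. by move=> c x y; rewrite !linearP. Qed.

Definition complin (K : fieldType) (A B C : lmodType K)
    (g : {linear B -> C}) (f : {linear A -> B}) : {linear A -> C} :=
  mklin (complin_subproof g f).

Lemma complinE (K : fieldType) (A B C : lmodType K)
  (g : {linear B -> C}) (f : {linear A -> B}) x : complin g f x = g (f x).
Proof. exact: mklinE. Qed.

Notation "g \oL f" := (complin g f) (at level 50, left associativity).

Lemma scalelin_subproof (K : fieldType) (A B : lmodType K) (c : K)
  (f : {linear A -> B}) : linear (fun x => c *: f x).
Proof. by move=> d x y; rewrite linearP scalerDr !scalerA mulrC. Qed.

Definition scalelin (K : fieldType) (A B : lmodType K) (c : K)
    (f : {linear A -> B}) : {linear A -> B} :=
  mklin (scalelin_subproof c f).

Lemma scalelinE (K : fieldType) (A B : lmodType K) (c : K)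
  (f : {linear A -> B}) x : scalelin c f x = c *: f x.
Proof. exact: mklinE. Qed.

Lemma addlin_subproof (K : fieldType) (A B : lmodType K)
  (f g : {linear A -> B}) : linear (fun x => f x + g x).
Proof. by move=> d x y; rewrite !linearP scalerDr addrACA. Qed.

Definition addlin (K : fieldType) (A B : lmodType K)
    (f g : {linear A -> B}) : {linear A -> B} :=
  mklin (addlin_subproof f g).

Lemma addlinE (K : fieldType) (A B : lmodType K) (f g : {linear A -> B}) x :
  addlin f g x = f x + g x.
Proof. exact: mklinE. Qed.

Lemma sumlin_subproof (K : fieldType) (A B : lmodType K) (n : nat)
  (f : nat -> {linear A -> B}) : linear (fun x => \sum_(i < n) f i x).
Proof.
move=> d x y; rewrite scaler_sumr -big_split /=.
by apply: eq_bigr => i _; rewrite linearP.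
Qed.

Definition sumlin (K : fieldType) (A B : lmodType K) (n : nat)
    (f : nat -> {linear A -> B}) : {linear A -> B} :=
  mklin (sumlin_subproof n f).

Lemma sumlinE (K : fieldType) (A B : lmodType K) (n : nat)
  (f : nat -> {linear A -> B}) x : sumlin n f x = \sum_(i < n) f i x.
Proof. exact: mklinE. Qed.

Fixpoint powlin (K : fieldType) (A : lmodType K) (f : {linear A -> A})
    (n : nat) : {linear A -> A} :=
  if n is n'.+1 then f \oL powlin f n' else idlin A.

Inductive term (K : fieldType) (G : Type) : Type :=
| TGen of G
| TZero
| TAdd of term K G & term K G
| TScale of K & term K G.
Arguments TGen {K G}.
Arguments TZero {K G}.

HB.instance Definition _ (K : fieldType) (G : Type) := gen_eqMixin (term K G).
HB.instance Definition _ (K : fieldType) (G : Type) :=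
  gen_choiceMixin (term K G).

Inductive teq (K : fieldType) (G : Type) (R : term K G -> term K G -> Prop) :
    term K G -> term K G -> Prop :=
| teq_refl s : teq R s s
| teq_sym s t : teq R s t -> teq R t s
| teq_trans s t u : teq R s t -> teq R t u -> teq R s u
| teq_add s s' t t' : teq R s s' -> teq R t t' -> teq R (TAdd s t) (TAdd s' t')
| teq_scale c s s' : teq R s s' -> teq R (TScale c s) (TScale c s')
| teq_addA s t u : teq R (TAdd s (TAdd t u)) (TAdd (TAdd s t) u)
| teq_addC s t : teq R (TAdd s t) (TAdd t s)
| teq_add0 s : teq R (TAdd TZero s) s
| teq_addN s : teq R (TAdd (TScale (-1) s) s) TZero
| teq_scaleA c d s : teq R (TScale c (TScale d s)) (TScale (c * d) s)
| teq_scale1 s : teq R (TScale 1 s) s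
| teq_scaleDr c s t :
    teq R (TScale c (TAdd s t)) (TAdd (TScale c s) (TScale c t))
| teq_scaleDl c d s :
    teq R (TScale (c + d) s) (TAdd (TScale c s) (TScale d s))
| teq_rel s t : R s t -> teq R s t.

Section Presented.
Variables (K : fieldType) (G : Type) (R : term K G -> term K G -> Prop).

Definition teqb (s t : term K G) : bool := `[< teq R s t >].

Lemma teqb_refl : reflexive teqb.
Proof. by move=> s; apply/asboolP; exact: teq_refl. Qed.

Lemma teqb_sym : symmetric teqb.
Proof.
by move=> s t; apply/asboolP/asboolP => ?; exact: teq_sym.
Qed.

Lemma teqb_trans : transitive teqb.
Proof.
move=> t s u /asboolP h1 /asboolP h2; apply/asboolP; exact: teq_trans h1 h2.
Qed.

Canonical teqb_equiv := EquivRel teqb teqb_refl teqb_sym teqb_trans.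

Definition presented : Type := {eq_quot teqb_equiv}.
HB.instance Definition _ := Choice.on presented.
HB.instance Definition _ := Quotient.on presented.

Lemma presP s t : (\pi_presented s = \pi_presented t) <-> teq R s t.
Proof.
split=> [/eqmodP /asboolP //|h].
by apply/eqmodP/asboolP.
Qed.

Lemma repr_teq s : teq R (repr (\pi_presented s)) s.
Proof. by apply/presP; rewrite reprK. Qed.

Definition pres_add (a b : presented) : presented :=
  \pi_presented (TAdd (repr a) (repr b)).
Definition pres_scale (c : K) (a : presented) : presented :=
  \pi_presented (TScale c (repr a)).
Definition pres_zero : presented := \pi_presented TZero.
Definition pres_opp (a : presented) : presented := pres_scale (-1) a.

Lemma pres_addE s t :
  pres_add (\pi_presented s) (\pi_presented t) = \pi_presented (TAdd s t).
Proof. by apply/presP; apply: teq_add; exact: repr_teq. Qed.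

Lemma pres_scaleE c s :
  pres_scale c (\pi_presented s) = \pi_presented (TScale c s).
Proof. by apply/presP; apply: teq_scale; exact: repr_teq. Qed.

Lemma pres_addA : associative pres_add.
Proof.
elim/quotW=> s; elim/quotW=> t; elim/quotW=> u.
rewrite (pres_addE t u) (pres_addE s) (pres_addE s t) pres_addE.
by apply/presP; exact: teq_addA.
Qed.

Lemma pres_addC : commutative pres_add.
Proof.
elim/quotW=> s; elim/quotW=> t.
rewrite (pres_addE s t) (pres_addE t s).
by apply/presP; exact: teq_addC.
Qed.

Lemma pres_add0 : left_id pres_zero pres_add.
Proof.
elim/quotW=> s; rewrite pres_addE.
by apply/presP; exact: teq_add0.
Qed.

Lemma pres_addN : left_inverse pres_zero pres_opp pres_add.
Proof.
elim/quotW=> s.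
rewrite /pres_opp (pres_scaleE _ s) (pres_addE _ s).
by apply/presP; exact: teq_addN.
Qed.

HB.instance Definition _ :=
  GRing.isZmodule.Build presented pres_addA pres_addC pres_add0 pres_addN.

Lemma pres_scaleA c d a :
  pres_scale c (pres_scale d a) = pres_scale (c * d) a.
Proof.
elim/quotW: a => s.
rewrite (pres_scaleE d s) (pres_scaleE c) (pres_scaleE _ s).
by apply/presP; exact: teq_scaleA.
Qed.

Lemma pres_scale1 : left_id 1 pres_scale.
Proof.
elim/quotW=> s; rewrite pres_scaleE.
by apply/presP; exact: teq_scale1.
Qed.

Lemma pres_scaleDr : right_distributive pres_scale +%R.
Proof.
move=> c; elim/quotW=> s; elim/quotW=> t.
change (pres_scale c (pres_add (\pi_presented s) (\pi_presented t))
  = pres_add (pres_scale c (\pi_presented s)) (pres_scale c (\pi_presented t))).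
rewrite (pres_addE s t) (pres_scaleE c (TAdd s t)) (pres_scaleE c s).
rewrite (pres_scaleE c t) pres_addE.
by apply/presP; exact: teq_scaleDr.
Qed.

Lemma pres_scaleDl a : {morph pres_scale^~ a : c d / c + d}.
Proof.
elim/quotW: a => s c d.
change (pres_scale (c + d) (\pi_presented s)
  = pres_add (pres_scale c (\pi_presented s)) (pres_scale d (\pi_presented s))).
rewrite (pres_scaleE _ s) (pres_scaleE c s) (pres_scaleE d s) pres_addE.
by apply/presP; exact: teq_scaleDl.
Qed.

HB.instance Definition _ :=
  GRing.Zmodule_isLmodule.Build K presented
    pres_scaleA pres_scale1 pres_scaleDr pres_scaleDl.

Lemma pres_add_pi s t : \pi_presented s + \pi_presented t
  = \pi_presented (TAdd s t).
Proof. exact: pres_addE. Qed.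

Lemma pres_scale_pi c s : c *: \pi_presented s = \pi_presented (TScale c s).
Proof. exact: pres_scaleE. Qed.

Definition pres_gen (g : G) : presented := \pi_presented (TGen g).

Section Lift.
Variables (W : lmodType K) (f : G -> W).

Fixpoint teval (t : term K G) : W :=
  match t with
  | TGen g => f g
  | TZero => 0
  | TAdd s t => teval s + teval t
  | TScale c s => c *: teval s
  end.

Hypothesis fR : forall s t, R s t -> teval s = teval t.

Lemma teval_teq s t : teq R s t -> teval s = teval t.
Proof.
elim=> //=; try by intros; congruence.
- by move=> *; rewrite addrA.
- by move=> *; rewrite addrC.
- by move=> *; rewrite add0r.
- by move=> *; rewrite scaleN1r addNr.
- by move=> *; rewrite scalerA.
- by move=> *; rewrite scale1r.
- by move=> *; rewrite scalerDr.
- by move=> *; rewrite scalerDl.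
Qed.

Definition pres_fun (a : presented) : W := teval (repr a).

Lemma pres_funE s : pres_fun (\pi_presented s) = teval s.
Proof. exact: teval_teq (repr_teq s). Qed.

Lemma pres_fun_linear : linear pres_fun.
Proof.
move=> c; elim/quotW=> s; elim/quotW=> t.
by rewrite (pres_scale_pi c s) (pres_add_pi _ t) !pres_funE.
Qed.

Definition pres_lift : {linear presented -> W} := mklin pres_fun_linear.

Lemma pres_liftE g : pres_lift (pres_gen g) = f g.
Proof. rewrite mklinE; exact: pres_funE. Qed.

End Lift.

Lemma pres_ind (P : presented -> Prop) :
  P 0 -> (forall c a b, P a -> P b -> P (c *: a + b)) ->
  (forall g, P (pres_gen g)) -> forall a, P a.
Proof.
move=> P0 PD PG a; rewrite -[a]reprK; elim: (repr a) => [g||s Ps t Pt|c s Ps].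
- exact: PG.
- exact: P0.
- by rewrite -pres_add_pi -[X in X + _]scale1r; exact: PD.
- by rewrite -pres_scale_pi -[_ *: _]addr0; exact: PD.
Qed.

Lemma pres_lin_ext (W : lmodType K) (f g : {linear presented -> W}) :
  (forall x, f (pres_gen x) = g (pres_gen x)) -> f =1 g.
Proof.
move=> fg; elim/pres_ind => [|c a b fa fb|//]; first by rewrite !linear0.
by rewrite !linearP fa fb.
Qed.

End Presented.

Inductive tens_rel (K : fieldType) (A B : lmodType K) :
    term K (A * B) -> term K (A * B) -> Prop :=
| tens_relL c a a' b : tens_rel (TGen (c *: a + a', b))
    (TAdd (TScale c (TGen (a, b))) (TGen (a', b)))
| tens_relR c a b b' : tens_rel (TGen (a, c *: b + b'))
    (TAdd (TScale c (TGen (a, b))) (TGen (a, b'))).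

Definition tens (K : fieldType) (A B : lmodType K) : lmodType K :=
  presented (@tens_rel K A B).

Section Tensor.
Variable K : fieldType.
Implicit Types A B C D W : lmodType K.

Definition tpure A B (a : A) (b : B) : tens A B :=
  pres_gen (@tens_rel K A B) (a, b).

Lemma tpureDl A B c (a a' : A) (b : B) :
  tpure (c *: a + a') b = c *: tpure a b + tpure a' b.
Proof.
rewrite /tpure /pres_gen pres_scale_pi pres_add_pi.
by apply/presP/teq_rel; constructor.
Qed.

Lemma tpureDr A B c (a : A) (b b' : B) :
  tpure a (c *: b + b') = c *: tpure a b + tpure a b'.
Proof.
rewrite /tpure /pres_gen pres_scale_pi pres_add_pi.
by apply/presP/teq_rel; constructor.
Qed.

Section Lift.
Variables (A B W : lmodType K) (f : A -> B -> W).
Hypothesis fl : forall b, linear (f^~ b).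
Hypothesis fr : forall a, linear (f a).

Lemma tlift_subproof s t : tens_rel s t ->
  teval (fun p => f p.1 p.2) s = teval (fun p => f p.1 p.2) t.
Proof. by case=> c a b b' /=; rewrite ?fl ?fr. Qed.

Definition tlift : {linear tens A B -> W} := pres_lift tlift_subproof.

Lemma tliftE a b : tlift (tpure a b) = f a b.
Proof. exact: (pres_liftE tlift_subproof (a, b)). Qed.

End Lift.

Lemma tens_lin_ext A B W (f g : {linear tens A B -> W}) :
  (forall a b, f (tpure a b) = g (tpure a b)) -> f =1 g.
Proof. by move=> fg; apply: pres_lin_ext => -[a b]; exact: fg. Qed.

Section Map.
Variables (A B C D : lmodType K) (f : {linear A -> C}) (g : {linear B -> D}).

Lemma tmap_subproofl b : linear (fun a => tpure (f a) (g b)).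
Proof. by move=> c a a'; rewrite linearP tpureDl. Qed.

Lemma tmap_subproofr a : linear (fun b => tpure (f a) (g b)).
Proof. by move=> c b b'; rewrite linearP tpureDr. Qed.

(* The tensor product of linear maps WITHOUT Koszul sign:
   a (x) b |-> f a (x) g b. *)
Definition tmap : {linear tens A B -> tens C D} :=
  tlift tmap_subproofl tmap_subproofr.

Lemma tmapE a b : tmap (tpure a b) = tpure (f a) (g b).
Proof. exact: tliftE. Qed.

End Map.

Section Assoc.
Variables (A B C : lmodType K).

Lemma tassoc1_subproofl (c : C) (b : B) :
  linear (fun a : A => tpure a (tpure b c)).
Proof. by move=> k a a'; rewrite tpureDl. Qed.

Lemma tassoc1_subproofr (c : C) (a : A) :
  linear (fun b : B => tpure a (tpure b c)).
Proof. by move=> k b b'; rewrite tpureDl tpureDr. Qed.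

Definition tassoc1 (c : C) : {linear tens A B -> tens A (tens B C)} :=
  tlift (tassoc1_subproofl c) (tassoc1_subproofr c).

Lemma tassoc_subproofl (c : C) : linear (fun t : tens A B => tassoc1 c t).
Proof. by move=> k s t; rewrite linearP. Qed.

Lemma tassoc_subproofr (t : tens A B) : linear (fun c : C => tassoc1 c t).
Proof.
move=> k c c'.
elim/pres_ind: t => [|d t t' IH IH'|[a b]].
- by rewrite !linear0 ?scaler0 ?addr0.
- rewrite !linearP IH IH' !scalerDr !scalerA [d * k]mulrC.
  by rewrite -!addrA; congr (_ + _); rewrite addrCA.
- by rewrite !tliftE !tpureDr.
Qed.

Definition tassoc : {linear tens (tens A B) C -> tens A (tens B C)} :=
  tlift tassoc_subproofl tassoc_subproofr.

Lemma tassocE a b c : tassoc (tpure (tpure a b) c) = tpure a (tpure b c).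
Proof. by rewrite /tassoc !tliftE. Qed.

End Assoc.
End Tensor.

(* V is the internal direct sum of the images of the orthogonal projections
   gpr i, i.e. of its homogeneous components. *)
Record gvect (K : fieldType) := GVect {
  gsort :> lmodType K;
  gpr : int -> {linear gsort -> gsort};
  gprK : forall i j x, gpr i (gpr j x) = if i == j then gpr j x else 0;
  gpr_sum : forall x, exists2 s : seq int, uniq s & x = \sum_(i <- s) gpr i x
}.
Arguments gpr {K} V i : rename.

Definition hom (K : fieldType) (V : gvect K) (i : int) (x : V) : Prop :=
  gpr V i x = x.

(* V[i]^k = V^(i+k) *)
Lemma shift_subproofK (K : fieldType) (V : gvect K) (d i j : int) (x : V) :
  gpr V (d + i) (gpr V (d + j) x) = if i == j then gpr V (d + j) x else 0.
Proof. by rewrite gprK (inj_eq (addrI d)). Qed.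

Lemma shift_subproof_sum (K : fieldType) (V : gvect K) (d : int) (x : V) :
  exists2 s : seq int, uniq s & x = \sum_(i <- s) gpr V (d + i) x.
Proof.
have [s us {1}->] := gpr_sum x.
exists [seq i - d | i <- s]; first by rewrite map_inj_uniq //; exact: subIr.
rewrite big_map; apply: eq_bigr => i _; by rewrite addrC subrK.
Qed.

Definition shift (K : fieldType) (d : int) (V : gvect K) : gvect K :=
  @GVect K V (fun i => gpr V (d + i))
    (@shift_subproofK K V d) (@shift_subproof_sum K V d).

Section Weights.
Variables (K : fieldType) (V : gvect K).

Definition gsupp (x : V) : seq int := s2val (cid2 (gpr_sum x)).

Lemma gsupp_uniq x : uniq (gsupp x).
Proof. exact: s2valP (cid2 (gpr_sum x)). Qed.

Lemma gsuppE x : x = \sum_(i <- gsupp x) gpr V i x.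
Proof. exact: s2valP' (cid2 (gpr_sum x)). Qed.

Lemma gsupp_out x i : i \notin gsupp x -> gpr V i x = 0.
Proof.
move=> ni; rewrite [X in gpr V i X]gsuppE linear_sum /= big1_seq // => j /andP[_ js].
by rewrite gprK; case: eqP => // ij; rewrite ij js in ni.
Qed.

(* The linear map acting by the scalar c i on the component of degree i. *)
Definition gweight_fun (c : int -> K) (x : V) : V :=
  \sum_(i <- gsupp x) c i *: gpr V i x.

Lemma sum_supp_sub (s u : seq int) (F : int -> V) : uniq s -> uniq u ->
  {subset s <= u} -> (forall i, i \notin s -> F i = 0) ->
  \sum_(i <- s) F i = \sum_(i <- u) F i.
Proof.
move=> us uu su F0; rewrite [RHS](bigID (mem s)) /=.
rewrite [X in _ + X]big1 ?addr0 => [|i /F0 //].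
rewrite -[RHS]big_filter; apply: perm_big; apply: uniq_perm => //.
  exact: filter_uniq.
move=> i; rewrite mem_filter /=; case: (boolP (i \in s)) => //= is_.
by rewrite su.
Qed.

Lemma gweight_linear c : linear (gweight_fun c).
Proof.
move=> k x y; pose u := undup (gsupp x ++ gsupp y ++ gsupp (k *: x + y)).
have uu : uniq u by exact: undup_uniq.
have E z : {subset gsupp z <= u} ->
    gweight_fun c z = \sum_(i <- u) c i *: gpr V i z.
  move=> zu; apply: sum_supp_sub => //; first exact: gsupp_uniq.
  by move=> i /gsupp_out ->; rewrite scaler0.
rewrite !E.
- rewrite scaler_sumr -big_split /=; apply: eq_bigr => i _.
  by rewrite linearP scalerDr !scalerA mulrC.
- by move=> i iz; rewrite mem_undup !mem_cat iz !orbT.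
- by move=> i iz; rewrite mem_undup !mem_cat iz.
- by move=> i iz; rewrite mem_undup !mem_cat iz !orbT.
Qed.

Definition gweight (c : int -> K) : {linear V -> V} := mklin (gweight_linear c).

Lemma gweight_hom c i x : hom i x -> gweight c x = c i *: x.
Proof.
move=> hx; rewrite mklinE /gweight_fun -{3}hx.
have F0 j : j != i -> gpr V j x = 0.
  by move=> ji; rewrite -hx gprK (negPf ji).
have [ix|nix] := boolP (i \in gsupp x).
  rewrite (bigD1_seq i) ?gsupp_uniq //= big1 ?addr0 // => j ji.
  by rewrite F0 // scaler0.
rewrite (gsupp_out nix) scaler0 big1_seq // => j /andP[_ jx].
by rewrite F0 ?scaler0 //; apply: contraNneq nix => <-.
Qed.

Definition sgnz (i : int) : K := (-1) ^+ odd `|i|.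

Definition gsgn : {linear V -> V} := gweight sgnz.

Definition gpar (b : bool) : {linear V -> V} :=
  gweight (fun i => (odd `|i| == b)%:R).

End Weights.
Arguments gsgn {K} V.
Arguments gpar {K} V b.
Arguments sgnz {K} i.

(* Sym(V) is spanned by the words x1 \/ ... \/ xn, multilinear in the letters
   and graded commutative. *)
Inductive sym_rel (K : fieldType) (V : gvect K) :
    term K (seq V) -> term K (seq V) -> Prop :=
| sym_rel_lin u w c (x y : V) : sym_rel (TGen (u ++ (c *: x + y) :: w))
    (TAdd (TScale c (TGen (u ++ x :: w))) (TGen (u ++ y :: w)))
| sym_rel_comm u w i j (x y : V) : hom i x -> hom j y ->
    sym_rel (TGen (u ++ x :: y :: w))
            (TScale (sgnz (i * j)) (TGen (u ++ y :: x :: w))).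

Definition Sym (K : fieldType) (V : gvect K) : lmodType K :=
  presented (@sym_rel K V).

Section Symmetric.
Variables (K : fieldType) (V : gvect K).

Definition word (w : seq V) : Sym V := pres_gen (@sym_rel K V) w.
Definition sym1 : Sym V := word [::].

Lemma word_lin u w c x y :
  word (u ++ (c *: x + y) :: w) = c *: word (u ++ x :: w) + word (u ++ y :: w).
Proof.
rewrite /word /pres_gen pres_scale_pi pres_add_pi.
by apply/presP/teq_rel; constructor.
Qed.

Lemma word_comm u w i j x y : hom i x -> hom j y ->
  word (u ++ x :: y :: w) = sgnz (i * j) *: word (u ++ y :: x :: w).
Proof.
move=> hx hy; rewrite /word /pres_gen pres_scale_pi.
by apply/presP/teq_rel; constructor.
Qed.

Section Lift.
Variables (W : lmodType K) (f : seq V -> W).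
Hypothesis flin : forall u w c x y,
  f (u ++ (c *: x + y) :: w) = c *: f (u ++ x :: w) + f (u ++ y :: w).
Hypothesis fcomm : forall u w i j x y, hom i x -> hom j y ->
  f (u ++ x :: y :: w) = sgnz (i * j) *: f (u ++ y :: x :: w).

Lemma sym_lift_subproof s t : sym_rel s t -> teval f s = teval f t.
Proof. by case=> [u w c x y|u w i j x y hx hy] /=; [exact: flin|exact: fcomm]. Qed.

Definition sym_lift : {linear Sym V -> W} := pres_lift sym_lift_subproof.

Lemma sym_liftE w : sym_lift (word w) = f w.
Proof. exact: (pres_liftE sym_lift_subproof w). Qed.

End Lift.

Lemma sym_lin_ext (W : lmodType K) (f g : {linear Sym V -> W}) :
  (forall w, f (word w) = g (word w)) -> f =1 g.
Proof. exact: pres_lin_ext. Qed.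

Section Vee.
Variable z : V.

Lemma vee_lin u w c x y : word (z :: u ++ (c *: x + y) :: w)
  = c *: word (z :: u ++ x :: w) + word (z :: u ++ y :: w).
Proof. exact: (word_lin (z :: u)). Qed.

Lemma vee_comm u w i j x y : hom i x -> hom j y ->
  word (z :: u ++ x :: y :: w) = sgnz (i * j) *: word (z :: u ++ y :: x :: w).
Proof. exact: (word_comm (z :: u)). Qed.

Definition vee : {linear Sym V -> Sym V} :=
  @sym_lift _ (fun w => word (z :: w)) vee_lin vee_comm.

Lemma veeE w : vee (word w) = word (z :: w).
Proof. exact: sym_liftE. Qed.

End Vee.

Lemma vee_linear a : linear (fun z => vee z a).
Proof.
move=> c x y.
elim/pres_ind: a => [|d a b IHa IHb|w].
- by rewrite !linear0 ?scaler0 ?addr0.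
- rewrite !linearP IHa IHb !scalerDr !scalerA [d * c]mulrC.
  by rewrite -!addrA; congr (_ + _); rewrite addrCA.
- by rewrite !veeE (word_lin [::]).
Qed.

Lemma vee_commE i j x y a : hom i x -> hom j y ->
  vee x (vee y a) = sgnz (i * j) *: vee y (vee x a).
Proof.
move=> hx hy.
elim/pres_ind: a => [|d a b IHa IHb|w].
- by rewrite !linear0 ?scaler0.
- by rewrite !linearP IHa IHb.
- by rewrite !veeE (word_comm [::] _ hx hy).
Qed.

Lemma gsgn_hom i (x : V) : hom i x -> gsgn V x = sgnz i *: x.
Proof. exact: gweight_hom. Qed.

Lemma ssgn_lin u w c x y : word (map (gsgn V) (u ++ (c *: x + y) :: w))
  = c *: word (map (gsgn V) (u ++ x :: w)) + word (map (gsgn V) (u ++ y :: w)).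
Proof. by rewrite !map_cat !map_cons linearP word_lin. Qed.

Lemma hom_gsgn i (x : V) : hom i x -> hom i (gsgn V x).
Proof. by move=> hx; rewrite (gsgn_hom hx) /hom linearZ /= hx. Qed.

Lemma ssgn_comm u w i j x y : hom i x -> hom j y ->
  word (map (gsgn V) (u ++ x :: y :: w))
  = sgnz (i * j) *: word (map (gsgn V) (u ++ y :: x :: w)).
Proof.
move=> hx hy; rewrite !map_cat !map_cons.
exact: (word_comm _ _ (hom_gsgn hx) (hom_gsgn hy)).
Qed.

(* The grading involution of Sym(V): a |-> (-1)^|a| a on homogeneous a. *)
Definition ssgn : {linear Sym V -> Sym V} := 
  @sym_lift _ (fun w => word (map (gsgn V) w)) ssgn_lin ssgn_comm.

Lemma ssgnE w : ssgn (word w) = word (map (gsgn V) w).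
Proof. exact: sym_liftE. Qed.

Lemma ssgn_vee x a : ssgn (vee x a) = vee (gsgn V x) (ssgn a).
Proof.
elim/pres_ind: a => [|d a b IHa IHb|w].
- by rewrite !linear0.
- by rewrite !linearP IHa IHb.
- by rewrite veeE !ssgnE veeE.
Qed.

Section Proj.
Variable k : nat.

Definition spr_word (w : seq V) : Sym V :=
  if size w == k then word w else 0.

Lemma spr_lin u w c x y : spr_word (u ++ (c *: x + y) :: w)
  = c *: spr_word (u ++ x :: w) + spr_word (u ++ y :: w).
Proof.
rewrite /spr_word !size_cat /=; case: eqP => _; first exact: word_lin.
by rewrite scaler0 addr0.
Qed.

Lemma spr_comm u w i j x y : hom i x -> hom j y ->
  spr_word (u ++ x :: y :: w) = sgnz (i * j) *: spr_word (u ++ y :: x :: w).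
Proof.
move=> hx hy; rewrite /spr_word !size_cat /=; case: eqP => _.
  exact: word_comm.
by rewrite scaler0.
Qed.

Definition spr : {linear Sym V -> Sym V} := @sym_lift _ spr_word spr_lin spr_comm.

End Proj.

Definition spr1_word (w : seq V) : V := if w is [:: x] then x else 0.

Lemma spr1_lin u w c x y : spr1_word (u ++ (c *: x + y) :: w)
  = c *: spr1_word (u ++ x :: w) + spr1_word (u ++ y :: w).
Proof.
by case: u => [|z [|z' u]]; case: w => [|z'' w] //=; rewrite scaler0 addr0.
Qed.

Lemma spr1_comm u w i j x y : hom i x -> hom j y ->
  spr1_word (u ++ x :: y :: w) = sgnz (i * j) *: spr1_word (u ++ y :: x :: w).
Proof. by move=> _ _; case: u => [|z [|z' u]] /=; rewrite scaler0. Qed.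

Definition spr1 : {linear Sym V -> V} := @sym_lift _ spr1_word spr1_lin spr1_comm.

Definition seps_word (w : seq V) : K^o := if w is [::] then 1 else 0.

Lemma seps_lin u w c x y : seps_word (u ++ (c *: x + y) :: w)
  = c *: seps_word (u ++ x :: w) + seps_word (u ++ y :: w).
Proof. by case: u => [|z u] /=; rewrite scaler0 addr0. Qed.

Lemma seps_comm u w i j x y : hom i x -> hom j y ->
  seps_word (u ++ x :: y :: w) = sgnz (i * j) *: seps_word (u ++ y :: x :: w).
Proof. by move=> _ _; case: u => [|z u] /=; rewrite scaler0. Qed.

Definition seps : {linear Sym V -> K^o} := @sym_lift _ seps_word seps_lin seps_comm.

(* Shuffle coproduct: the multiplicative extension of
   x |-> x (x) 1 + 1 (x) x for the graded product of Sym(V) (x) Sym(V), i.e.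
   Delta (x \/ a) = (x (x) 1 + 1 (x) x) Delta a, where
   (1 (x) x)(b (x) c) = (-1)^(|x||b|) b (x) (x \/ c).
   On words this is the signed sum over all shuffles. *)
Definition prim_mul (x : V) : {linear tens (Sym V) (Sym V) -> tens (Sym V) (Sym V)} :=
  addlin (tmap (vee x) (idlin _))
    (addlin (tmap (idlin _) (vee (gpar V false x)))
            (tmap ssgn (vee (gpar V true x)))).

Definition sdelta_word (w : seq V) : tens (Sym V) (Sym V) :=
  foldr (fun x t => prim_mul x t) (tpure sym1 sym1) w.

Lemma prim_mulE x a b : prim_mul x (tpure a b) = tpure (vee x a) b
  + (tpure a (vee (gpar V false x) b) + tpure (ssgn a) (vee (gpar V true x) b)).
Proof. by rewrite /prim_mul !addlinE !tmapE !idlinE. Qed.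

Lemma tpure0l (A B : lmodType K) (b : B) : tpure (0 : A) b = 0.
Proof.
have := tpureDl 1 (0 : A) 0 b; rewrite scaler0 addr0 scale1r => h.
by apply: (addrI (tpure 0 b)); rewrite addr0 -h.
Qed.

Lemma tpure0r (A B : lmodType K) (a : A) : tpure a (0 : B) = 0.
Proof.
have := tpureDr 1 a (0 : B) 0; rewrite scaler0 addr0 scale1r => h.
by apply: (addrI (tpure a 0)); rewrite addr0 -h.
Qed.

Lemma tpureZl (A B : lmodType K) c (a : A) (b : B) :
  tpure (c *: a) b = c *: tpure a b.
Proof. by have := tpureDl c a 0 b; rewrite tpure0l !addr0. Qed.

Lemma tpureZr (A B : lmodType K) c (a : A) (b : B) :
  tpure a (c *: b) = c *: tpure a b.
Proof. by have := tpureDr c a b 0; rewrite tpure0r !addr0. Qed.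

Lemma veeZ c x a : vee (c *: x) a = c *: vee x a.
Proof. by have := linearZ_LR (mklin (vee_linear a)) c x; rewrite !mklinE. Qed.

Lemma vee0 a : vee 0 a = 0.
Proof. by have := linear0 (mklin (vee_linear a)); rewrite mklinE. Qed.

Lemma addr3ACA (A : zmodType) (a a' b b' c c' : A) :
  a + a' + (b + b' + (c + c')) = a + (b + c) + (a' + (b' + c')).
Proof. by rewrite (addrACA b) (addrACA a). Qed.

Lemma prim_mul_linear t : linear (fun x => prim_mul x t).
Proof.
move=> c x y; elim/pres_ind: t => [|d s t IHs IHt|[a b]].
- by rewrite !linear0 ?scaler0 ?addr0.
- rewrite !(linearP (prim_mul _)) IHs IHt.
  move: (prim_mul x s) (prim_mul y s) (prim_mul x t) (prim_mul y t).
  move=> p q p' q'; rewrite !scalerDr !scalerA [d * c]mulrC.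
  by rewrite -!addrA; congr (_ + _); rewrite addrCA.
- change (prim_mul (c *: x + y) (tpure a b) =
    c *: prim_mul x (tpure a b) + prim_mul y (tpure a b)).
  rewrite !prim_mulE !linearP !vee_linear tpureDl !tpureDr !scalerDr.
  exact: addr3ACA.
Qed.

Lemma prim_mul_hom i x a b : hom i x -> prim_mul x (tpure a b) =
  tpure (vee x a) b + tpure (if odd `|i| then ssgn a else a) (vee x b).
Proof.
move=> hx; rewrite prim_mulE !(gweight_hom _ hx) !veeZ !tpureZr.
by case: odd; rewrite /= scale0r scale1r ?add0r ?addr0.
Qed.

Lemma odd_mulz (i j : int) : odd `|i * j| = odd `|i| && odd `|j|.
Proof. by rewrite abszM oddM. Qed.

Lemma prim_mul_comm i j x y t : hom i x -> hom j y ->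
  prim_mul x (prim_mul y t) = sgnz (i * j) *: prim_mul y (prim_mul x t).
Proof.
move=> hx hy; elim/pres_ind: t => [|d s t IHs IHt|[a b]].
- by rewrite !linear0 ?scaler0.
- rewrite !(linearP (prim_mul _)) IHs IHt.
  move: (prim_mul y (prim_mul x s)) (prim_mul y (prim_mul x t)) => p q.
  by rewrite scalerDr !scalerA [d * _]mulrC.
- change (prim_mul x (prim_mul y (tpure a b)) =
    sgnz (i * j) *: prim_mul y (prim_mul x (tpure a b))).
  rewrite (prim_mul_hom _ _ hx) (prim_mul_hom _ _ hy) !(linearD (prim_mul _)).
  rewrite !(prim_mul_hom _ _ hx) !(prim_mul_hom _ _ hy).
  rewrite (vee_commE a hx hy) (vee_commE b hx hy) !scalerDr tpureZl tpureZr.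
  rewrite [RHS]addrACA /sgnz odd_mulz.
  case oi: (odd `|i|); case oj: (odd `|j|) => /=;
  by rewrite ?ssgn_vee ?(gsgn_hom hx) ?(gsgn_hom hy) /sgnz ?oi ?oj /=
    ?expr0 ?expr1 ?scale1r ?veeZ ?tpureZl ?tpureZr ?scalerA ?mulN1r ?opprK
    ?mulr1 ?mul1r ?scale1r.
Qed.

Lemma sdelta_lin u w c x y : sdelta_word (u ++ (c *: x + y) :: w)
  = c *: sdelta_word (u ++ x :: w) + sdelta_word (u ++ y :: w).
Proof.
elim: u => [|z u IH] /=; first exact: prim_mul_linear.
by rewrite IH linearP.
Qed.

Lemma sdelta_comm u w i j x y : hom i x -> hom j y ->
  sdelta_word (u ++ x :: y :: w) = sgnz (i * j) *: sdelta_word (u ++ y :: x :: w).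
Proof.
move=> hx hy; elim: u => [|z u IH] /=; first exact: prim_mul_comm.
by rewrite IH linearZ.
Qed.

Definition sdelta : {linear Sym V -> tens (Sym V) (Sym V)} :=
  @sym_lift _ sdelta_word sdelta_lin sdelta_comm.

Lemma sdeltaE w : sdelta (word w) = sdelta_word w.
Proof. exact: sym_liftE. Qed.

Lemma sdelta_vee x a : sdelta (vee x a) = prim_mul x (sdelta a).
Proof.
elim/pres_ind: a => [|d a b IHa IHb|w].
- by rewrite !linear0.
- by rewrite !linearP IHa IHb.
- by rewrite veeE !sdeltaE.
Qed.

End Symmetric.
Arguments sym1 {K} V.
Arguments ssgn {K} V.
Arguments spr {K} V k.
Arguments spr1 {K} V.
Arguments seps {K} V.
Arguments sdelta {K} V.

Inductive lspan (K : fieldType) (A : lmodType K) (P : A -> Prop) : A -> Prop :=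
| lspan0 : lspan P 0
| lspan_gen a : P a -> lspan P a
| lspan_lin c a b : lspan P a -> lspan P b -> lspan P (c *: a + b).

Section Spans.
Variable K : fieldType.

Definition sym_hom (V : gvect K) (d : int) : Sym V -> Prop :=
  lspan (fun a => exists w : seq (int * V),
    [/\ forall p, p \in w -> hom p.1 p.2, \sum_(p <- w) p.1 = d &
        a = word (map snd w)]).

Definition tens_hom (A B : lmodType K) (hA : int -> A -> Prop)
    (hB : int -> B -> Prop) (d : int) : tens A B -> Prop :=
  lspan (fun t => exists i j a b,
    [/\ hA i a, hB j b, i + j = d & t = tpure a b]).

Definition degree_map (A B : Type) (hA : int -> A -> Prop)
    (hB : int -> B -> Prop) (d : int) (f : A -> B) : Prop :=
  forall i a, hA i a -> hB (i + d) (f a).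

Definition filtered_map (A B : Type) (fA : int -> A -> Prop)
    (fB : int -> B -> Prop) (f : A -> B) : Prop :=
  forall k a, fA k a -> fB k (f a).

Definition converges (A : zmodType) (fA : int -> A -> Prop) (u : nat -> A)
    (l : A) : Prop :=
  forall k, exists n0, forall n, (n0 <= n)%N -> fA k (u n - l).

Definition cauchy (A : zmodType) (fA : int -> A -> Prop) (u : nat -> A) : Prop :=
  forall k, exists n0, forall m n, (n0 <= m)%N -> (n0 <= n)%N ->
    fA k (u m - u n).

Definition series (A : zmodType) (u : nat -> A) (n : nat) : A :=
  \sum_(i < n) u i.

End Spans.

(* Graded vector spaces with a complete descending exhaustive filtration,
   indexed by all integers. A filtration of a graded space is by graded
   subspaces, and completeness is in the graded sense: every V^i is the limit
   of the V^i / F^k V^i. *)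
Record fgvect (K : fieldType) := FGVect {
  fgsort :> gvect K;
  fil : int -> fgsort -> Prop;
  fil0 : forall k, fil k 0;
  fil_lin : forall k c x y, fil k x -> fil k y -> fil k (c *: x + y);
  fil_desc : forall k x, fil (k + 1) x -> fil k x;
  fil_exhaustive : forall x, exists k, fil k x;
  fil_graded : forall k i x, fil k x -> fil k (gpr fgsort i x);
  fil_separated : forall x, (forall k, fil k x) -> x = 0;
  fil_complete : forall i (u : nat -> fgsort), (forall n, hom i (u n)) ->
    cauchy fil u -> exists l, converges fil u l
}.
Arguments fil {K} V k x : rename.

Definition fshift (K : fieldType) (d : int) (V : fgvect K) : fgvect K :=
  @FGVect K (shift d V) (fil V) (@fil0 K V) (@fil_lin K V) (@fil_desc K V)
    (@fil_exhaustive K V) (fun k i => @fil_graded K V k (d + i))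
    (@fil_separated K V) (fun i => @fil_complete K V (d + i)).

Section Filtrations.
Variable K : fieldType.

(* F^k Sym(V), spanned by the words with letters in F^(k_i) V, sum_i k_i >= k *)
Definition sym_fil (V : fgvect K) (k : int) : Sym V -> Prop :=
  lspan (fun a => exists w : seq (int * V),
    [/\ forall p, p \in w -> fil V p.1 p.2, (k <= \sum_(p <- w) p.1)%R &
        a = word (map snd w)]).

Definition tens_fil (A B : lmodType K) (fA : int -> A -> Prop)
    (fB : int -> B -> Prop) (k : int) : tens A B -> Prop :=
  lspan (fun t => exists i j a b,
    [/\ fA i a, fB j b, (k <= i + j)%R & t = tpure a b]).

End Filtrations.

Section Comodules.
Variables (K : fieldType) (V : gvect K).

(* id (x) f for f of degree d, with its Koszul sign
   a (x) x |-> (-1)^(d |a|) a (x) f x. *)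
Definition idtens (A B : lmodType K) (d : int) (f : {linear A -> B}) :
    {linear tens (Sym V) A -> tens (Sym V) B} :=
  if odd `|d| then tmap (ssgn V) f else tmap (idlin (Sym V)) f.

Definition coact (M : lmodType K) :
    {linear tens (Sym V) M -> tens (Sym V) (tens (Sym V) M)} :=
  tassoc (Sym V) (Sym V) M \oL tmap (sdelta V) (idlin M).

Lemma prM_subproofl (M : lmodType K) (m : M) :
  linear (fun a : Sym V => (seps V a : K) *: m).
Proof. by move=> c a b; rewrite linearP scalerDl scalerA. Qed.

Lemma prM_subproofr (M : lmodType K) (a : Sym V) :
  linear (fun m : M => (seps V a : K) *: m).
Proof. by move=> c m m'; rewrite scalerDr !scalerA mulrC. Qed.

(* pr_M : Sym(V) (x) M -> Sym^0(V) (x) M = M *)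
Definition prM (M : lmodType K) : {linear tens (Sym V) M -> M} :=
  tlift (@prM_subproofl M) (@prM_subproofr M).

Definition veeM (M : lmodType K) (x : V) :
    {linear tens (Sym V) M -> tens (Sym V) M} :=
  tmap (vee x) (idlin M).

End Comodules.
Arguments idtens {K V A B} d f.
Arguments coact {K} V M.
Arguments prM {K} V M.
Arguments veeM {K V} M x.

Notation SymL L := (Sym (fshift 1 L)).
Notation SymLM L M := (tens (SymL L) M).

Section Linfinity.
Variable K : fieldType.
Implicit Types L M N : fgvect K.

Definition homS L : int -> SymL L -> Prop := @sym_hom K (fshift 1 L).
Definition filS L : int -> SymL L -> Prop := @sym_fil K (fshift 1 L).
Definition homSM L M : int -> SymLM L M -> Prop :=
  tens_hom (@homS L) (@hom K M).
Definition filSM L M : int -> SymLM L M -> Prop :=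
  tens_fil (@filS L) (fil M).

Record linf L := Linf {
  linfQ :> {linear SymL L -> SymL L};
  linf_deg : degree_map (@homS L) (@homS L) 1 linfQ;
  linf_coder : forall a, sdelta _ (linfQ a) =
    tmap linfQ (idlin _) (sdelta _ a) + idtens 1 linfQ (sdelta _ a);
  linf_sq : forall a, linfQ (linfQ a) = 0;
  linf_flat : linfQ (sym1 _) = 0;
  linf_fil : filtered_map (@filS L) (@filS L) linfQ
}.

Record linf_mor L (Q Q' : linf L) := LinfMor {
  linf_mor_map :> {linear SymL L -> SymL L};
  linf_mor_deg : degree_map (@homS L) (@homS L) 0 linf_mor_map;
  linf_mor_comul : forall a, sdelta _ (linf_mor_map a) =
    tmap linf_mor_map linf_mor_map (sdelta _ a);
  linf_mor_counit : forall a, seps _ (linf_mor_map a) = seps _ a;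
  linf_mor_comm : forall a, linf_mor_map (Q a) = Q' (linf_mor_map a);
  linf_mor_fil : filtered_map (@filS L) (@filS L) linf_mor_map
}.

Record lmodule L (Q : linf L) M := LModule {
  lmodule_map :> {linear SymLM L M -> SymLM L M};
  lmodule_deg : degree_map (@homSM L M) (@homSM L M) 1 lmodule_map;
  lmodule_coact : forall x, coact _ M (lmodule_map x) =
    idtens 1 lmodule_map (coact _ M x) + tmap Q (idlin _) (coact _ M x);
  lmodule_sq : forall x, lmodule_map (lmodule_map x) = 0;
  lmodule_fil : filtered_map (@filSM L M) (@filSM L M) lmodule_map
}.

Record lmorph L (Q : linf L) M N (phi : lmodule Q M) (phi' : lmodule Q N) :=
    LMorph {
  lmorph_map :> {linear SymLM L M -> SymLM L N};
  lmorph_deg : degree_map (@homSM L M) (@homSM L N) 0 lmorph_map;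
  lmorph_coact : forall x, coact _ N (lmorph_map x) =
    idtens 0 lmorph_map (coact _ M x);
  lmorph_comm : forall x, lmorph_map (phi x) = phi' (lmorph_map x);
  lmorph_fil : filtered_map (@filSM L M) (@filSM L N) lmorph_map
}.

Section Composition.
Variables (L M N P : fgvect K) (Q : linf L).
Variables (phi : lmodule Q M) (phi' : lmodule Q N) (phi'' : lmodule Q P).
Variables (g : lmorph phi' phi'') (f : lmorph phi phi').

Lemma lmorph_comp_deg : degree_map (@homSM L M) (@homSM L P) 0 (g \oL f).
Proof.
move=> i x hx; rewrite complinE.
by have := lmorph_deg g (lmorph_deg f hx); rewrite !addr0.
Qed.

Lemma lmorph_comp_coact x :
  coact _ P ((g \oL f) x) = idtens 0 (g \oL f) (coact _ M x).
Proof.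
rewrite complinE !lmorph_coact /idtens /=.
move: (coact _ M x) => y; rewrite -complinE; apply: tens_lin_ext => a b.
by rewrite complinE !tmapE !idlinE complinE.
Qed.

Lemma lmorph_comp_comm x : (g \oL f) (phi x) = phi'' ((g \oL f) x).
Proof. by rewrite !complinE !lmorph_comm. Qed.

Lemma lmorph_comp_fil : filtered_map (@filSM L M) (@filSM L P) (g \oL f).
Proof.
by move=> k x hx; rewrite complinE; exact: lmorph_fil (lmorph_fil f hx).
Qed.

Definition lmorph_comp : lmorph phi phi'' :=
  LMorph lmorph_comp_deg lmorph_comp_coact lmorph_comp_comm lmorph_comp_fil.

End Composition.

(* The differential of Hom(Sym(L[1]) (x) M, N)[-1] on an element X of degree d
   in this shifted complex, that is, on a map X of degree d - 1. *)
Definition hom_diff L (Q : linf L) M N (phi : lmodule Q M) (phi' : lmodule Q N)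
    (d : int) (X : {linear SymLM L M -> N}) (x : SymLM L M) : N :=
  prM _ N (phi' (idtens (d - 1) X (coact _ M x))) + sgnz d *: X (phi x).

Definition homotopic L (Q : linf L) M N (phi : lmodule Q M)
    (phi' : lmodule Q N) (kappa1 kappa2 : lmorph phi phi') : Prop :=
  exists h : {linear SymLM L M -> N},
    [/\ degree_map (@homSM L M) (@hom K N) (0 - 1) h,
        filtered_map (@filSM L M) (fil N) h &
        forall x, prM _ N (kappa2 x) =
          prM _ N (kappa1 x) - hom_diff phi phi' 0 h x].

End Linfinity.

(* A power series sum_n u_n t^n with coefficients in V is the sequence of its
   coefficients u : nat -> V; a t-dependent linear map is the sequence of its
   coefficients T : nat -> {linear A -> B}, composed by the Cauchy product.
   For V^i complete, the completion of V^i (x) K[t] with respect to the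
   F^k V^i (x) K[t] is the space of power series whose coefficients tend to 0. *)

Section PowerSeries.
Variable K : fieldType.

Definition in_hat (V : fgvect K) (k i : int) (u : nat -> V) : Prop :=
  (forall n, hom i (u n) /\ fil V k (u n)) /\ converges (fil V) u 0.

Definition eval1 (V : fgvect K) (u : nat -> V) (l : V) : Prop :=
  converges (fil V) (series u) l.

Definition psC (A : zmodType) (x : A) (n : nat) : A :=
  if n is 0%N then x else 0.

Definition ps_const (A B : lmodType K) (f : {linear A -> B}) (n : nat) :
    {linear A -> B} :=
  if n is 0%N then f else zerolin A B.

Definition ps_comp (A B C : lmodType K) (S : nat -> {linear B -> C})
    (T : nat -> {linear A -> B}) (n : nat) : {linear A -> C} :=
  sumlin n.+1 (fun i => S i \oL T (n - i)%N).

Fixpoint ps_pow (A : lmodType K) (T : nat -> {linear A -> A}) (j : nat) :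
    nat -> {linear A -> A} :=
  if j is j'.+1 then ps_comp T (ps_pow T j') else ps_const (idlin A).

(* sum_j T(t)^j / j! for T(0) = 0: then T(t)^j contributes to the coefficient
   of t^n only for j <= n. *)
Definition ps_exp (A : lmodType K) (T : nat -> {linear A -> A}) (n : nat) :
    {linear A -> A} :=
  sumlin n.+1 (fun j => scalelin ((j`!)%:R^-1) (ps_pow T j n)).

(* exp(- p(t) \/) f exp(p(t) \/) for p(0) = 0 *)
Definition ps_twist (V : Type) (A B : lmodType K)
    (vA : V -> {linear A -> A}) (vB : V -> {linear B -> B}) (p : nat -> V)
    (f : {linear A -> B}) : nat -> {linear A -> B} :=
  ps_comp (ps_exp (fun n => scalelin (-1) (vB (p n))))
    (ps_comp (ps_const f) (ps_exp (fun n => vA (p n)))).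

Definition exp_trunc (A : lmodType K) (T : {linear A -> A}) (n : nat) :
    {linear A -> A} :=
  sumlin n (fun j => scalelin ((j`!)%:R^-1) (powlin T j)).

(* g = exp(- p \/) f exp(p \/); the exponentials of p in F^1 are infinite sums,
   so the composite is a pointwise limit for the filtration fB. *)
Definition is_twist (V : Type) (A B : lmodType K) (fB : int -> B -> Prop)
    (vA : V -> {linear A -> A}) (vB : V -> {linear B -> B}) (p : V)
    (f g : A -> B) : Prop :=
  forall a, converges fB
    (fun n => exp_trunc (scalelin (-1) (vB p)) n (f (exp_trunc (vA p) n a)))
    (g a).

End PowerSeries.

Section Twisting.
Variable K : fieldType.
Implicit Types L M N : fgvect K.

Definition veeL L (x : L) : {linear SymL L -> SymL L} :=
  @vee K (fshift 1 L) x.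
Definition veeLM L M (x : L) : {linear SymLM L M -> SymLM L M} :=
  @veeM K (fshift 1 L) M x.

Definition maurer_cartan L (Q : linf L) (p : L) : Prop :=
  [/\ hom 1 p, fil L 1 p &
      converges (fil L) (fun n => spr1 _ (Q (exp_trunc (veeL p) n (sym1 _)))) 0].

Definition mc_homotopic0 L (Q : linf L) (p : L) (pt lt : nat -> L) : Prop :=
  [/\ in_hat 1 1 pt, in_hat 1 0 lt,
      forall n, n.+1%:R *: pt n.+1 = \sum_(i < n.+1)
        spr1 _ (Q (veeL (lt i) (ps_exp (fun m => veeL (pt m)) (n - i) (sym1 _)))),
      pt 0%N = 0 & eval1 pt p].

Definition twisted_linf L (Q : linf L) (p : L) (Qp : linf L) : Prop :=
  is_twist (@filS K L) (@veeL L) (@veeL L) p Q Qp.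

Definition twisted_lmodule L (Q : linf L) M (phi : lmodule Q M) (p : L)
    (Qp : linf L) (phip : lmodule Qp M) : Prop :=
  is_twist (@filSM K L M) (@veeLM L M) (@veeLM L M) p phi phip.

Definition twisted_lmorph L (Q : linf L) M N (phi : lmodule Q M)
    (phi' : lmodule Q N) (kappa : lmorph phi phi') (p : L) (Qp : linf L)
    (phip : lmodule Qp M) (phip' : lmodule Qp N) (kappap : lmorph phip phip') :
    Prop :=
  is_twist (@filSM K L N) (@veeLM L M) (@veeLM L N) p kappa kappap.

Definition pullback_lmodule L (Q Q' : linf L) (F : linf_mor Q Q') M
    (phi' : lmodule Q' M) (phi : lmodule Q M) : Prop :=
  forall x, prM _ M (phi x) = prM _ M (phi' (tmap F (idlin M) x)).

Definition pullback_lmorph L (Q Q' : linf L) (F : linf_mor Q Q') M N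
    (phi1' : lmodule Q' M) (phi2' : lmodule Q' N) (kappa' : lmorph phi1' phi2')
    (phi1 : lmodule Q M) (phi2 : lmodule Q N) (kappa : lmorph phi1 phi2) : Prop :=
  forall x, prM _ N (kappa x) = prM _ N (kappa' (tmap F (idlin M) x)).

Definition linf_twist_t L (Q : linf L) (pt : nat -> L) :
    nat -> {linear SymL L -> SymL L} :=
  ps_twist (@veeL L) (@veeL L) pt Q.
Definition lmodule_twist_t L (Q : linf L) M (phi : lmodule Q M)
    (pt : nat -> L) : nat -> {linear SymLM L M -> SymLM L M} :=
  ps_twist (@veeLM L M) (@veeLM L M) pt phi.

(* The family Phi_t: coalgebra morphisms whose Taylor coefficients
   Sym^i(L[1]) -> L[t]^[1] solve the differential equation. *)
Definition is_Phi L (Q : linf L) (pt : nat -> L) (lambda : L)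
    (Phi : nat -> {linear SymL L -> SymL L}) : Prop :=
  [/\ [/\ forall n, degree_map (@homS K L) (@homS K L) 0 (Phi n),
          forall n a, sdelta _ (Phi n a) =
            \sum_(j < n.+1) tmap (Phi j) (Phi (n - j)%N) (sdelta _ a) &
          forall n a, seps _ (Phi n a) = psC (seps _ a) n],
      forall a, converges (fil L) (fun n => spr1 _ (Phi n a)) 0,
      forall a, spr1 _ (Phi 0%N a) = spr1 _ a &
      forall n i a, spr _ i a = a ->
        n.+1%:R *: spr1 _ (Phi n.+1 a) = \sum_(1 <= k < i.+1) \sum_(j < n.+1)
          spr1 _ (linf_twist_t Q pt j
            (veeL lambda (spr _ k (Phi (n - j)%N a))))].

Definition is_Phi1 L (Q Q' : linf L) (Phi : nat -> {linear SymL L -> SymL L})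
    (Phi1 : linf_mor Q Q') : Prop :=
  forall a, eval1 (fun n => spr1 _ (Phi n a)) (spr1 _ (Phi1 a)).

(* Phi_t^* phi^(p(t)) = Q (x) id + (id (x) X_t) (Delta_sh (x) id) for
   X_t = (phi^(p(t)))^1 (Phi_t (x) id), of degree 1 *)
Definition pullback_t L (Q : linf L) M (phi : lmodule Q M) (pt : nat -> L)
    (Phi : nat -> {linear SymL L -> SymL L}) (n : nat) :
    {linear SymLM L M -> SymLM L M} :=
  addlin (ps_const (tmap Q (idlin M)) n)
    (idtens 1 (prM _ M \oL ps_comp (lmodule_twist_t phi pt)
                 (fun m => tmap (Phi m) (idlin M)) n) \oL coact _ M).

Definition is_Psi L (Q : linf L) M (phi : lmodule Q M) (pt : nat -> L)
    (lambda : L) (Phi : nat -> {linear SymL L -> SymL L})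
    (Psi : nat -> {linear SymLM L M -> SymLM L M}) : Prop :=
  [/\ forall n, degree_map (@homSM K L M) (@homSM K L M) 0 (Psi n),
      forall n x, coact _ M (Psi n x) = idtens 0 (Psi n) (coact _ M x),
      forall x, converges (fil M) (fun n => prM _ M (Psi n x)) 0,
      forall x, prM _ M (Psi 0%N x) = prM _ M x &
      forall n x, n.+1%:R *: prM _ M (Psi n.+1 x) = \sum_(j < n.+1)
        prM _ M (pullback_t phi pt Phi j (veeLM M lambda (Psi (n - j)%N x)))].

Definition is_Psi1 L (Q : linf L) M (phi phi1 : lmodule Q M)
    (Psi : nat -> {linear SymLM L M -> SymLM L M}) (Psi1 : lmorph phi phi1) :
    Prop :=
  forall x, eval1 (fun n => prM _ M (Psi n x)) (prM _ M (Psi1 x)).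

End Twisting.

(* Main.v *)
(* Write l for the operator lambda \/ and P = exp(pi(t) \/), G = P Phi_t, as formal
   power series in t with operator coefficients. G is grouplike and its
   corestriction satisfies the differential equation of exp(t [Q, l]), hence
   G = exp(t [Q, l]); since l l = 0, G commutes with l. Comparing corestrictions
   again, P (Phi_t (x) id) Psi_{M,t} = exp(t [phi, l]), and likewise for N. So the
   transported morphism Psi_N^{-1} (Phi_t^* kappa^{pi(t)}) Psi_M is formally
   exp(-t [phi', l]) kappa exp(t [phi, l]), whose derivative is a boundary because
   [phi, l] commutes with phi. To avoid inverses, the homotopy is integrated
   after multiplication by exp(t [phi', l]) (the series hflow). At t = 1
   everything converges since lambda lies in F^1: the coefficient of t^n raises
   the filtration by n. *)
Require Import Defs.
From HB Require Import structures.
From mathcomp Require Import all_boot all_order all_algebra.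
From mathcomp Require Import boolp zify.

Set Implicit Arguments.
Unset Strict Implicit.
Unset Printing Implicit Defensive.

Import Order.TTheory GRing.Theory Num.Theory.
Local Open Scope ring_scope.
Local Notation hom := Defs.hom.

(** Constancy of lambda is what makes G the exponential of one fixed operator. The obstacle is
    evaluation at t = 1: [Sym] and its tensor products are not completed, so exp(pi \/) need not
    have a value there, and the twisted structures are only pointwise limits of truncations.
    Identities are therefore proved coefficientwise in t, a truncated exponential is related to
    partial sums in t by a difference tending to 0, and the final limits are compared after
    corestriction to [N], where they are unique. A second point is that [hflow] is not a comodule
    map: it covers G up to a sign. Removing the factor G coefficient by coefficient leaves comodule
    maps whose sum at t = 1 is a homotopy into [N] with its pulled-back structure. Only then is the
    given inverse of Psi_N applied. *)

Definition cauchy_prod (X Y : Type) (C : zmodType) (b : X -> Y -> C)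
    (u : nat -> X) (v : nat -> Y) (n : nat) : C :=
  \sum_(i < n.+1) b (u i) (v (n - i)%N).

Definition pderiv (K : fieldType) (A : lmodType K) (u : nat -> A) (n : nat) : A :=
  n.+1%:R *: u n.+1.

(** A bare predicate, so that partial applications [b^~ y] of a bilinear map qualify without being
    packed as linear maps. *)
Definition additive_map (A B : zmodType) (f : A -> B) := {morph f : x y / x + y}.

(** * Cauchy products of coefficient sequences *)

Section CauchyProducts.

Lemma additive_sum (A B : zmodType) (f : A -> B) (I : Type) (r : seq I)
  (P : pred I) (F : I -> A) : additive_map f ->
  f (\sum_(i <- r | P i) F i) = \sum_(i <- r | P i) f (F i).
Proof.
move=> fD; apply: big_morph => //.
by apply: (addrI (f 0)); rewrite -fD !addr0.
Qed.

(** The triangle i + j < n is cut by antidiagonals or by rows. Used for associativity of Cauchy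
    products and for rearranging their partial sums. *)
Lemma triangle_sumr (C : zmodType) (f : nat -> nat -> C) n :
  \sum_(m < n) \sum_(i < m.+1) f i (m - i)%N
  = \sum_(j < n) \sum_(i < n - j) f i j.
Proof.
elim: n => [|n IH]; first by rewrite !big_ord0.
rewrite big_ord_recr IH /= [RHS]big_ord_recr /= subSn // subnn big_ord1.
have -> : \sum_(j < n) \sum_(i < n.+1 - j) f i j =
   \sum_(j < n) \sum_(i < n - j) f i j + \sum_(j < n) f (n - j)%N j.
  rewrite -big_split /=; apply: eq_bigr => j _.
  by rewrite subSn ?big_ord_recr //= ltnW.
rewrite -addrA; congr (_ + _).
rewrite (reindex_inj rev_ord_inj) /= big_ord_recr /= !subSS subnn subn0.
congr (_ + _); apply: eq_bigr => j _.
by rewrite !subSS subKn // ltnW.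
Qed.

Lemma rev_sum (C : zmodType) (f : nat -> nat -> C) n :
  \sum_(i < n.+1) f i (n - i)%N = \sum_(i < n.+1) f (n - i)%N i.
Proof.
rewrite (reindex_inj rev_ord_inj) /=; apply: eq_bigr => i _.
by rewrite !subSS (subKn (leq_ord i)).
Qed.

Lemma triangle_suml (C : zmodType) (f : nat -> nat -> C) n :
  \sum_(m < n) \sum_(i < m.+1) f i (m - i)%N
  = \sum_(i < n) \sum_(j < n - i) f i j.
Proof.
rewrite -(triangle_sumr (fun j i => f i j)).
by apply: eq_bigr => m _; exact: rev_sum.
Qed.

(** Four separate products are allowed, because an operator series acting on the left factor of a
    tensor is one of the instances. *)
Lemma cauchy_prod_assoc (X Y Z : Type) (W T C : zmodType)
  (b1 : W -> Z -> C) (b2 : X -> Y -> W) (b3 : X -> T -> C) (b4 : Y -> Z -> T)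
  u v w : (forall z, additive_map (b1^~ z)) -> (forall x, additive_map (b3 x)) ->
  (forall x y z, b1 (b2 x y) z = b3 x (b4 y z)) ->
  cauchy_prod b1 (cauchy_prod b2 u v) w =1 cauchy_prod b3 u (cauchy_prod b4 v w).
Proof.
move=> b1D b3D E n; rewrite /cauchy_prod.
transitivity (\sum_(m < n.+1) \sum_(i < m.+1)
    b1 (b2 (u i) (v (m - i)%N)) (w (n - (i + (m - i)))%N)).
  apply: eq_bigr => m _; rewrite (additive_sum _ _ _ (b1D _)).
  by apply: eq_bigr => i _; rewrite (subnKC (leq_ord i)).
rewrite (triangle_suml (fun i j => b1 (b2 (u i) (v j)) (w (n - (i + j))%N))).
apply: eq_bigr => i _; rewrite (additive_sum _ _ _ (b3D _)) (subSn (leq_ord i)).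
by apply: eq_bigr => j _; rewrite E subnDA.
Qed.

(** Needed when [u] and [v] act independently, by commuting multiplications or on different tensor
    factors. *)
Lemma cauchy_prod_leftcomm (X Y Z : Type) (W T C : zmodType)
  (b1 : X -> W -> C) (b2 : Y -> Z -> W) (b3 : Y -> T -> C) (b4 : X -> Z -> T)
  u v w : (forall x, additive_map (b1 x)) -> (forall y, additive_map (b3 y)) ->
  (forall x y z, b1 x (b2 y z) = b3 y (b4 x z)) ->
  cauchy_prod b1 u (cauchy_prod b2 v w) =1 cauchy_prod b3 v (cauchy_prod b4 u w).
Proof.
move=> b1D b3D E n; rewrite /cauchy_prod.
transitivity (\sum_(m < n.+1) \sum_(i < m.+1)
    b1 (u i) (b2 (v (m - i)%N) (w (n - (i + (m - i)))%N))).
  rewrite (triangle_suml (fun i j => b1 (u i) (b2 (v j) (w (n - (i + j))%N)))).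
  apply: eq_bigr => i _; rewrite (additive_sum _ _ _ (b1D _)) (subSn (leq_ord i)).
  by apply: eq_bigr => j _; rewrite subnDA.
rewrite (triangle_sumr (fun i j => b1 (u i) (b2 (v j) (w (n - (i + j))%N)))).
apply: eq_bigr => i _; rewrite (additive_sum _ _ _ (b3D _)) (subSn (leq_ord i)).
by apply: eq_bigr => j _; rewrite E addnC subnDA.
Qed.

Lemma cauchy_prod_pderiv (K : fieldType) (A B C : lmodType K) (b : A -> B -> C) u v n :
  (forall y, linear (b^~ y)) -> (forall x, linear (b x)) ->
  pderiv (cauchy_prod b u v) n = cauchy_prod b (pderiv u) v n + cauchy_prod b u
    (pderiv v) n.
Proof.
move=> bl br.
have bZl c x y : b (c *: x) y = c *: b x y.
  by have := linearZ_LR (mklin (bl y)) c x; rewrite !mklinE.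
have bZr c x y : b x (c *: y) = c *: b x y.
  by have := linearZ_LR (mklin (br x)) c y; rewrite !mklinE.
rewrite /pderiv /cauchy_prod scaler_sumr.
(* The weight n + 1 is split as i + (n + 1 - i); each part becomes a derivative on one factor, and
   its end term of weight 0 drops out. *)
transitivity (\sum_(i < n.+2) (i%:R *: b (u i) (v (n.+1 - i)%N) +
    (n.+1 - i)%:R *: b (u i) (v (n.+1 - i)%N))).
  by apply: eq_bigr => i _; rewrite -scalerDl -natrD (subnKC (leq_ord i)).
rewrite big_split /=; congr (_ + _).
  rewrite big_ord_recl scale0r add0r; apply: eq_bigr => i _.
  by rewrite /= bZl subSS.
rewrite big_ord_recr /= subnn scale0r addr0; apply: eq_bigr => i _.
by rewrite bZr (subSn (leq_ord i)).
Qed.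

Lemma eq_cauchy_prod (X Y : Type) (C : zmodType) (b b' : X -> Y -> C) u u' v v' :
  (forall x y, b x y = b' x y) -> u =1 u' -> v =1 v' ->
  cauchy_prod b u v =1 cauchy_prod b' u' v'.
Proof. by move=> E Eu Ev n; apply: eq_bigr => i _; rewrite E Eu Ev. Qed.

End CauchyProducts.

(** * Functoriality of tensor products *)

Section TensorMaps.
Variable K : fieldType.
Implicit Types A B C D E F W : lmodType K.

Lemma tpure_linearl A B (b : B) : linear (fun a : A => tpure a b).
Proof. by move=> c a a'; rewrite tpureDl. Qed.

Lemma tpure_linearr A B (a : A) : linear (fun b : B => tpure a b).
Proof. by move=> c b b'; rewrite tpureDr. Qed.

Lemma linear_additive A B (f : A -> B) : linear f -> additive_map f.
Proof. by move=> fl x y; have := linearD (mklin fl) x y; rewrite !mklinE. Qed.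

Lemma tpure_additivel A B (b : B) : additive_map (fun a : A => tpure a b).
Proof. exact: linear_additive (tpure_linearl b). Qed.

Lemma tpure_additiver A B (a : A) : additive_map (fun b : B => tpure a b).
Proof. exact: linear_additive (tpure_linearr a). Qed.

Lemma tpureNl A B (a : A) (b : B) : tpure (- a) b = - tpure a b.
Proof. by rewrite -[in LHS]scaleN1r tpureZl scaleN1r. Qed.

Lemma tpureNr A B (a : A) (b : B) : tpure a (- b) = - tpure a b.
Proof. by rewrite -[in LHS]scaleN1r tpureZr scaleN1r. Qed.

Lemma tmap_comp A B C D E F (f : {linear C -> E}) (g : {linear D -> F})
  (f' : {linear A -> C}) (g' : {linear B -> D}) t :
  tmap f g (tmap f' g' t) = tmap (f \oL f') (g \oL g') t.
Proof.
rewrite -complinE; apply: tens_lin_ext => a b.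
by rewrite complinE !tmapE !complinE.
Qed.

Lemma eq_tmap A B C D (f f' : {linear A -> C}) (g g' : {linear B -> D}) :
  f =1 f' -> g =1 g' -> tmap f g =1 tmap f' g'.
Proof. by move=> ff gg; apply: tens_lin_ext => a b; rewrite !tmapE ff gg. Qed.

Lemma tmap_id A B (t : tens A B) : tmap (idlin A) (idlin B) t = t.
Proof.
rewrite -[RHS]idlinE; apply: tens_lin_ext => a b.
by rewrite tmapE !idlinE.
Qed.

Lemma tmapDr A B C D (f : {linear A -> C}) (g g' : {linear B -> D}) t :
  tmap f (addlin g g') t = tmap f g t + tmap f g' t.
Proof.
rewrite -addlinE; apply: tens_lin_ext => a b.
by rewrite addlinE !tmapE addlinE tpure_additiver.
Qed.

Lemma tmapDl A B C D (f f' : {linear A -> C}) (g : {linear B -> D}) t :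
  tmap (addlin f f') g t = tmap f g t + tmap f' g t.
Proof.
rewrite -addlinE; apply: tens_lin_ext => a b.
by rewrite addlinE !tmapE addlinE tpure_additivel.
Qed.

Lemma tassoc_tmap A B C A' B' C' (f : {linear A -> A'}) (g : {linear B -> B'})
    (h : {linear C -> C'}) t :
  tassoc _ _ _ (tmap (tmap f g) h t) = tmap f (tmap g h) (tassoc _ _ _ t).
Proof.
have tl c : linear (fun u => tassoc A' B' C' (tmap (tmap f g) h (tpure u c))).
  by move=> d u v; rewrite tpureDl !linearP.
have tr c : linear (fun u => tmap f (tmap g h) (tassoc A B C (tpure u c))).
  by move=> d u v; rewrite tpureDl !linearP.
rewrite -2!complinE; apply: tens_lin_ext => u c; rewrite !complinE.
rewrite -(mklinE (tl c)) -[RHS](mklinE (tr c)); apply: tens_lin_ext => a b.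
by rewrite (mklinE (tl c)) (mklinE (tr c)) !(tmapE, tassocE).
Qed.

End TensorMaps.

Section Spans.
Variable K : fieldType.
Implicit Types A B : lmodType K.

Lemma lspanD A (P : A -> Prop) x y : lspan P x -> lspan P y -> lspan P (x + y).
Proof. by move=> hx hy; rewrite -[x]scale1r; exact: lspan_lin. Qed.

Lemma lspanZ A (P : A -> Prop) c x : lspan P x -> lspan P (c *: x).
Proof. by move=> hx; rewrite -[_ *: _]addr0; apply: lspan_lin => //; exact: lspan0. Qed.

Lemma lspan_sum A (P : A -> Prop) (I : Type) (r : seq I) (R : pred I) (F : I -> A) :
  (forall i, R i -> lspan P (F i)) -> lspan P (\sum_(i <- r | R i) F i).
Proof. by move=> h; apply: big_ind => //; [exact: lspan0|exact: lspanD]. Qed.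

Lemma lspan_map A B (P : A -> Prop) (R : B -> Prop) (f : {linear A -> B}) x :
  (forall a, P a -> lspan R (f a)) -> lspan P x -> lspan R (f x).
Proof.
move=> h; elim=> [|a /h //|c a b _ IHa _ IHb]; first by rewrite linear0; exact: lspan0.
by rewrite linearP; exact: lspan_lin.
Qed.

Lemma lspan_mono A (P R : A -> Prop) x :
  (forall a, P a -> R a) -> lspan P x -> lspan R x.
Proof.
move=> h; elim=> [|a /h ha|c a b _ IHa _ IHb]; first exact: lspan0.
  exact: lspan_gen.
exact: lspan_lin.
Qed.

Lemma lspan_ext A B (P : A -> Prop) (f g : {linear A -> B}) x :
  (forall a, P a -> f a = g a) -> lspan P x -> f x = g x.
Proof.
move=> h; elim=> [|a /h //|c a b _ IHa _ IHb]; first by rewrite !linear0.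
by rewrite !linearP IHa IHb.
Qed.

End Spans.

(** * Counit laws and coassociativity of the shuffle coproduct *)

Section SymmetricCoalgebra.
Variables (K : fieldType) (V : gvect K).
Local Notation S := (Sym V).

Lemma hom_gpr i (x : V) : hom i (gpr V i x).
Proof. by rewrite /hom gprK eqxx. Qed.

Lemma sym_ind (P : S -> Prop) :
  P 0 -> (forall c a b, P a -> P b -> P (c *: a + b)) -> P (sym1 V) ->
  (forall i x a, hom i x -> P a -> P (vee x a)) -> forall a, P a.
Proof.
move=> P0 Plin P1 Pvee; elim/pres_ind => // w.
elim: w => [|x w IH]; first exact: P1.
change (P (word (x :: w))); change (P (word w)) in IH; rewrite -veeE.
rewrite (gsuppE x) (additive_sum _ _ _ (linear_additive (@vee_linear _ _ _))).
apply: big_ind => // [a b ha hb|i _]; first by rewrite -[a]scale1r; exact: Plin.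
exact: Pvee (hom_gpr i x) IH.
Qed.

Lemma sgnzE (i : int) : sgnz i = (-1) ^ i :> K.
Proof.
rewrite /sgnz signr_odd; case: i => n //.
by rewrite NegzE abszN -exprz_inv invrN invr1.
Qed.

Lemma sgnzD (i j : int) : sgnz (i + j) = sgnz i * sgnz j :> K.
Proof. by rewrite !sgnzE expfzDr // oppr_eq0 oner_eq0. Qed.

Lemma sgnz_sqr (i : int) : sgnz i * sgnz i = 1 :> K.
Proof. by rewrite /sgnz -signr_addb addbb. Qed.

Lemma sgnz_odd (i : int) : odd `|i| -> sgnz i = -1 :> K.
Proof. by rewrite /sgnz => ->. Qed.

Lemma ssgnK (a : S) : ssgn V (ssgn V a) = a.
Proof.
elim/sym_ind: a => [|c a b ha hb||i x a hx ha].
- by rewrite !linear0.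
- by rewrite !linearP ha hb.
- by rewrite !ssgnE.
- by rewrite !ssgn_vee ha (gsgn_hom (hom_gsgn hx)) (gsgn_hom hx)
    scalerA sgnz_sqr scale1r.
Qed.

Lemma seps_vee x (a : S) : seps V (vee x a) = 0.
Proof.
elim/pres_ind: a => [|c a b ha hb|w]; first by rewrite !linear0.
- by rewrite !linearP ha hb /= scaler0 addr0.
- by rewrite veeE sym_liftE.
Qed.

Lemma seps_ssgn (a : S) : seps V (ssgn V a) = seps V a.
Proof.
elim/sym_ind: a => [|c a b ha hb||i x a hx ha]; first by rewrite !linear0.
- by rewrite !linearP ha hb.
- by rewrite ssgnE.
- by rewrite ssgn_vee !seps_vee.
Qed.

Lemma sdelta1 : sdelta V (sym1 V) = tpure (sym1 V) (sym1 V).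
Proof. by rewrite sdeltaE. Qed.

Lemma seps1 : seps V (sym1 V) = 1.
Proof. by rewrite sym_liftE. Qed.

Lemma prMEl (M : lmodType K) (a : S) (m : M) :
  prM V M (tpure a m) = (seps V a : K) *: m.
Proof. exact: tliftE. Qed.

(** The left counit law, with [prM] taken for the module Sym(V) itself. *)
Lemma prM_sdelta (a : S) : prM V S (sdelta V a) = a.
Proof.
elim/sym_ind: a => [|c a b ha hb||i x a hx {2}<-]; first by rewrite !linear0.
- by rewrite !linearP ha hb.
- by rewrite sdelta1 prMEl seps1 scale1r.
rewrite sdelta_vee -[LHS]complinE -[RHS]complinE.
move: (sdelta V a); apply: tens_lin_ext => b c.
rewrite !complinE (prim_mul_hom _ _ hx) linearD /= !prMEl seps_vee scale0r add0r.
by rewrite linearZ; case: odd; rewrite ?seps_ssgn.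
Qed.

Lemma epsr_subproofl (b : S) : linear (fun a : S => (seps V b : K) *: a).
Proof. by move=> c a a'; rewrite scalerDr !scalerA mulrC. Qed.

Lemma epsr_subproofr (a : S) : linear (fun b : S => (seps V b : K) *: a).
Proof. by move=> c b b'; rewrite linearP scalerDl scalerA. Qed.

(** The counit on the second factor, mirror image of [prM]. *)
Definition epsr : {linear tens S S -> S} := tlift epsr_subproofl epsr_subproofr.

Lemma epsr_sdelta (a : S) : epsr (sdelta V a) = a.
Proof.
elim/sym_ind: a => [|c a b ha hb||i x a hx {2}<-]; first by rewrite !linear0.
- by rewrite !linearP ha hb.
- by rewrite sdelta1 tliftE seps1 scale1r.
rewrite sdelta_vee -[LHS]complinE -[RHS]complinE.
move: (sdelta V a); apply: tens_lin_ext => b c.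
by rewrite !complinE (prim_mul_hom _ _ hx) linearD /= !tliftE seps_vee scale0r
  addr0 linearZ.
Qed.

Lemma sdelta_ssgn (a : S) :
  sdelta V (ssgn V a) = tmap (ssgn V) (ssgn V) (sdelta V a).
Proof.
elim/sym_ind: a => [|c a b ha hb||i x a hx ha]; first by rewrite !linear0.
- by rewrite !linearP ha hb.
- by rewrite ssgnE sdelta1 tmapE !ssgnE.
rewrite ssgn_vee !sdelta_vee ha -[LHS]complinE -[RHS]complinE.
move: (sdelta V a); apply: tens_lin_ext => b c.
rewrite !complinE !tmapE (prim_mul_hom _ _ (hom_gsgn hx)) (prim_mul_hom _ _ hx).
by rewrite linearD /= !tmapE !ssgn_vee; case: odd; rewrite ?ssgnK.
Qed.

Lemma sdelta_coassoc (a : S) :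
  tassoc _ _ _ (tmap (sdelta V) (idlin _) (sdelta V a)) =
  tmap (idlin _) (sdelta V) (sdelta V a).
Proof.
elim/sym_ind: a => [|c a b ha hb||i x a hx IH]; first by rewrite !linear0.
- by rewrite !linearP ha hb.
- by rewrite !(sdelta1, tmapE, idlinE, tassocE).
(* [s] is the sign that a left tensor factor acquires when [x] passes it. *)
pose s := if odd `|i| then ssgn V else idlin S.
have sE b : (if odd `|i| then ssgn V b else b) = s b.
  by rewrite /s; case: odd => //; rewrite idlinE.
have sd b : sdelta V (s b) = tmap s s (sdelta V b).
  by rewrite /s; case: odd; rewrite ?sdelta_ssgn // tmap_id idlinE.
have primE : prim_mul x =1 addlin (tmap (vee x) (idlin S)) (tmap s (vee x)).
  apply: tens_lin_ext => b c.
  by rewrite (prim_mul_hom _ _ hx) addlinE !tmapE idlinE sE.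
(* [X] is multiplication by x on the threefold tensor product, with Koszul signs; both iterated
   coproducts intertwine [vee x] with it. *)
pose X := addlin (tmap (vee x) (idlin (tens S S)))
            (tmap s (addlin (tmap (vee x) (idlin S)) (tmap s (vee x)))).
transitivity (X (tassoc S S S (tmap (sdelta V) (idlin _) (sdelta V a)))).
  rewrite sdelta_vee primE; move: (sdelta V a) => t.
  rewrite -!complinE; move: t; apply: tens_lin_ext => b c.
  rewrite !complinE addlinE linearD /= !tmapE !idlinE sdelta_vee sd primE.
  rewrite addlinE tpure_additivel !linearD /=.
  move: (sdelta V b) => u.
  rewrite -[c in tpure (tmap (vee x) _ u) c]idlinE.
  rewrite -[c in tpure (tmap s (vee x) u) c]idlinE.
  rewrite -!tmapE !tassoc_tmap /X addlinE tmapDr.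
  rewrite addrA; congr (_ + _ + _).
  by apply: eq_tmap => // ?; rewrite tmap_id idlinE.
rewrite IH sdelta_vee primE; move: (sdelta V a) => t.
rewrite -!complinE; move: t; apply: tens_lin_ext => b c.
by rewrite !complinE !addlinE linearD /= !tmapE !idlinE sdelta_vee primE.
Qed.

End SymmetricCoalgebra.

(** * Cofree comodules Sym(V) (x) M *)

Section Comodules.
Variables (K : fieldType) (V : gvect K).
Local Notation S := (Sym V).
Implicit Types M N P : lmodType K.

Definition sgn_pow (d : int) : {linear S -> S} :=
  if odd `|d| then ssgn V else idlin S.

Lemma idtensE M N d (X : {linear M -> N}) : idtens d X = tmap (sgn_pow d) X.
Proof. by rewrite /idtens /sgn_pow; case: odd. Qed.

Lemma sgn_pow0 a : sgn_pow 0 a = a.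
Proof. exact: idlinE. Qed.

Lemma sgn_pow_odd d : odd `|d| -> sgn_pow d = ssgn V.
Proof. by rewrite /sgn_pow => ->. Qed.

Lemma sdelta_sgn_pow d a :
  sdelta V (sgn_pow d a) = tmap (sgn_pow d) (sgn_pow d) (sdelta V a).
Proof.
by rewrite /sgn_pow; case: odd; rewrite ?sdelta_ssgn // tmap_id idlinE.
Qed.

Lemma seps_sgn_pow d a : seps V (sgn_pow d a) = seps V a.
Proof. by rewrite /sgn_pow; case: odd; rewrite ?seps_ssgn // idlinE. Qed.

Lemma coact_pure M a m :
  coact V M (tpure a m) = tassoc S S M (tpure (sdelta V a) m).
Proof. by rewrite complinE tmapE idlinE. Qed.

Lemma tassoc_linear M (m : M) : linear (fun u => tassoc S S M (tpure u m)).
Proof. by move=> c u v; rewrite tpureDl linearP. Qed.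

Lemma prM_coact M x : prM V (tens S M) (coact V M x) = x.
Proof.
rewrite -[RHS]idlinE -[LHS]complinE; move: x; apply: tens_lin_ext => a m.
rewrite complinE idlinE coact_pure -[in RHS](prM_sdelta a).
move: (sdelta V a) => u.
rewrite -(mklinE (tassoc_linear m)) -(mklinE (tpure_linearl m)) -!complinE.
move: u; apply: tens_lin_ext => b c.
by rewrite !complinE (mklinE (tassoc_linear m)) mklinE tassocE !prMEl tpureZl.
Qed.

Lemma prM_idtens M N d (X : {linear M -> N}) t :
  prM V N (idtens d X t) = X (prM V M t).
Proof.
rewrite idtensE -!complinE; move: t; apply: tens_lin_ext => a m.
by rewrite !complinE tmapE !prMEl seps_sgn_pow linearZ.
Qed.

Lemma prM_idtens_coact M N d (X : {linear tens S M -> N}) x :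
  prM V N (idtens d X (coact V M x)) = X x.
Proof. by rewrite prM_idtens prM_coact. Qed.

Lemma tmap_prM_coact M x : tmap (idlin S) (prM V M) (coact V M x) = x.
Proof.
rewrite -[RHS]idlinE -[LHS]complinE; move: x; apply: tens_lin_ext => a m.
rewrite complinE idlinE coact_pure -[in RHS](epsr_sdelta a).
move: (sdelta V a) => u.
rewrite -(mklinE (tassoc_linear m)) -(mklinE (tpure_linearl m)) -!complinE.
move: u; apply: tens_lin_ext => b c.
rewrite !complinE (mklinE (tassoc_linear m)) mklinE tassocE !tmapE prMEl.
by rewrite tliftE idlinE tpureZl tpureZr.
Qed.

Lemma coact_coassoc M x :
  tmap (idlin S) (coact V M) (coact V M x) =
  tassoc S S _ (tmap (sdelta V) (idlin _) (coact V M x)).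
Proof.
move: (coact V M) (@coact_pure M) => co coE.
rewrite -!complinE; move: x; apply: tens_lin_ext => a m.
rewrite !complinE coE.
pose T := tmap (idlin S) (mklin (tassoc_linear m)).
transitivity (T (tmap (idlin S) (sdelta V) (sdelta V a))).
  move: (sdelta V a) => u.
  rewrite -(mklinE (tassoc_linear m)) -!complinE.
  move: u; apply: tens_lin_ext => b c.
  rewrite !complinE (mklinE (tassoc_linear m)) tassocE !tmapE !idlinE.
  by rewrite (mklinE (tassoc_linear m)) coE.
rewrite -sdelta_coassoc; move: (sdelta V a) => u.
rewrite -(mklinE (tassoc_linear m)) -!complinE.
move: u; apply: tens_lin_ext => b c.
rewrite !complinE (mklinE (tassoc_linear m)) tassocE !tmapE !idlinE.
move: (sdelta V b) => u.
rewrite -(mklinE (tassoc_linear c)) -(mklinE (tassoc_linear (tpure c m))) -!complinE.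
move: u; apply: tens_lin_ext => e f.
rewrite !complinE !(mklinE (tassoc_linear _)) !tassocE tmapE idlinE.
by rewrite (mklinE (tassoc_linear m)) tassocE.
Qed.

Definition is_comod M N (d : int) (F : {linear tens S M -> tens S N}) :=
  forall x, coact V N (F x) = idtens d F (coact V M x).

(** Coassociativity moves the coaction inside; the sign factor follows because the grading
    involution is a coalgebra map. *)
Lemma is_comod_cofree M N d (X : {linear tens S M -> N}) :
  is_comod d (idtens d X \oL coact V M).
Proof.
move=> x; rewrite [idtens d (_ \oL _)]idtensE complinE.
have -> : tmap (sgn_pow d) (idtens d X \oL coact V M) (coact V M x) =
    tmap (sgn_pow d) (tmap (sgn_pow d) X)
      (tmap (idlin S) (coact V M) (coact V M x)).
  rewrite tmap_comp; apply: eq_tmap => y; first by rewrite complinE idlinE.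
  by rewrite !complinE idtensE.
rewrite coact_coassoc -tassoc_tmap [in LHS]complinE; congr (tassoc _ _ _ _).
rewrite tmap_comp idtensE tmap_comp; apply: eq_tmap => y.
  by rewrite !complinE sdelta_sgn_pow.
by rewrite !complinE !idlinE.
Qed.

Lemma coact_recon M N (f : {linear S -> S}) (g : {linear tens S M -> tens S N}) x y :
  coact V N y = tmap f g (coact V M x) ->
  y = tmap f (prM V N \oL g) (coact V M x).
Proof.
move=> E; rewrite -[y](tmap_prM_coact) E tmap_comp.
by apply: eq_tmap => z //; rewrite complinE idlinE.
Qed.

(** Projecting the second factor by [prM] undoes the coaction, so a comodule map is determined by
    its corestriction. *)
Lemma is_comod_recon M N d (F : {linear tens S M -> tens S N}) x :
  is_comod d F -> F x = idtens d (prM V N \oL F) (coact V M x).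
Proof. by move=> /(_ x); rewrite !idtensE; exact: coact_recon. Qed.

(** Multiplication by a letter is a coderivation; only the cost of crossing the first factor depends
    on parity, and for odd z it is the grading involution. *)
Lemma coact_veeM M i (z : V) x : hom i z -> odd `|i| ->
  coact V M (veeM M z x) =
  tmap (vee z) (idlin _) (coact V M x) + tmap (ssgn V) (veeM M z) (coact V M x).
Proof.
move=> hz oi; move: (coact V M) (@coact_pure M) => co coE.
rewrite -addlinE -!complinE; move: x; apply: tens_lin_ext => a m.
rewrite !complinE addlinE tmapE !coE idlinE sdelta_vee.
move: (sdelta V a) => u.
rewrite -!(mklinE (tassoc_linear m)) -!complinE -addlinE.
move: u; apply: tens_lin_ext => b c.
rewrite addlinE !complinE !(mklinE (tassoc_linear m)) (prim_mul_hom _ _ hz) oi.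
by rewrite !tassocE !tmapE tpure_additivel linearD /= !tassocE !idlinE.
Qed.

Lemma prM_veeM M z x : prM V M (veeM M z x) = 0.
Proof.
rewrite -(zerolinE M x) -complinE; move: x; apply: tens_lin_ext => a m.
by rewrite complinE zerolinE tmapE prMEl seps_vee scale0r.
Qed.

Lemma prM_tmap0 M (f : {linear S -> S}) x : (forall a, seps V (f a) = 0) ->
  prM V M (tmap f (idlin M) x) = 0.
Proof.
move=> ef; rewrite -(zerolinE M x) -complinE; move: x; apply: tens_lin_ext => a m.
by rewrite complinE tmapE !prMEl ef zerolinE scale0r.
Qed.

End Comodules.
Arguments sgn_pow {K V} d.

(** * Homogeneous elements and the grading involution *)

Section Homogeneous.
Variables (K : fieldType) (V : gvect K).
Local Notation S := (Sym V).

Lemma gvect_ind (P : V -> Prop) : P 0 -> (forall x y, P x -> P y -> P (x + y)) ->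
  (forall i x, hom i x -> P x) -> forall x, P x.
Proof.
move=> P0 PD Ph x; rewrite (gsuppE x); apply: big_ind => // i _.
exact: Ph (hom_gpr i x).
Qed.

Lemma sym_hom_vee i d (x : V) a : hom i x -> sym_hom d a -> sym_hom (i + d) (vee x a).
Proof.
move=> hx; apply: lspan_map => {}a [w [hw <- ->]]; apply: lspan_gen.
exists ((i, x) :: w); split; rewrite ?big_cons ?veeE // => p.
by rewrite inE => /orP[/eqP -> //|/hw].
Qed.

Lemma sym_hom1 : sym_hom 0 (sym1 V).
Proof. by apply: lspan_gen; exists [::]; rewrite big_nil. Qed.

Lemma sym_hom_span (a : S) : lspan (fun b => exists i, sym_hom i b) a.
Proof.
elim/sym_ind: a => [|c a b ha hb||i x a hx]; first exact: lspan0.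
- exact: lspan_lin.
- by apply: lspan_gen; exists 0; exact: sym_hom1.
apply: lspan_map => b [j hb]; apply: lspan_gen; exists (i + j).
exact: sym_hom_vee.
Qed.

Lemma ssgn_sym_hom i (a : S) : sym_hom i a -> ssgn V a = sgnz i *: a.
Proof.
elim=> [|b [w [hw <- ->]]|c b b' _ IHb _ IHb']; first by rewrite linear0 scaler0.
  2: by rewrite linearP IHb IHb' scalerDr !scalerA mulrC.
elim: w hw => [|[j x] w IH] hw; first by rewrite big_nil ssgnE scale1r.
rewrite big_cons -veeE ssgn_vee IH => [|p pw]; last first.
  by apply: hw; rewrite inE pw orbT.
rewrite (gsgn_hom (hw (j, x) _)) ?mem_head // sgnzD linearZ /= veeZ scalerA.
by rewrite mulrC.
Qed.

(** Only homogeneous elements have to be checked, since they span. For d = 1 this makes [Q]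
    anticommute with the grading involution. *)
Lemma ssgn_degree_map d (f : {linear S -> S}) a :
  degree_map (@sym_hom K V) (@sym_hom K V) d f -> f (ssgn V a) = sgnz d *: ssgn V (f a).
Proof.
move=> hf; rewrite -complinE -[ssgn V (f a)]complinE -scalelinE.
apply: lspan_ext (sym_hom_span a) => b [i hb].
rewrite scalelinE !complinE (ssgn_sym_hom hb) (ssgn_sym_hom (hf _ _ hb)).
by rewrite linearZ /= sgnzD scalerA mulrCA sgnz_sqr mulr1.
Qed.

End Homogeneous.

(** * Recovering elements of Sym(V) from corestrictions *)

Section Euler.
Variables (K : fieldType) (V : gvect K).
Local Notation S := (Sym V).

Lemma spr1E w : spr1 V (word w) = spr1_word w.
Proof. exact: sym_liftE. Qed.

Lemma spr1_ssgn a : spr1 V (ssgn V a) = gsgn V (spr1 V a).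
Proof.
elim/pres_ind: a => [|c a b ha hb|w]; first by rewrite !linear0.
- by rewrite !linearP ha hb.
- by rewrite ssgnE !spr1E; case: w => [|x [|y w]] /=; rewrite ?linear0.
Qed.

Lemma spr1_vee x a : spr1 V (vee x a) = (seps V a : K) *: x.
Proof.
elim/pres_ind: a => [|c a b ha hb|w]; first by rewrite !linear0 scale0r.
- by rewrite !linearP ha hb scalerDl scalerA.
- rewrite veeE spr1E sym_liftE; case: w => [|y w] /=.
    by rewrite scale1r.
  by rewrite scale0r.
Qed.

Lemma vee_additive (a : S) : additive_map (fun z => vee z a).
Proof. exact: linear_additive (@vee_linear _ _ _). Qed.

(** [prim_mul] encodes the Koszul sign by splitting x into its even and odd parts; once the factors
    are multiplied together, this sign is exactly the one of graded commutativity. *)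
Lemma vee_gpar (x y : V) c :
  vee y (vee (gpar V false x) c) + vee (gsgn V y) (vee (gpar V true x) c)
  = vee x (vee y c).
Proof.
elim/gvect_ind: x => [|x x' hx hx'|i x hx].
- by rewrite !linear0 !vee0 !linear0 addr0.
- by rewrite !linearD !vee_additive !linearD addrACA hx hx'.
elim/gvect_ind: y => [|y y' hy hy'|j y hy].
- by rewrite !linear0 !vee0 !linear0 addr0.
- by rewrite !linearD !vee_additive !linearD addrACA hy hy'.
rewrite !(gweight_hom _ hx) (gsgn_hom hy) !veeZ !linearZ /=.
rewrite (vee_commE c hx hy) /sgnz odd_mulz.
by do 2 case: odd; rewrite /= ?(scale0r, scale1r, scaler0, addr0, add0r).
Qed.

Definition vee_tens : {linear tens V S -> S} :=
  tlift (@vee_linear K V) (fun x c a b => linearP (vee x) c a b).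

Lemma vee_tensE x a : vee_tens (tpure x a) = vee x a.
Proof. exact: tliftE. Qed.

Lemma vee_tens_prim_mul x t :
  vee_tens (tmap (spr1 V) (idlin S) (prim_mul x t)) =
  vee x (prM V S t) + vee x (vee_tens (tmap (spr1 V) (idlin S) t)).
Proof.
rewrite -!complinE -addlinE; move: t; apply: tens_lin_ext => b c.
rewrite addlinE !complinE prim_mulE prMEl !linearD /= !tmapE !vee_tensE !idlinE.
by rewrite spr1_vee spr1_ssgn vee_gpar veeZ linearZ.
Qed.

(** An Euler operator: splitting off one letter in all ways and multiplying it back yields the word
    once per letter. *)
Lemma vee_tens_sdelta w :
  vee_tens (tmap (spr1 V) (idlin S) (sdelta V (word w))) = (size w)%:R *: word w.
Proof.
elim: w => [|x w IH].
  by rewrite sdelta1 tmapE vee_tensE spr1E vee0 scale0r.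
rewrite -veeE sdelta_vee vee_tens_prim_mul IH prM_sdelta linearZ /= veeE.
by rewrite -add1n natrD scalerDl scale1r.
Qed.

Definition inv_len_word (w : seq V) : S := ((size w)%:R^-1 : K) *: word w.

Lemma inv_len_lin u w c x y : inv_len_word (u ++ (c *: x + y) :: w)
  = c *: inv_len_word (u ++ x :: w) + inv_len_word (u ++ y :: w).
Proof.
by rewrite /inv_len_word !size_cat /= word_lin scalerDr !scalerA mulrC.
Qed.

Lemma inv_len_comm u w i j x y : hom i x -> hom j y ->
  inv_len_word (u ++ x :: y :: w) = sgnz (i * j) *: inv_len_word (u ++ y :: x :: w).
Proof.
move=> hx hy.
by rewrite /inv_len_word !size_cat /= (word_comm _ _ hx hy) !scalerA mulrC.
Qed.

(* The empty word is sent to 0, because 0^-1 = 0. *)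
Definition inv_len : {linear S -> S} := sym_lift inv_len_lin inv_len_comm.

(** In characteristic zero the Euler operator is inverted on nonempty words. Hence a is determined
    by its counit and by its coproduct with corestricted left factor, which turns information on
    corestrictions into information on Sym(V). *)
Lemma sym_recon (charK0 : [pchar K] =i pred0) a :
  a = (seps V a : K) *: sym1 V +
      inv_len (vee_tens (tmap (spr1 V) (idlin S) (sdelta V a))).
Proof.
elim/pres_ind: a => [|c a b ha hb|w]; first by rewrite !linear0 scale0r addr0.
- by rewrite !linearP /= scalerDl [in LHS]ha [in LHS]hb scalerDr addrACA scalerA.
change (word w = (seps V (word w) : K) *: sym1 V +
      inv_len (vee_tens (tmap (spr1 V) (idlin S) (sdelta V (word w))))).
rewrite vee_tens_sdelta linearZ /= !sym_liftE /inv_len_word; case: w => [|x w] /=.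
  by rewrite scale1r !scale0r addr0.
rewrite scale0r add0r scalerA divff ?scale1r //.
by rewrite (proj1 (pcharf0P K) charK0).
Qed.

(** Prepares inductions through [sym_recon]: terms with left factor 1 are controlled by the
    corestricted value of a map at 1, the others by induction on length. *)
Lemma sdelta_split w :
  lspan (fun t => (exists c, t = tpure (sym1 V) c) \/
    (exists b w', (size w' < size w)%N /\ t = tpure b (word w'))) (sdelta V (word w)).
Proof.
(* The induction needs a length bound also for left factor 1, since a further letter may join that
   factor. *)
suff : lspan (fun t => exists b w', ((b = sym1 V /\ (size w' <= size w)%N) \/
    (size w' < size w)%N) /\ t = tpure b (word w')) (sdelta V (word w)).
  apply: lspan_mono => t [b [w' [[[-> _]|lt] ->]]]; first by left; exists (word w').
  by right; exists b, w'.
elim: w => [|x w IH].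
  apply: lspan_gen; exists (sym1 V), [::]; split; last exact: sdelta1.
  by left.
rewrite -veeE sdelta_vee; apply: lspan_map IH => t [b [w' [h ->]]].
have le : (size w' <= size w)%N by case: h => [[_ //]|/ltnW].
rewrite prim_mulE !veeE; apply: lspanD.
  by apply: lspan_gen; exists (vee x b), w'; split => //; right.
apply: lspanD; apply: lspan_gen.
  exists b, (gpar V false x :: w'); split=> //=.
exists (ssgn V b), (gpar V true x :: w'); split=> //=.
by case: h => [[-> _]|lt]; [left; rewrite ssgnE|right].
Qed.

Lemma sym_len_ind (P : S -> Prop) :
  P 0 -> (forall c a b, P a -> P b -> P (c *: a + b)) ->
  (forall w, (forall w', (size w' < size w)%N -> P (word w')) -> P (word w)) ->
  forall a, P a.
Proof.
move=> P0 Plin Pw; elim/pres_ind => // w; change (P (word w)).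
elim: {w}(size w).+1 {-2}w (ltnSn (size w)) => // n IH w lt.
by apply: Pw => w' lt'; apply: IH; apply: leq_trans lt' _.
Qed.

End Euler.

(** * Coalgebra morphisms depending formally on t *)

Section GroupLike.
Variables (K : fieldType) (V : gvect K) (charK0 : [pchar K] =i pred0).
Local Notation S := (Sym V).

Definition grouplike (F : nat -> {linear S -> S}) :=
  (forall n a, sdelta V (F n a) =
     \sum_(j < n.+1) tmap (F j) (F (n - j)%N) (sdelta V a)) /\
  (forall n a, seps V (F n a) = psC (seps V a) n).

(* Induction on n, then on the length of words: by sym_recon, F n w is determined
   by the values F m w' with m < n or w' shorter than w. *)
Lemma grouplike_uniq (F G : nat -> {linear S -> S}) :
  grouplike F -> grouplike G ->
  spr1 V (F 0%N (sym1 V)) = 0 -> spr1 V (G 0%N (sym1 V)) = 0 ->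
  (forall n, (forall m, (m < n)%N -> F m =1 G m) ->
     forall a, spr1 V (F n a) = spr1 V (G n a)) ->
  forall n, F n =1 G n.
Proof.
move=> [Fd Fe] [Gd Ge] F0 G0 FG n.
elim/ltn_ind: n => n IH.
have E1 j a : (j <= n)%N -> spr1 V (F j a) = spr1 V (G j a).
  by move=> le; apply: FG => m lt; apply: IH; exact: leq_trans lt le.
elim/sym_len_ind => [|c a b ha hb|w Hw]; first by rewrite !linear0.
  by rewrite !linearP ha hb.
rewrite [LHS](sym_recon charK0) [RHS](sym_recon charK0) Fe Ge.
congr (_ + inv_len _ (vee_tens _ _)); rewrite Fd Gd !linear_sum /=.
apply: eq_bigr => j _; have jn := leq_ord j.
rewrite !tmap_comp; apply: lspan_ext (sdelta_split w) => _ [[c ->]|[b [w' [lt ->]]]];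
  rewrite !tmapE !complinE !idlinE (E1 _ _ jn).
  case: (posnP j) => [->|j0]; first by rewrite G0 !tpure0l.
  by rewrite IH // ltn_subrL j0 (leq_trans j0 jn).
case: (posnP j) => [->|j0]; first by rewrite subn0 Hw.
by rewrite IH // ltn_subrL j0 (leq_trans j0 jn).
Qed.

End GroupLike.

(** * Filtrations and convergence *)

Record is_filtration (K : fieldType) (A : lmodType K) (fA : int -> A -> Prop) : Prop := {
  filtr0 : forall k, fA k 0;
  filtr_lin : forall k c x y, fA k x -> fA k y -> fA k (c *: x + y);
  filtr_mono : forall k k' x, k <= k' -> fA k' x -> fA k x;
  filtr_exh : forall x, exists k, fA k x
}.

(** [converges fA u l] unfolds to [tends0] of the differences [u n - l]; limits are proved in that
    form throughout. *)
Definition tends0 (A : Type) (fA : int -> A -> Prop) (u : nat -> A) :=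
  forall k, exists n0, forall n, (n0 <= n)%N -> fA k (u n).

Section Filtrations.
Variable K : fieldType.

Section Closure.
Variables (A : lmodType K) (fA : int -> A -> Prop) (HA : is_filtration fA).

Lemma filtrD k x y : fA k x -> fA k y -> fA k (x + y).
Proof. by move=> hx hy; rewrite -[x]scale1r; exact: filtr_lin. Qed.

Lemma filtrZ k c x : fA k x -> fA k (c *: x).
Proof. by move=> hx; rewrite -[_ *: _]addr0; apply: filtr_lin => //; exact: filtr0. Qed.

Lemma filtrN k x : fA k x -> fA k (- x).
Proof. by rewrite -scaleN1r; exact: filtrZ. Qed.

Lemma filtrB k x y : fA k x -> fA k y -> fA k (x - y).
Proof. by move=> hx hy; apply: filtrD => //; exact: filtrN. Qed.

Lemma filtr_sum k (I : Type) (r : seq I) (P : pred I) (F : I -> A) :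
  (forall i, P i -> fA k (F i)) -> fA k (\sum_(i <- r | P i) F i).
Proof. by move=> h; apply: big_ind => //; [exact: filtr0|exact: filtrD]. Qed.

Lemma tends0D u v : tends0 fA u -> tends0 fA v -> tends0 fA (fun n => u n + v n).
Proof.
move=> hu hv k; have [m hm] := hu k; have [n hn] := hv k.
exists (maxn m n) => i; rewrite geq_max => /andP[mi ni].
by apply: filtrD; [exact: hm|exact: hn].
Qed.

Lemma tends0Z c u : tends0 fA u -> tends0 fA (fun n => c *: u n).
Proof. by move=> hu k; have [m hm] := hu k; exists m => i /hm; exact: filtrZ. Qed.

Lemma tends0_cst0 : tends0 fA (fun=> 0).
Proof. by move=> k; exists 0%N => n _; exact: filtr0. Qed.

Lemma tends0N u : tends0 fA u -> tends0 fA (fun n => - u n).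
Proof. by move=> hu k; have [m hm] := hu k; exists m => i /hm; exact: filtrN. Qed.

Lemma tends0B u v : tends0 fA u -> tends0 fA v -> tends0 fA (fun n => u n - v n).
Proof. by move=> hu hv; apply: tends0D => //; exact: tends0N. Qed.

Lemma eq_tends0 u v : u =1 v -> tends0 fA u -> tends0 fA v.
Proof. by move=> uv hu k; have [m hm] := hu k; exists m => n /hm; rewrite uv. Qed.

Lemma tends0_sum (J : nat) (u : nat -> nat -> A) : (forall j, tends0 fA (u j)) ->
  tends0 fA (fun n => \sum_(j < J) u j n).
Proof.
move=> hu; elim: J => [|J IH].
  by apply: (eq_tends0 _ tends0_cst0) => n; rewrite big_ord0.
by apply: (eq_tends0 _ (tends0D IH (hu J))) => n; rewrite big_ord_recr.
Qed.

Lemma tends0_shift m u : tends0 fA u -> tends0 fA (fun n => u (n + m)%N).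
Proof.
by move=> hu k; have [n0 h] := hu k; exists n0 => n le; apply: h;
  apply: leq_trans le (leq_addr _ _).
Qed.

(** Allows an identity to fail at the first indices, for instance where a truncation is still
    empty. *)
Lemma tends0_unshift m u : tends0 fA (fun n => u (n + m)%N) -> tends0 fA u.
Proof.
move=> hu k; have [n0 h] := hu k; exists (n0 + m)%N => n le.
have mn : (m <= n)%N by apply: leq_trans le; exact: leq_addl.
by rewrite -(subnK mn); apply: h; rewrite leq_subRL // addnC.
Qed.

Lemma converges_series_tends0 u l : converges fA (series u) l -> tends0 fA u.
Proof.
move=> hu; apply: (eq_tends0 _ (tends0B (tends0_shift 1 hu) hu)) => n.
by rewrite addn1 /series big_ord_recr /= opprB addrA subrK addrC addKr.
Qed.

Lemma converges_lin c u v l m : converges fA u l -> converges fA v m ->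
  converges fA (fun n => c *: u n + v n) (c *: l + m).
Proof.
move=> hu hv; apply: (eq_tends0 _ (tends0D (tends0Z c hu) hv)) => n.
by rewrite scalerBr opprD addrACA.
Qed.

Lemma series_lin c (u v : nat -> A) n :
  series (fun i => c *: u i + v i) n = c *: series u n + series v n.
Proof. by rewrite /series scaler_sumr -big_split. Qed.

Lemma converges_unique u l m : (forall x, (forall k, fA k x) -> x = 0) ->
  converges fA u l -> converges fA u m -> l = m.
Proof.
move=> sep hl hm; apply/eqP; rewrite -subr_eq0; apply/eqP; apply: sep => k.
have [n0 h] := tends0B hm hl k; move: (h n0 (leqnn _)).
by rewrite opprB addrC addrA subrK.
Qed.

End Closure.

Lemma linear_series (A B : lmodType K) (f : {linear A -> B}) u n :
  f (series u n) = series (fun i => f (u i)) n.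
Proof. by rewrite /series linear_sum. Qed.

Lemma tends0_map (A B : lmodType K) fA fB d (f : {linear A -> B}) u :
  degree_map fA fB d f -> tends0 fA u -> tends0 fB (fun n => f (u n)).
Proof.
move=> hf hu k; have [n0 h] := hu (k - d); exists n0 => n /h /hf.
by rewrite subrK.
Qed.

Lemma converges_map (A B : lmodType K) fA fB d (f : {linear A -> B}) u l :
  degree_map fA fB d f -> converges fA u l -> converges fB (fun n => f (u n)) (f l).
Proof.
move=> hf hu; apply: (eq_tends0 _ (tends0_map hf hu)) => n.
by rewrite linearB.
Qed.

(* S1 n stands for the n-th approximation of the value at t = 1 of the
   series S; S1 is not assumed to converge. *)
Lemma series_cauchy_prod (A B : lmodType K) fA fB d (HA : is_filtration fA)
    (HB : is_filtration fB) (S S1 : nat -> {linear A -> B}) u y :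
  (forall n, degree_map fA fB d (S n)) -> (forall n, degree_map fA fB d (S1 n)) ->
  (forall a, tends0 fB (fun n => S1 n a - series (fun i => S i a) n)) ->
  (forall a, tends0 fB (fun n => S n a)) -> converges fA (series u) y ->
  tends0 fB (fun n => S1 n y - series (cauchy_prod (fun f a => f a) S u) n).
Proof.
move=> hS hS1 appr S0 hu k.
have [J1 h1] := converges_series_tends0 HA hu (k - d).
have [J2 h2] := hu (k - d).
pose J := maxn J1 J2.
(* For fixed j, the sum up to n - j misses only terms S i (u j) with large i, and these tend to
   0. *)
have T j : tends0 fB (fun n => S1 n (u j) - \sum_(i < n - j) S i (u j)).
  apply: (eq_tends0 _ (tends0D HB (appr (u j)) (u := _)
     (v := fun n => \sum_(n - j <= i < n) S i (u j)) _)).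
    move=> n; rewrite -addrA; congr (_ + _).
    rewrite /series -!(big_mkord xpredT (fun i => S i (u j))).
    by rewrite (@big_cat_nat _ _ _ (n - j)%N 0 n) ?leq_subr //= opprD addrNK.
  move=> l; have [n0 h] := S0 (u j) l; exists (n0 + j)%N => n le.
  rewrite big_nat; apply: filtr_sum => // i /andP[ni _]; apply: h.
  by apply: leq_trans ni; rewrite leq_subRL ?(leq_trans (leq_addl _ _) le) // addnC.
have [n0 h0] := tends0_sum HB J T k.
exists (maxn n0 J) => n; rewrite geq_max => /andP[/h0 hn Jn].
have -> : series (cauchy_prod (fun (f : {linear A -> B}) a => f a) S u) n =
    \sum_(j < n) \sum_(i < n - j) S i (u j).
  exact: (triangle_sumr (fun i j => S i (u j))).
(* Three errors: [S1 n] applied to a tail of [u]; finitely many columns, small by [T]; the remaining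
   columns, whose vectors u j are already small. The common shift d makes the first and the last
   uniform in n. *)
have -> : S1 n y - \sum_(j < n) \sum_(i < n - j) S i (u j) =
   - S1 n (series u J - y) +
   (\sum_(j < J) (S1 n (u j) - \sum_(i < n - j) S i (u j))
    - \sum_(J <= j < n) \sum_(i < n - j) S i (u j)).
  rewrite big_split /= sumrN linearB opprB -addrA.
  rewrite -(big_mkord xpredT (fun j => \sum_(i < n - j) S i (u j))).
  rewrite -[in RHS](big_mkord xpredT (fun j => \sum_(i < n - j) S i (u j))).
  rewrite (@big_cat_nat _ _ _ J 0 n) //= linear_sum /=.
  by rewrite opprD -!addrA addKr.
apply: filtrD => //.
  apply: filtrN => //; rewrite -[k](subrK d); apply: hS1; apply: h2.
  exact: leq_maxr.
apply: filtrB => //; rewrite big_nat; apply: filtr_sum => // j /andP[Jj _].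
apply: filtr_sum => // i _; rewrite -[k](subrK d); apply: hS; apply: h1.
by apply: leq_trans Jj; exact: leq_maxl.
Qed.

Lemma converges_cauchy_prod (A B : lmodType K) fA fB d (HA : is_filtration fA)
    (HB : is_filtration fB) (S : nat -> {linear A -> B}) (S1 : {linear A -> B}) u y :
  (forall n, degree_map fA fB d (S n)) -> degree_map fA fB d S1 ->
  (forall a, converges fB (series (fun n => S n a)) (S1 a)) ->
  converges fA (series u) y ->
  converges fB (series (cauchy_prod (fun f a => f a) S u)) (S1 y).
Proof.
move=> hS hS1 cS hu.
have := @series_cauchy_prod _ _ _ _ d HA HB S (fun=> S1) u y hS (fun=> hS1) _ _ hu.
have cS' a : tends0 fB (fun n => S1 a - series (fun i => S i a) n).
  apply: (eq_tends0 _ (tends0N HB (cS a))) => n; exact: opprB.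
move=> /(_ cS' (fun a => converges_series_tends0 HB (cS a))) h.
apply: (eq_tends0 _ (tends0N HB h)) => n; exact: opprB.
Qed.

End Filtrations.

(** * Filtrations and gradings of Sym(V) and of tensor products *)

Section FiltrationInstances.
Variable K : fieldType.

Lemma fil_mono (V : fgvect K) k k' (x : V) : k <= k' -> fil V k' x -> fil V k x.
Proof.
move=> le; rewrite -[k'](subrK k) -(gez0_abs (m := k' - k)) ?subr_ge0 //.
elim: `|k' - k|%N => [|n IH]; first by rewrite add0r.
by rewrite intS -addrA addrC => /fil_desc.
Qed.

Lemma fil_filtration (V : fgvect K) : is_filtration (fil V).
Proof.
split; [exact: fil0|exact: fil_lin|exact: fil_mono|exact: fil_exhaustive].
Qed.

Lemma lspan_exh (A : lmodType K) (P : int -> A -> Prop) :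
  (forall k k' x, k <= k' -> lspan (P k') x -> lspan (P k) x) ->
  forall c a b, (exists k, lspan (P k) a) -> (exists k, lspan (P k) b) ->
  exists k, lspan (P k) (c *: a + b).
Proof.
move=> mono c a b [i ha] [j hb]; exists (Order.min i j); apply: lspan_lin.
  by apply: mono ha; rewrite ge_min lexx.
by apply: mono hb; rewrite ge_min lexx orbT.
Qed.

Lemma sym_fil_filtration (V : fgvect K) : is_filtration (@sym_fil K V).
Proof.
have mono k k' (x : Sym V) : k <= k' -> sym_fil k' x -> sym_fil k x.
  move=> le; apply: lspan_mono => a [w [hw le' ->]]; exists w; split=> //.
  exact: le_trans le'.
split=> //; [by move=> k; exact: lspan0|by move=> *; exact: lspan_lin|].
elim/pres_ind => [|c a b|w]; first by exists 0; exact: lspan0.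
  exact: lspan_exh.
have [w' [hw' E]] : exists w' : seq (int * V),
    (forall p, p \in w' -> fil V p.1 p.2) /\ map snd w' = w.
  elim: w => [|x w [w' [hw' <-]]]; first by exists [::].
  have [k hk] := fil_exhaustive x; exists ((k, x) :: w'); split=> // p.
  by rewrite inE => /orP[/eqP -> //|/hw'].
by exists (\sum_(p <- w') p.1); apply: lspan_gen; exists w'; rewrite E.
Qed.

Lemma tens_fil_filtration (A B : lmodType K) fA fB :
  is_filtration fA -> is_filtration fB -> is_filtration (@tens_fil K A B fA fB).
Proof.
move=> HA HB.
have mono k k' x : k <= k' -> tens_fil fA fB k' x -> tens_fil fA fB k x.
  move=> le; apply: lspan_mono => t [i [j [a [b [ha hb le' ->]]]]].
  by exists i, j, a, b; split=> //; exact: le_trans le'.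
split=> //; [by move=> k; exact: lspan0|by move=> *; exact: lspan_lin|].
elim/pres_ind => [|c a b|[a b]]; first by exists 0; exact: lspan0.
  exact: lspan_exh.
have [i ha] := filtr_exh HA a; have [j hb] := filtr_exh HB b.
by exists (i + j); apply: lspan_gen; exists i, j, a, b.
Qed.

Lemma tpure_fil (A B : lmodType K) fA fB i j k (a : A) (b : B) :
  fA i a -> fB j b -> k = i + j -> tens_fil fA fB k (tpure a b).
Proof. by move=> ha hb ->; apply: lspan_gen; exists i, j, a, b. Qed.

Lemma tmap_fil (A B C D : lmodType K) fA fB fC fD d e
    (f : {linear A -> C}) (g : {linear B -> D}) :
  degree_map fA fC d f -> degree_map fB fD e g ->
  degree_map (tens_fil fA fB) (tens_fil fC fD) (d + e) (tmap f g).
Proof.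
move=> hf hg k x; apply: lspan_map => t [i [j [a [b [ha hb le ->]]]]].
rewrite tmapE; apply: lspan_gen; exists (i + d), (j + e), (f a), (g b).
by split; [exact: hf|exact: hg|rewrite addrACA lerD2r|].
Qed.

Lemma degree_map_id (A : lmodType K) (fA : int -> A -> Prop) : degree_map fA fA 0
  (idlin A).
Proof. by move=> k a ha; rewrite addr0 idlinE. Qed.

Lemma degree_map_comp (A B C : lmodType K) (fA : int -> A -> Prop)
    (fB : int -> B -> Prop) (fC : int -> C -> Prop) d e
    (f : {linear A -> B}) (g : {linear B -> C}) :
  degree_map fA fB d f -> degree_map fB fC e g -> degree_map fA fC (d + e) (g \oL f).
Proof. by move=> hf hg k a /hf /hg; rewrite addrA complinE. Qed.

Lemma filtered_degree0 (A B : Type) (fA : int -> A -> Prop) (fB : int -> B -> Prop) f :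
  filtered_map fA fB f <-> degree_map fA fB 0 f.
Proof. by split=> h k a /h; rewrite addr0. Qed.

Lemma tassoc_fil (A B C : lmodType K) fA fB fC : is_filtration fA ->
  is_filtration fB -> is_filtration fC ->
  filtered_map (tens_fil (tens_fil fA fB) fC) (tens_fil fA (tens_fil fB fC))
    (tassoc A B C).
Proof.
move=> HA HB HC k x; apply: lspan_map => t [i [j [u [c [hu hc le ->]]]]].
rewrite tliftE; apply: lspan_map hu => v [p [q [a [b [ha hb le' ->]]]]].
rewrite tliftE; apply: lspan_gen; exists p, (q + j), a, (tpure b c); split=> //.
  by apply: tpure_fil hb hc _.
by rewrite addrA; apply: le_trans le _; rewrite lerD2r.
Qed.

Lemma tpure_hom (A B : lmodType K) hA hB i j k (a : A) (b : B) :
  hA i a -> hB j b -> k = i + j -> tens_hom hA hB k (tpure a b).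
Proof. by move=> ha hb ->; apply: lspan_gen; exists i, j, a, b. Qed.

Lemma tmap_hom (A B C D : lmodType K) hA hB hC hD d e
    (f : {linear A -> C}) (g : {linear B -> D}) :
  degree_map hA hC d f -> degree_map hB hD e g ->
  degree_map (tens_hom hA hB) (tens_hom hC hD) (d + e) (tmap f g).
Proof.
move=> hf hg k x; apply: lspan_map => t [i [j [a [b [ha hb <- ->]]]]].
rewrite tmapE; apply: tpure_hom (hf _ _ ha) (hg _ _ hb) _.
by rewrite addrACA.
Qed.

Lemma tassoc_hom (A B C : lmodType K) hA hB hC :
  degree_map (tens_hom (tens_hom hA hB) hC) (tens_hom hA (tens_hom hB hC)) 0
    (tassoc A B C).
Proof.
move=> k x; rewrite addr0; apply: lspan_map => t [i [j [u [c [hu hc <- ->]]]]].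
rewrite tliftE; apply: lspan_map hu => v [p [q [a [b [ha hb <- ->]]]]].
rewrite tliftE -addrA; apply: tpure_hom ha _ erefl; exact: tpure_hom hb hc erefl.
Qed.

End FiltrationInstances.

(** * Degree and filtration of the structure maps *)

Section SymDegrees.
Variables (K : fieldType) (V : gvect K).
Local Notation S := (Sym V).

Lemma ssgn_hom : degree_map (@sym_hom K V) (@sym_hom K V) 0 (ssgn V).
Proof.
by move=> i a ha; rewrite addr0 (ssgn_sym_hom ha); exact: lspanZ.
Qed.

Lemma sgn_pow_hom d : degree_map (@sym_hom K V) (@sym_hom K V) 0 (sgn_pow d).
Proof.
by rewrite /sgn_pow; case: odd; [exact: ssgn_hom|exact: degree_map_id].
Qed.

Lemma sdelta_hom :
  degree_map (@sym_hom K V) (tens_hom (@sym_hom K V) (@sym_hom K V)) 0 (sdelta V).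
Proof.
move=> d a; rewrite addr0; apply: lspan_map => {}a [w [hw <- ->]].
elim: w hw => [|[i x] w IH] hw.
  by rewrite big_nil sdelta1; apply: tpure_hom (sym_hom1 V) (sym_hom1 V) _.
have hx : hom i x by apply: (hw (i, x)); rewrite mem_head.
rewrite big_cons -veeE sdelta_vee.
have : tens_hom (@sym_hom K V) (@sym_hom K V) (\sum_(p <- w) p.1)
    (sdelta V (word (map snd w))) by apply: IH => p pw; apply: hw; rewrite inE pw orbT.
apply: lspan_map => t [j [k [b [c [hb hc <- ->]]]]].
rewrite (prim_mul_hom _ _ hx); apply: lspanD.
  by apply: tpure_hom (sym_hom_vee hx hb) hc _; rewrite addrA.
apply: tpure_hom (_ : sym_hom j _) (sym_hom_vee hx hc) _; last by rewrite addrCA.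
by case: odd => //; rewrite -[j]addr0; exact: ssgn_hom.
Qed.

Lemma coact_hom (M : lmodType K) hM : degree_map (tens_hom (@sym_hom K V) hM)
  (tens_hom (@sym_hom K V) (tens_hom (@sym_hom K V) hM)) 0 (coact V M).
Proof.
apply: (@degree_map_comp _ _ _ _ _ _ _ 0 0) (@tassoc_hom _ _ _ _ _ _ _).
exact: (@tmap_hom _ _ _ _ _ _ _ _ _ 0 0) sdelta_hom (@degree_map_id _ _ _).
Qed.

Lemma seps_hom_neq0 d (a : S) : sym_hom d a -> d != 0 -> seps V a = 0.
Proof.
move=> ha d0; elim: ha => [|{}a [w [_ E ->]]|c b b' _ IHb _ IHb'].
- exact: linear0.
- rewrite sym_liftE; case: w E => [|p w] //=.
  by rewrite big_nil => d0'; rewrite -d0' eqxx in d0.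
- by rewrite linearP IHb IHb' /= scaler0 addr0.
Qed.

Lemma prM_hom (M : gvect K) :
  degree_map (tens_hom (@sym_hom K V) (@hom K M)) (@hom K M) 0 (prM V M).
Proof.
move=> d x; rewrite addr0; elim=> [|t [i [j [a [m [ha hm <- ->]]]]]|c a b _ IHa _ IHb].
- by rewrite !linear0 /hom linear0.
- rewrite prMEl; have [->|/(seps_hom_neq0 ha) ->] := eqVneq i 0.
    by rewrite /hom add0r linearZ /= hm.
  by rewrite scale0r /hom linear0.
- by rewrite /hom !linearP /= IHa IHb.
Qed.

End SymDegrees.

Section SymFiltration.
Variables (K : fieldType) (V : fgvect K).
Local Notation S := (Sym V).
Local Notation filS := (@sym_fil K V).

Lemma gweight_fil c k (x : V) : fil V k x -> fil V k (gweight V c x).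
Proof.
move=> hx; rewrite mklinE; apply: (filtr_sum (fil_filtration V)) => i _.
by apply: (filtrZ (fil_filtration V)); exact: fil_graded.
Qed.

Lemma vee_fil d (x : V) : fil V d x -> degree_map filS filS d (vee x).
Proof.
move=> hx k a; apply: lspan_map => {}a [w [hw le ->]]; apply: lspan_gen.
exists ((d, x) :: w); split; rewrite ?big_cons ?veeE //=.
  by move=> p; rewrite inE => /orP[/eqP -> //|/hw].
by rewrite addrC lerD2l.
Qed.

Lemma sym1_fil : filS 0 (sym1 V).
Proof. by apply: lspan_gen; exists [::]; rewrite big_nil. Qed.

Lemma ssgn_fil : degree_map filS filS 0 (ssgn V).
Proof.
move=> k a; rewrite addr0; apply: lspan_map => {}a [w [hw le ->]]; apply: lspan_gen.
exists [seq (p.1, gsgn V p.2) | p <- w]; split.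
- by move=> _ /mapP[p pw ->] /=; apply: gweight_fil; apply: hw.
- by rewrite big_map.
- by rewrite ssgnE -!map_comp.
Qed.

Lemma sgn_pow_fil d : degree_map filS filS 0 (sgn_pow d).
Proof.
by rewrite /sgn_pow; case: odd; [exact: ssgn_fil|exact: degree_map_id].
Qed.

Lemma prim_mul_fil d x : fil V d x ->
  degree_map (tens_fil filS filS) (tens_fil filS filS) d (prim_mul x).
Proof.
move=> hx k t; apply: lspan_map => {}t [i [j [a [b [ha hb le ->]]]]].
rewrite prim_mulE; have leD : k + d <= i + j + d by rewrite lerD2r.
have mono := filtr_mono (tens_fil_filtration (sym_fil_filtration V)
  (sym_fil_filtration V)) leD.
apply: lspanD; [|apply: lspanD]; apply: mono.
- by apply: tpure_fil (vee_fil hx ha) hb _; rewrite addrAC.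
- by apply: tpure_fil ha (vee_fil (gweight_fil _ hx) hb) _; rewrite addrA.
- apply: tpure_fil (ssgn_fil ha) (vee_fil (gweight_fil _ hx) hb) _.
  by rewrite addr0 addrA.
Qed.

Lemma sdelta_fil : degree_map filS (tens_fil filS filS) 0 (sdelta V).
Proof.
move=> k a; rewrite addr0; apply: lspan_map => {}a [w [hw le ->]].
apply: (filtr_mono (tens_fil_filtration (sym_fil_filtration V)
  (sym_fil_filtration V)) le).
elim: w hw {le} => [|[i x] w IH] hw.
  by rewrite big_nil sdelta1; apply: tpure_fil sym1_fil sym1_fil _; rewrite addr0.
have hx : fil V i x by apply: (hw (i, x)); rewrite mem_head.
rewrite big_cons -veeE sdelta_vee addrC; apply: prim_mul_fil => //.
by apply: IH => p pw; apply: hw; rewrite inE pw orbT.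
Qed.

Lemma coact_fil (M : lmodType K) fM : is_filtration fM ->
  degree_map (tens_fil filS fM) (tens_fil filS (tens_fil filS fM)) 0 (coact V M).
Proof.
move=> HM; apply: (@degree_map_comp _ _ _ _ _ _ _ 0 0).
  exact: (@tmap_fil _ _ _ _ _ _ _ _ _ 0 0) sdelta_fil (@degree_map_id _ _ _).
apply/filtered_degree0; apply: tassoc_fil => //; exact: sym_fil_filtration.
Qed.

(** The empty word has weight 0, so positive filtration excludes it. This makes [prM] filtered
    although letters may have negative weight. *)
Lemma seps_fil_gt0 k (a : S) : filS k a -> 0 < k -> seps V a = 0.
Proof.
move=> ha k0; elim: ha => [|{}a [w [_ le ->]]|c b b' _ IHb _ IHb'].
- exact: linear0.
- rewrite sym_liftE; case: w le => [|p w] //=.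
  by rewrite big_nil leNgt k0.
- by rewrite linearP IHb IHb' /= scaler0 addr0.
Qed.

Lemma prM_fil (M : lmodType K) fM : is_filtration fM ->
  degree_map (tens_fil filS fM) fM 0 (prM V M).
Proof.
move=> HM d x; rewrite addr0; elim=> [|t [i [j [a [m [ha hm le ->]]]]]|c a b _ IHa _ IHb].
- by rewrite linear0; exact: filtr0.
- rewrite prMEl; have [i0|/(seps_fil_gt0 ha) ->] := leP i 0.
    apply: filtrZ => //; apply: filtr_mono hm => //.
    by apply: le_trans le _; rewrite gerDr.
  by rewrite scale0r; exact: filtr0.
- by rewrite linearP; exact: filtr_lin.
Qed.

Lemma spr1_fil : degree_map filS (fil V) 0 (spr1 V).
Proof.
have HV := fil_filtration V.
move=> k a; rewrite addr0; elim=> [|{}a [w [hw le ->]]|c b b' _ IHb _ IHb'].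
- by rewrite linear0; exact: fil0.
- rewrite spr1E; case: w hw le => [|p [|q w]] hw le /=; [exact: fil0| |exact: fil0].
  apply: fil_mono (hw _ (mem_head _ _)).
  by apply: le_trans le _; rewrite big_seq1.
- by rewrite linearP; exact: fil_lin.
Qed.

Lemma inv_len_fil : degree_map filS filS 0 (@inv_len K V).
Proof.
move=> k a; rewrite addr0; apply: lspan_map => {}a [w [hw le ->]].
by rewrite sym_liftE; apply: lspanZ; apply: lspan_gen; exists w.
Qed.

Lemma idtens_fil (M N : lmodType K) fM fN d e (f : {linear M -> N}) :
  degree_map fM fN e f -> degree_map (tens_fil filS fM) (tens_fil filS fN) e
    (@idtens K V _ _ d f).
Proof.
by move=> hf; rewrite idtensE -[e]add0r; apply: tmap_fil => //; exact: sgn_pow_fil.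
Qed.

Lemma idtens_hom (M N : lmodType K) hM hN d e (f : {linear M -> N}) :
  degree_map hM hN e f -> degree_map (tens_hom (@sym_hom K V) hM)
    (tens_hom (@sym_hom K V) hN) e (@idtens K V _ _ d f).
Proof.
by move=> hf; rewrite idtensE -[e]add0r; apply: tmap_hom => //; exact: sgn_pow_hom.
Qed.

End SymFiltration.

(** * Power series of operators *)

Section PowerSeriesMaps.
Variable K : fieldType.
Implicit Types A B C : lmodType K.

(** Application as an explicit bilinear map, so that [cauchy_prod] can let operators act on
    vectors. *)
Definition ap A B (f : {linear A -> B}) (a : A) : B := f a.

Lemma ps_compE A B C (S : nat -> {linear B -> C}) (T : nat -> {linear A -> B}) n a :
  ps_comp S T n a = cauchy_prod (@ap B C) S (fun m => T m a) n.
Proof. by rewrite sumlinE; apply: eq_bigr => i _; rewrite complinE. Qed.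

Lemma ps_expE A (T : nat -> {linear A -> A}) n a :
  ps_exp T n a = \sum_(j < n.+1) (j`!)%:R^-1 *: ps_pow T j n a.
Proof. by rewrite sumlinE; apply: eq_bigr => j _; rewrite scalelinE. Qed.

Lemma ps_powS A (T : nat -> {linear A -> A}) j n a :
  ps_pow T j.+1 n a = cauchy_prod (@ap A A) T (fun m => ps_pow T j m a) n.
Proof. exact: ps_compE. Qed.

Lemma ps_pow0 A (T : nat -> {linear A -> A}) n a : ps_pow T 0 n a = psC a n.
Proof. by case: n => [|n]; rewrite /= ?idlinE ?zerolinE. Qed.

Lemma ps_pow_lt A (T : nat -> {linear A -> A}) j n a :
  (forall b, T 0%N b = 0) -> (n < j)%N -> ps_pow T j n a = 0.
Proof.
move=> T0; elim: j n => // j IH n lt; rewrite ps_powS /cauchy_prod big1 // => i _.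
case: i => -[|i] lti; first exact: T0.
by rewrite /ap /= IH ?linear0 //; lia.
Qed.

(** Powers beyond n contribute nothing to t^n, so all coefficients can share one bound before sums
    are exchanged. *)
Lemma ps_exp_widen A (T : nat -> {linear A -> A}) m n a :
  (forall b, T 0%N b = 0) -> (n < m)%N ->
  ps_exp T n a = \sum_(j < m) (j`!)%:R^-1 *: ps_pow T j n a.
Proof.
move=> T0 lt; rewrite ps_expE.
rewrite -(big_mkord xpredT (fun j => (j`!)%:R^-1 *: ps_pow T j n a)).
rewrite -[RHS](big_mkord xpredT (fun j => (j`!)%:R^-1 *: ps_pow T j n a)).
rewrite [RHS](@big_cat_nat _ _ _ n.+1) //= [X in _ = _ + X]big_nat [X in _ = _ +
  X]big1 ?addr0 //.
by move=> j /andP[nj _]; rewrite ps_pow_lt // scaler0.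
Qed.

Lemma ps_exp0 A (T : nat -> {linear A -> A}) a : ps_exp T 0 a = a.
Proof. by rewrite ps_expE big_ord1 ps_pow0 fact0 invr1 scale1r. Qed.

Lemma powlinS A (f : {linear A -> A}) n a : powlin f n.+1 a = f (powlin f n a).
Proof. exact: complinE. Qed.

Lemma exp_truncE A (f : {linear A -> A}) n a :
  exp_trunc f n a = \sum_(j < n) (j`!)%:R^-1 *: powlin f j a.
Proof. by rewrite sumlinE; apply: eq_bigr => j _; rewrite scalelinE. Qed.

Lemma pderiv_inj (charK0 : [pchar K] =i pred0) A (x y : A) n :
  n.+1%:R *: x = n.+1%:R *: y -> x = y.
Proof. by apply: scalerI; rewrite (proj1 (pcharf0P K) charK0). Qed.

(** Lower coefficients determine the coefficient of t^(n+1) after division by n + 1. *)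
Lemma linear_ode_uniq (charK0 : [pchar K] =i pred0) (X : Type) A
    (b : X -> A -> A) q (Y Z : nat -> A) :
  Y 0%N = Z 0%N -> (forall n, pderiv Y n = cauchy_prod b q Y n) ->
  (forall n, pderiv Z n = cauchy_prod b q Z n) -> Y =1 Z.
Proof.
move=> E0 EY EZ n; elim/ltn_ind: n => -[//|n IH].
apply: (@pderiv_inj charK0 _ _ _ n); change (pderiv Y n = pderiv Z n); rewrite EY EZ.
by apply: eq_bigr => i _; rewrite IH // ltnS leq_subr.
Qed.

Section TensorId.
Variables (A B : lmodType K) (T : nat -> {linear A -> A}).
Let TB n := tmap (T n) (idlin B).

Lemma ps_pow_tmap j n t : ps_pow TB j n t = tmap (ps_pow T j n) (idlin B) t.
Proof.
move: t; apply: tens_lin_ext => a b.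
elim: j n => [|j IH] n.
  rewrite tmapE idlinE !ps_pow0; case: n => [|n] //=; by rewrite tpure0l.
rewrite tmapE idlinE !ps_powS /cauchy_prod (additive_sum _ _ _ (tpure_additivel b)).
by apply: eq_bigr => i _; rewrite /ap IH /TB !tmapE !idlinE.
Qed.

Lemma ps_exp_tmap n t : ps_exp TB n t = tmap (ps_exp T n) (idlin B) t.
Proof.
move: t; apply: tens_lin_ext => a b.
rewrite tmapE idlinE !ps_expE (additive_sum _ _ _ (tpure_additivel b)).
by apply: eq_bigr => i _; rewrite ps_pow_tmap tmapE idlinE tpureZl.
Qed.

Lemma powlin_tmap (f : {linear A -> A}) n t :
  powlin (tmap f (idlin B)) n t = tmap (powlin f n) (idlin B) t.
Proof.
move: t; apply: tens_lin_ext => a b.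
elim: n => [|n IH]; first by rewrite tmapE !idlinE.
by rewrite powlinS IH !tmapE !idlinE powlinS.
Qed.

Lemma exp_trunc_tmap (f : {linear A -> A}) n t :
  exp_trunc (tmap f (idlin B)) n t = tmap (exp_trunc f n) (idlin B) t.
Proof.
move: t; apply: tens_lin_ext => a b.
rewrite tmapE idlinE !exp_truncE (additive_sum _ _ _ (tpure_additivel b)).
by apply: eq_bigr => i _; rewrite powlin_tmap tmapE idlinE tpureZl.
Qed.

End TensorId.
End PowerSeriesMaps.

(** * The exponential of a power series of even letters *)

Section ExpEven.
Variables (K : fieldType) (charK0 : [pchar K] =i pred0) (V : gvect K).
Local Notation S := (Sym V).
Variables (p : nat -> V) (p_even : forall n, hom 0 (p n)) (p0 : p 0%N = 0).
Let T n := vee (p n).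
Local Notation P := (ps_exp T).
Local Notation veef := (fun (x : V) (a : S) => vee x a).

Let T0 b : T 0%N b = 0.
Proof. by rewrite /T p0 vee0. Qed.

Let veel (a : S) : linear (veef^~ a) := @vee_linear K V a.
Let veer x : linear (veef x).
Proof. by move=> c a b; rewrite linearP. Qed.

Lemma vee_even_comm n y (a : S) : vee (p n) (vee y a) = vee y (vee (p n) a).
Proof.
elim/gvect_ind: y => [|y y' hy hy'|j y hy].
- by rewrite !vee0 linear0.
- by rewrite !vee_additive linearD /= hy hy'.
by rewrite (vee_commE a (p_even n) hy) mul0r scale1r.
Qed.

Lemma hom_pderiv n : hom 0 (pderiv p n).
Proof. by rewrite /pderiv /hom linearZ /= p_even. Qed.

(** The usual power rule, valid because the letters p n are even and hence commute. *)
Lemma pderiv_ps_pow j a n : pderiv (fun n => ps_pow T j.+1 n a) n =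
  j.+1%:R *: cauchy_prod veef (pderiv p) (fun n => ps_pow T j n a) n.
Proof.
have E j' m : ps_pow T j'.+1 m a = cauchy_prod veef p (fun n => ps_pow T j' n a) m.
  exact: ps_powS.
elim: j n => [|j IH] n; rewrite {1}/pderiv E -/(pderiv _ n)
  (cauchy_prod_pderiv _ _ _ veel veer).
  rewrite scale1r -[RHS]addr0; congr (_ + _); rewrite /cauchy_prod big1 // => i _.
  by rewrite /pderiv ps_pow0 scaler0 linear0.
rewrite -[in RHS]addn1 addnC natrD scalerDl scale1r; congr (_ + _).
transitivity (cauchy_prod veef p (fun m => j.+1%:R *:
    cauchy_prod veef (pderiv p) (fun n => ps_pow T j n a) m) n).
  by apply: eq_bigr => i _; rewrite IH.
transitivity (j.+1%:R *: cauchy_prod veef p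
    (cauchy_prod veef (pderiv p) (fun n => ps_pow T j n a)) n).
  by rewrite /cauchy_prod scaler_sumr; apply: eq_bigr => i _; rewrite linearZ.
congr (_ *: _).
transitivity (cauchy_prod veef (pderiv p) (cauchy_prod veef p
  (fun m => ps_pow T j m a)) n).
  apply: (@cauchy_prod_leftcomm nat nat S S S S (fun i b => vee (p i) b)
    (fun i b => vee (pderiv p i) b) (fun i b => vee (pderiv p i) b)
    (fun i b => vee (p i) b) id id) => i => [b c|b c|k c]; rewrite ?linearD //.
  exact: vee_even_comm.
by apply: eq_bigr => i _; rewrite E.
Qed.

Lemma pderiv_ps_exp a n : pderiv (fun n => P n a) n =
  cauchy_prod veef (pderiv p) (fun n => P n a) n.
Proof.
rewrite {1}/pderiv ps_expE scaler_sumr big_ord_recl.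
rewrite [X in X + _](_ : _ = 0) ?add0r; last by rewrite ps_pow0 !scaler0.
transitivity (\sum_(j < n.+1) (j`!)%:R^-1 *:
    cauchy_prod veef (pderiv p) (fun n => ps_pow T j n a) n).
  apply: eq_bigr => j _; rewrite /= /bump /= add1n scalerA mulrC -scalerA.
  rewrite [X in _ *: X](_ : _ = j.+1%:R *: cauchy_prod veef (pderiv p)
    (fun n => ps_pow T j n a) n); last exact: pderiv_ps_pow.
  rewrite scalerA factS natrM invfM -mulrA mulrC; congr (_ *: _).
  by rewrite -mulrA mulfV ?mulr1 // (proj1 (pcharf0P K) charK0).
rewrite /cauchy_prod; under eq_bigr do rewrite scaler_sumr.
rewrite exchange_big /=; apply: eq_bigr => i _.
rewrite (@ps_exp_widen _ _ T n.+1) //; last by rewrite ltnS leq_subr.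
by rewrite linear_sum /=; apply: eq_bigr => j _; rewrite linearZ.
Qed.

Lemma ps_exp_vee_comm n y a : P n (vee y a) = vee y (P n a).
Proof.
suff E j m : ps_pow T j m (vee y a) = vee y (ps_pow T j m a).
  by rewrite !ps_expE linear_sum; apply: eq_bigr => j _; rewrite E linearZ.
elim: j m => [|j IH] m.
  by rewrite !ps_pow0; case: m => [|m] //=; rewrite linear0.
rewrite !ps_powS /cauchy_prod linear_sum; apply: eq_bigr => i _.
by rewrite /ap IH; exact: vee_even_comm.
Qed.

Lemma seps_ps_exp n a : seps V (P n a) = psC (seps V a) n.
Proof.
case: n => [|n]; first by rewrite ps_exp0.
apply: (@pderiv_inj _ charK0 _ _ _ n); rewrite -linearZ scaler0.
rewrite -[_ *: _]/(pderiv (fun n => P n a) n) pderiv_ps_exp /cauchy_prod linear_sum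
  big1 // => i _.
exact: seps_vee.
Qed.

(** Powers of p lengthen words, so only 1 + p survives corestriction, and p only against the counit
    of a. *)
Lemma spr1_ps_exp n a :
  spr1 V (P n a) = psC (spr1 V a) n + (seps V a : K) *: p n.
Proof.
case: n => [|n]; first by rewrite ps_exp0 p0 scaler0 addr0.
apply: (@pderiv_inj _ charK0 _ _ _ n); rewrite -linearZ add0r.
rewrite -[_ *: P _ _]/(pderiv (fun n => P n a) n) pderiv_ps_exp /cauchy_prod linear_sum.
rewrite big_ord_recr big1 /= => [|i _].
  by rewrite subnn spr1_vee ps_exp0 add0r /pderiv !scalerA mulrC.
rewrite spr1_vee seps_ps_exp.
by have := ltn_ord i; rewrite -subn_gt0; case: (n - i)%N => // k _; rewrite scale0r.
Qed.

Lemma prim_mul_even i t : prim_mul (pderiv p i) t =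
  tmap (vee (pderiv p i)) (idlin S) t + tmap (idlin S) (vee (pderiv p i)) t.
Proof.
rewrite -addlinE; move: t; apply: tens_lin_ext => b c.
by rewrite (prim_mul_hom _ _ (hom_pderiv i)) addlinE !tmapE !idlinE.
Qed.

(** For the coproduct law, both sides solve F' = p' F with the same value at t = 0, where p' acts on
    tensors by [prim_mul]. *)
Lemma ps_exp_grouplike : grouplike P.
Proof.
split=> n a; last exact: seps_ps_exp.
pose prim (x : V) t := prim_mul x t.
(* The claim is made for every tensor t and not only for a coproduct, so that it can be checked on
   pure tensors. *)
suff H t : (fun n => \sum_(j < n.+1) tmap (P j) (P (n - j)%N) t) 0%N = t /\
   forall n, pderiv (fun n => \sum_(j < n.+1) tmap (P j) (P (n - j)%N) t) n =
     cauchy_prod prim (pderiv p) (fun n => \sum_(j < n.+1) tmap (P j) (P (n - j)%N) t) n.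
  have [H0 H1] := H (sdelta V a).
  apply: (@linear_ode_uniq _ charK0 _ _ prim (pderiv p) (fun n => sdelta V
    (P n a)) _ _ _ H1).
    by rewrite H0 ps_exp0.
  move=> m; rewrite /pderiv -linearZ -[_ *: P _ _]/(pderiv (fun n => P n a) m).
  by rewrite pderiv_ps_exp /cauchy_prod linear_sum; apply: eq_bigr => i _;
    exact: sdelta_vee.
elim/pres_ind: t => [|c s t [IHs0 IHs] [IHt0 IHt]|[b c]].
- split=> [|m]; first by rewrite big_ord1 linear0.
  rewrite /pderiv /cauchy_prod big1 => [|j _]; last by rewrite linear0.
  rewrite scaler0 big1 // => i _; rewrite /prim big1 ?linear0 // => j _.
  by rewrite linear0.
- have E m : \sum_(j < m.+1) tmap (P j) (P (m - j)%N) (c *: s + t) =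
     c *: (\sum_(j < m.+1) tmap (P j) (P (m - j)%N) s)
     + \sum_(j < m.+1) tmap (P j) (P (m - j)%N) t.
    by rewrite scaler_sumr -big_split; apply: eq_bigr => j _; rewrite linearP.
  split=> [|m]; first by rewrite E IHs0 IHt0.
  rewrite /pderiv E scalerDr scalerA mulrC -scalerA.
  move: (IHs m) (IHt m); rewrite /pderiv => -> ->.
  rewrite /cauchy_prod scaler_sumr -big_split; apply: eq_bigr => i _.
  by rewrite E /prim linearP.
- change (pres_gen (@tens_rel K S S) (b, c)) with (tpure b c).
  pose tp := fun x y : S => tpure x y.
  have E m : \sum_(j < m.+1) tmap (P j) (P (m - j)%N) (tpure b c) =
     cauchy_prod tp (fun n => P n b) (fun n => P n c) m.
    by apply: eq_bigr => j _; rewrite tmapE.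
  split=> [|m]; first by rewrite E /cauchy_prod big_ord1 /tp !ps_exp0.
  rewrite /pderiv E -/(pderiv _ m).
  rewrite (@cauchy_prod_pderiv _ _ _ _ tp _ _ _ (@tpure_linearl _ _ _)
    (@tpure_linearr _ _ _)).
  pose pl (x : V) := tmap (vee x) (idlin S); pose pr (x : V) := tmap (idlin S) (vee x).
  (* The two Leibniz terms match the two summands of [prim_mul] for an even letter. *)
  transitivity (cauchy_prod (fun x t => pl x t) (pderiv p) (cauchy_prod tp
    (fun n => P n b) (fun n => P n c)) m +
     cauchy_prod (fun x t => pr x t) (pderiv p) (cauchy_prod tp (fun n => P n b)
       (fun n => P n c)) m).
    congr (_ + _).
      rewrite -(@cauchy_prod_assoc _ _ _ _ _ _ tp veef _ tp) => [|z|x|x y z].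
      + by apply: eq_cauchy_prod => // k; exact: pderiv_ps_exp.
      + exact: tpure_additivel.
      + by move=> u v; rewrite linearD.
      + by rewrite /tp /pl tmapE idlinE.
    rewrite -(@cauchy_prod_leftcomm _ _ _ _ _ _ tp veef _ tp) => [|z|x|x y z].
    + by apply: eq_cauchy_prod => // k; exact: pderiv_ps_exp.
    + exact: tpure_additiver.
    + by move=> u v; rewrite linearD.
    + by rewrite /tp /pr tmapE idlinE.
  rewrite /cauchy_prod -big_split /=; apply: eq_bigr => i _.
  by rewrite E /prim prim_mul_even.
Qed.

End ExpEven.

(** * Convergence of exponentials of letters at t = 1 *)

Section VeeConvergence.
Variables (K : fieldType) (V : fgvect K).
Local Notation S := (Sym V).
Local Notation filS := (@sym_fil K V).
Local Notation HS := (sym_fil_filtration V).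

Lemma tends0_vee u a : tends0 (fil V) u -> tends0 filS (fun n => vee (u n) a).
Proof.
move=> hu k; have [k0 ha] := filtr_exh HS a.
have [n0 h] := hu (k - k0); exists n0 => n /h hn.
by rewrite -[k](subrK k0) addrC; exact: vee_fil.
Qed.

Lemma converges_vee u x a : converges (fil V) (series u) x ->
  converges filS (series (fun n => vee (u n) a)) (vee x a).
Proof.
move=> hu; apply: (eq_tends0 _ (tends0_vee a hu)) => n.
rewrite vee_additive; congr (_ + _).
  by rewrite /series (additive_sum _ _ _ (@vee_additive _ _ a)).
by rewrite -scaleN1r veeZ scaleN1r.
Qed.

End VeeConvergence.

Section ExpConvergence.
Variables (K : fieldType) (V : fgvect K).
Local Notation S := (Sym V).
Local Notation filS := (@sym_fil K V).
Local Notation HS := (sym_fil_filtration V).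
Variables (p : nat -> V) (p1 : V) (p0 : p 0%N = 0).
Hypotheses (p_fil : forall n, fil V 1 (p n)) (p1_fil : fil V 1 p1).
Hypothesis (p_sum : converges (fil V) (series p) p1).
Let T n := vee (p n).
Local Notation P := (ps_exp T).

Let T0 b : T 0%N b = 0.
Proof. by rewrite /T p0 vee0. Qed.

Lemma ps_pow_fil j n : degree_map filS filS j%:Z (ps_pow T j n).
Proof.
elim: j n => [|j IH] n k a ha.
  rewrite addr0 ps_pow0; case: n => [|n] //=; exact: lspan0.
rewrite ps_powS; apply: (filtr_sum HS) => i _.
rewrite intS addrCA addrC; apply: (vee_fil (p_fil i)).
exact: IH.
Qed.

Lemma powlin_fil j : degree_map filS filS j%:Z (powlin (vee p1) j).
Proof.
elim: j => [|j IH] k a ha; first by rewrite addr0 idlinE.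
rewrite powlinS intS addrCA addrC; apply: vee_fil => //; exact: IH.
Qed.

Lemma ps_exp_fil n : degree_map filS filS 0 (P n).
Proof.
move=> k a ha; rewrite ps_expE; apply: (filtr_sum HS) => j _.
apply: (filtrZ HS); apply: (filtr_mono HS) (ps_pow_fil j n ha).
by rewrite addr0 lerDl.
Qed.

Lemma exp_trunc_fil n : degree_map filS filS 0 (exp_trunc (vee p1) n).
Proof.
move=> k a ha; rewrite exp_truncE; apply: (filtr_sum HS) => j _.
apply: (filtrZ HS); apply: (filtr_mono HS) (powlin_fil j ha).
by rewrite addr0 lerDl.
Qed.

(** Evaluation at t = 1 is multiplicative, by the convergence of Cauchy products. *)
Lemma converges_ps_pow j a :
  converges filS (series (fun n => ps_pow T j n a)) (powlin (vee p1) j a).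
Proof.
elim: j => [|j IH].
  rewrite idlinE => k; exists 1%N => -[|n] // _.
  rewrite /series big_ord_recl big1 => [|i _]; last by rewrite ps_pow0.
  by rewrite ps_pow0 addr0 subrr; exact: lspan0.
rewrite powlinS.
apply: (eq_tends0 (u := fun n => series (cauchy_prod (fun f a => f a) T
  (fun m => ps_pow T j m a)) n - vee p1 (powlin (vee p1) j a))).
  move=> n; congr (_ - _); apply: eq_bigr => i _; exact/esym/ps_powS.
apply: (converges_cauchy_prod (d := 1) HS HS) => [n||b|//].
- by apply: vee_fil; exact: p_fil.
- exact: vee_fil.
- exact: converges_vee.
Qed.

Lemma ps_exp_tends0 a : tends0 filS (fun n => P n a).
Proof.
have [k0 ha] := filtr_exh HS a.
(* For j >= J each coefficient of the j-th power maps a into F^k, because every letter p n raises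
   the filtration by 1. *)
move=> k; pose J := `|k - k0|%N.
have le j : (J <= j)%N -> k <= k0 + j%:Z.
  by rewrite /J => h; lia.
have [n0 h0] := tends0_sum HS J (fun j => tends0Z HS ((j`!)%:R^-1)
  (converges_series_tends0 HS (@converges_ps_pow j a))) k.
exists (maxn n0 J) => n; rewrite geq_max => /andP[/h0 hn Jn].
rewrite (@ps_exp_widen _ _ T n.+1 n a T0) //.
rewrite -(big_mkord xpredT (fun j => (j`!)%:R^-1 *: ps_pow T j n a)).
rewrite (@big_cat_nat _ _ _ J) //= ?(leq_trans Jn) //.
apply: (filtrD HS); first by rewrite big_mkord.
rewrite big_nat; apply: (filtr_sum HS) => j /andP[Jj _].
by apply: (filtrZ HS); apply: (filtr_mono HS (le j Jj)); exact: ps_pow_fil.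
Qed.

(** The limit of [exp_trunc] need not exist in the uncompleted [Sym]; comparing truncation in the
    power of p1 with truncation in t avoids it. *)
Lemma ps_exp_approx a :
  tends0 filS (fun n => exp_trunc (vee p1) n a - series (fun i => P i a) n).
Proof.
have [k0 ha] := filtr_exh HS a.
move=> k; pose J := `|k - k0|%N.
have le j : (J <= j)%N -> k <= k0 + j%:Z.
  by rewrite /J => h; lia.
pose R j n := powlin (vee p1) j a - series (fun m => ps_pow T j m a) n.
have R0 j : tends0 filS (R j).
  by apply: (eq_tends0 _ (tends0N HS (@converges_ps_pow j a))) => n; exact: opprB.
have [n0 h0] := tends0_sum HS J (fun j => tends0Z HS ((j`!)%:R^-1) (R0 j)) k.
exists (maxn n0 J) => n; rewrite geq_max => /andP[/h0 hn Jn].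
(* As p has no constant term, only powers j < n occur in the first n coefficients, so both
   truncations have the same range of j. *)
have -> : exp_trunc (vee p1) n a - series (fun i => P i a) n =
    \sum_(j < n) (j`!)%:R^-1 *: R j n.
  rewrite /R; under [RHS]eq_bigr do rewrite scalerBr.
  rewrite big_split /= sumrN exp_truncE; congr (_ - _).
  under [RHS]eq_bigr do rewrite scaler_sumr.
  rewrite exchange_big; apply: eq_bigr => i _.
  exact: ps_exp_widen.
rewrite -(big_mkord xpredT (fun j => (j`!)%:R^-1 *: R j n)).
rewrite (@big_cat_nat _ _ _ J) //=; apply: (filtrD HS); first by rewrite big_mkord.
rewrite big_nat; apply: (filtr_sum HS) => j /andP[Jj _].
apply: (filtrZ HS); apply: (filtr_mono HS (le j Jj)); apply: (filtrB HS).
  exact: powlin_fil.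
by apply: (filtr_sum HS) => i _; exact: ps_pow_fil.
Qed.

End ExpConvergence.

(** * Exponentials exp(t D), with coefficients [dpow D n] *)

Definition dpow (K : fieldType) (A : lmodType K) (D : {linear A -> A}) (n : nat) :
  {linear A -> A} := scalelin ((n`!)%:R^-1) (powlin D n).

Section DividedPowers.
Variables (K : fieldType) (charK0 : [pchar K] =i pred0).
Implicit Types A B C : lmodType K.

Lemma natr_neq0 n : n.+1%:R != 0 :> K.
Proof. by rewrite (proj1 (pcharf0P K) charK0). Qed.

Lemma dpow0 A (D : {linear A -> A}) x : dpow D 0 x = x.
Proof. by rewrite scalelinE idlinE fact0 invr1 scale1r. Qed.

Lemma pderiv_dpow A (D : {linear A -> A}) x n :
  pderiv (fun n => dpow D n x) n = D (dpow D n x).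
Proof.
rewrite /pderiv !scalelinE powlinS [in RHS]linearZ /= scalerA; congr (_ *: _).
by rewrite factS natrM invfM mulrA mulfV ?mul1r // natr_neq0.
Qed.

Lemma powlin_intertwine A B (D : {linear A -> A}) (D' : {linear B -> B})
    (f : {linear A -> B}) n x : (forall x, f (D x) = D' (f x)) ->
  f (powlin D n x) = powlin D' n (f x).
Proof.
by move=> fD; elim: n => [|n IH]; rewrite ?idlinE // !powlinS fD IH.
Qed.

Lemma dpow_intertwine A B (D : {linear A -> A}) (D' : {linear B -> B})
    (f : {linear A -> B}) n x : (forall x, f (D x) = D' (f x)) ->
  f (dpow D n x) = dpow D' n (f x).
Proof. by move=> fD; rewrite !scalelinE linearZ /= (powlin_intertwine _ _ fD). Qed.

Lemma pderiv_tens A B A' B' (F1 : nat -> {linear A -> A'})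
    (F2 : nat -> {linear B -> B'}) (H1 : nat -> {linear A -> A'})
    (H2 : nat -> {linear B -> B'}) n t :
  (forall n a, pderiv (fun n => F1 n a) n = H1 n a) ->
  (forall n b, pderiv (fun n => F2 n b) n = H2 n b) ->
  pderiv (fun n => \sum_(j < n.+1) tmap (F1 j) (F2 (n - j)%N) t) n =
  \sum_(j < n.+1) (tmap (H1 j) (F2 (n - j)%N) t + tmap (F1 j) (H2 (n - j)%N) t).
Proof.
move=> E1 E2; rewrite /pderiv.
pose f1 j := tmap (F1 j) (F2 (n.+1 - j)%N).
pose f2 j := addlin (tmap (H1 j) (F2 (n - j)%N)) (tmap (F1 j) (H2 (n - j)%N)).
transitivity (scalelin n.+1%:R (sumlin n.+2 f1) t); first by rewrite scalelinE sumlinE.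
transitivity (sumlin n.+1 f2 t); last first.
  by rewrite sumlinE; apply: eq_bigr => j _; rewrite addlinE.
move: t; apply: tens_lin_ext => a b; rewrite scalelinE !sumlinE.
pose tp := fun (x : A') (y : B') => tpure x y.
transitivity (pderiv (cauchy_prod tp (fun n => F1 n a) (fun n => F2 n b)) n).
  by congr (_ *: _); apply: eq_bigr => j _; rewrite tmapE.
rewrite (@cauchy_prod_pderiv _ _ _ _ tp _ _ _ (@tpure_linearl _ _ _)
  (@tpure_linearr _ _ _)).
rewrite /cauchy_prod -big_split; apply: eq_bigr => j _ /=.
by rewrite addlinE !tmapE E1 E2.
Qed.

(** The exponential of a coderivation is a coalgebra morphism, since both sides have the same
    derivative. Separate [D1] and [D2] cover coactions as well. *)
Lemma dpow_coder A B C (D : {linear A -> A}) (D1 : {linear B -> B})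
    (D2 : {linear C -> C}) (Delta : {linear A -> tens B C}) n x :
  (forall x, Delta (D x) = tmap D1 (idlin C) (Delta x) + tmap (idlin B) D2 (Delta x)) ->
  Delta (dpow D n x) = \sum_(j < n.+1) tmap (dpow D1 j) (dpow D2 (n - j)%N) (Delta x).
Proof.
move=> DD; elim: n => [|n IH].
  rewrite big_ord1 dpow0 -[LHS]tmap_id; apply: eq_tmap => y; by rewrite idlinE dpow0.
apply: (pderiv_inj charK0 (n := n)).
transitivity (Delta (D (dpow D n x))); first by rewrite -pderiv_dpow linearZ.
rewrite DD IH.
rewrite -[RHS]/(pderiv (fun n => \sum_(j < n.+1) tmap (dpow D1 j) (dpow D2
  (n - j)%N) (Delta x)) n).
rewrite (pderiv_tens (H1 := fun n => D1 \oL dpow D1 n) (H2 := fun n => D2 \oL dpow D2 n)).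
- rewrite !linear_sum -big_split; apply: eq_bigr => j _ /=; rewrite !tmap_comp.
  by congr (_ + _); apply: eq_tmap => y; rewrite !complinE ?idlinE.
- by move=> m a; rewrite pderiv_dpow complinE.
- by move=> m a; rewrite pderiv_dpow complinE.
Qed.

End DividedPowers.

(** * The flows generated by lambda *)

Section Flow.
Variables (K : fieldType) (charK0 : [pchar K] =i pred0) (V : gvect K).
Local Notation S := (Sym V).
Variables (Q : {linear S -> S}) (lam : V).
Hypothesis lam_hom : hom (-1) lam.
Hypothesis Q_coder : forall a, sdelta V (Q a) =
  tmap Q (idlin _) (sdelta V a) + tmap (ssgn V) Q (sdelta V a).
Hypothesis Q_ssgn : forall a, Q (ssgn V a) = - ssgn V (Q a).

(* The graded commutator of Q and lambda \/, both of odd degree. *)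
Definition Qbracket : {linear S -> S} := addlin (Q \oL vee lam) (vee lam \oL Q).

Lemma QbracketE a : Qbracket a = Q (vee lam a) + vee lam (Q a).
Proof. by rewrite addlinE !complinE. Qed.

(** Applying the counit to both factors of the coderivation identity gives eps Q = eps Q + eps Q. *)
Lemma seps_coder a : seps V (Q a) = 0.
Proof.
have E (t : tens S S) : seps V (prM V S (tmap (ssgn V) Q t)) = seps V (Q (prM V S t)).
  have -> : tmap (ssgn V) Q t = idtens 1 Q t by [].
  by rewrite prM_idtens.
have := congr1 (fun t => seps V (prM V S t)) (Q_coder a).
rewrite /= prM_sdelta !linearD /= E prM_sdelta => /eqP.
rewrite -[X in X == _]add0r (inj_eq (addIr _)) => /eqP /esym.
have {}E (t : tens S S) : seps V (prM V S (tmap Q (idlin S) t)) = seps V (Q (epsr V t)).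
  rewrite -!complinE; move: t; apply: tens_lin_ext => b c.
  rewrite !complinE tmapE prMEl idlinE tliftE !linearZ /=.
  exact: mulrC.
by rewrite E epsr_sdelta.
Qed.

Lemma vee_lam_ssgn a : vee lam (ssgn V a) = - ssgn V (vee lam a).
Proof.
by rewrite ssgn_vee (gsgn_hom lam_hom) sgnz_odd // veeZ scaleN1r opprK.
Qed.

Lemma sdelta_vee_lam a : sdelta V (vee lam a) =
  tmap (vee lam) (idlin S) (sdelta V a) + tmap (ssgn V) (vee lam) (sdelta V a).
Proof.
rewrite sdelta_vee -addlinE; move: (sdelta V a); apply: tens_lin_ext => b c.
by rewrite (prim_mul_hom _ _ lam_hom) addlinE !tmapE idlinE.
Qed.

(** An odd letter anticommutes with itself, so twice the square vanishes, and 2 is invertible. *)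
Lemma vee_lam_sq a : vee lam (vee lam a) = 0.
Proof.
have := vee_commE a lam_hom lam_hom; rewrite sgnz_odd // scaleN1r => /eqP.
rewrite -addr_eq0 -mulr2n -scaler_nat scaler_eq0.
by rewrite (negbTE (natr_neq0 charK0 1)) => /eqP.
Qed.

Lemma Qbracket_lam a : Qbracket (vee lam a) = vee lam (Qbracket a).
Proof. by rewrite !QbracketE linearD /= !vee_lam_sq linear0 add0r addr0. Qed.

Lemma Qbracket_ssgn a : Qbracket (ssgn V a) = ssgn V (Qbracket a).
Proof. by rewrite !QbracketE !linearD /= vee_lam_ssgn !Q_ssgn !linearN /=
  vee_lam_ssgn Q_ssgn !opprK. Qed.

Lemma seps_Qbracket a : seps V (Qbracket a) = 0.
Proof. by rewrite QbracketE linearD /= seps_coder seps_vee addr0. Qed.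

Lemma spr1_Qbracket a : spr1 V (Qbracket a) = spr1 V (Q (vee lam a)).
Proof. by rewrite QbracketE linearD /= spr1_vee seps_coder scale0r addr0. Qed.

Lemma sdelta_Qbracket a : sdelta V (Qbracket a) =
  tmap Qbracket (idlin _) (sdelta V a) + tmap (idlin S) Qbracket (sdelta V a).
Proof.
rewrite QbracketE linearD /= Q_coder !sdelta_vee_lam Q_coder !linearD /= !tmap_comp.
have E (f1 f2 f3 f4 f5 f6 f7 f8 g1 g2 : {linear tens S S -> tens S S}) y :
  (forall a z, f1 (tpure a z) + f2 (tpure a z) + (f3 (tpure a z) + f4 (tpure a z))
    + (f5 (tpure a z) + f6 (tpure a z) + (f7 (tpure a z) + f8 (tpure a z)))
    = g1 (tpure a z) + g2 (tpure a z)) ->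
  f1 y + f2 y + (f3 y + f4 y) + (f5 y + f6 y + (f7 y + f8 y)) = g1 y + g2 y.
  move=> h; rewrite -!addlinE; move: y.
  by apply: tens_lin_ext => b z; rewrite !addlinE.
apply: E => b c; rewrite !tmapE !complinE !idlinE !ssgnK !QbracketE.
rewrite vee_lam_ssgn Q_ssgn !tpureNl tpure_additivel tpure_additiver.
(* Terms 2 and 7, and 3 and 6, are the mixed ones and cancel by the sign rule; 1 with 5 and 4 with 8
   form the two brackets. *)
rewrite [LHS](AC ((2*2)*(2*2)) (((1*5)*(4*8))*((2*7)*(3*6)))) /=.
by rewrite addNr subrr !addr0.
Qed.

Section Modules.
Variables (M : lmodType K) (phi : {linear tens S M -> tens S M}).
Hypothesis phi_coact : forall x, coact V M (phi x) =
  tmap (ssgn V) phi (coact V M x) + tmap Q (idlin _) (coact V M x).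
Hypothesis phi_sq : forall x, phi (phi x) = 0.

Definition phibracket : {linear tens S M -> tens S M} :=
  addlin (phi \oL veeM M lam) (veeM M lam \oL phi).

Lemma phibracketE x : phibracket x = phi (veeM M lam x) + veeM M lam (phi x).
Proof. by rewrite addlinE !complinE. Qed.

Lemma coact_phibracket x : coact V M (phibracket x) =
  tmap Qbracket (idlin _) (coact V M x) + tmap (idlin S) phibracket (coact V M x).
Proof.
have cl := @coact_veeM K V M (-1) lam _ lam_hom isT.
rewrite phibracketE linearD /= phi_coact !cl phi_coact !linearD /=.
move: (coact V M x) => y; rewrite !tmap_comp.
have E : forall f1 f2 f3 f4 f5 f6 f7 f8 g1 g2 : {linear tens S
  (tens S M) -> tens S (tens S M)},
  (forall a z, f1 (tpure a z) + f2 (tpure a z) + (f3 (tpure a z) + f4 (tpure a z))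
    + (f5 (tpure a z) + f6 (tpure a z) + (f7 (tpure a z) + f8 (tpure a z)))
    = g1 (tpure a z) + g2 (tpure a z)) ->
  f1 y + f2 y + (f3 y + f4 y) + (f5 y + f6 y + (f7 y + f8 y)) = g1 y + g2 y.
  move=> f1 f2 f3 f4 f5 f6 f7 f8 g1 g2 h; rewrite -!addlinE; move: y.
  by apply: tens_lin_ext => a z; rewrite !addlinE.
apply: E => a z; rewrite !tmapE !complinE !idlinE !ssgnK.
rewrite QbracketE phibracketE vee_lam_ssgn Q_ssgn !tpureNl tpure_additivel
  tpure_additiver.
rewrite [LHS](AC ((2*2)*(2*2)) (((3*6)*(2*7))*((1*5)*(4*8)))) /=.
by rewrite subrr addNr !addr0.
Qed.

Lemma phibracket_comm x : phibracket (phi x) = phi (phibracket x).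
Proof. by rewrite !phibracketE linearD /= !phi_sq linear0 add0r addr0. Qed.

Lemma prM_phibracket x : prM V M (phibracket x) = prM V M (phi (veeM M lam x)).
Proof. by rewrite phibracketE linearD /= prM_veeM addr0. Qed.

Lemma coact_dpow n x : coact V M (dpow phibracket n x) =
  \sum_(j < n.+1) tmap (dpow Qbracket j) (dpow phibracket (n - j)%N) (coact V M x).
Proof. by apply: dpow_coder => // y; exact: coact_phibracket. Qed.

End Modules.

Section Intertwiners.
Variables (M N : lmodType K).
Variables (phi : {linear tens S M -> tens S M}) (phi' : {linear tens S N -> tens S N}).
Variable kappa : {linear tens S M -> tens S N}.
Hypothesis phi_coact : forall x, coact V M (phi x) =
  tmap (ssgn V) phi (coact V M x) + tmap Q (idlin _) (coact V M x).
Hypothesis phi_sq : forall x, phi (phi x) = 0.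
Hypothesis phi'_coact : forall x, coact V N (phi' x) =
  tmap (ssgn V) phi' (coact V N x) + tmap Q (idlin _) (coact V N x).
Hypothesis phi'_sq : forall x, phi' (phi' x) = 0.
Hypothesis kappa_coact : forall x, coact V N (kappa x) =
  tmap (idlin S) kappa (coact V M x).
Hypothesis kappa_comm : forall x, kappa (phi x) = phi' (kappa x).

(** The commutator of kappa with lambda \/, which is the source term of the homotopy. *)
Definition lam_comm : {linear tens S M -> tens S N} :=
  addlin (kappa \oL veeM M lam) (scalelin (-1) (veeM N lam \oL kappa)).

Lemma lam_commE x : lam_comm x = kappa (veeM M lam x) - veeM N lam (kappa x).
Proof. by rewrite addlinE scalelinE !complinE scaleN1r. Qed.

(** kappa leaves the left factor alone, so the parts of the two coactions in which lambda multiplies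
    that factor cancel. *)
Lemma coact_lam_comm x :
  coact V N (lam_comm x) = tmap (ssgn V) lam_comm (coact V M x).
Proof.
have clM := @coact_veeM K V M (-1) lam _ lam_hom isT.
have clN := @coact_veeM K V N (-1) lam _ lam_hom isT.
rewrite lam_commE linearB /= kappa_coact clM clN kappa_coact linearD /=.
move: (coact V M x) => y; rewrite !tmap_comp.
have -> : tmap (ssgn V) lam_comm y = tmap (ssgn V) (kappa \oL veeM M lam) y
   - tmap (ssgn V) (veeM N lam \oL kappa) y.
  rewrite -scaleN1r -scalelinE -addlinE; move: y; apply: tens_lin_ext => a z.
  rewrite addlinE scalelinE !tmapE lam_commE !complinE.
  by rewrite tpure_additiver tpureNr scaleN1r.
rewrite opprD addrACA -[RHS]add0r; congr (_ + (_ - _)).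
- apply/eqP; rewrite subr_eq0; apply/eqP; apply: eq_tmap => a.
    by rewrite !complinE !idlinE.
  by rewrite !complinE !idlinE.
- by apply: eq_tmap => a; rewrite !complinE ?idlinE.
- by apply: eq_tmap => a; rewrite !complinE ?idlinE.
Qed.

(* The coefficients of the solution of W' = [phi', l] W + [kappa, l] exp(t [phi, l]),
   W(0) = 0. *)
Fixpoint hflow (n : nat) : {linear tens S M -> tens S N} :=
  if n is m.+1 then
    scalelin (m.+1%:R^-1) (addlin (phibracket phi' \oL hflow m) (lam_comm \oL dpow
      (phibracket phi) m))
  else zerolin _ _.

Lemma pderiv_hflow x n : pderiv (fun n => hflow n x) n =
  phibracket phi' (hflow n x) + lam_comm (dpow (phibracket phi) n x).
Proof.
by rewrite /pderiv scalelinE addlinE !complinE scalerA mulfV ?scale1r // natr_neq0.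
Qed.

(** Both sides solve the same linear equation, by kappa [phi, l] - [phi', l] kappa = phi' [kappa, l]
    + [kappa, l] phi. This is the formal homotopy, valid in each coefficient of t. *)
Lemma hflow_homotopy n x :
  kappa (dpow (phibracket phi) n x) - dpow (phibracket phi') n (kappa x) =
  phi' (hflow n x) + hflow n (phi x).
Proof.
elim: n => [|n IH]; first by rewrite !dpow0 /= !zerolinE linear0 addr0 subrr.
have comm y : phibracket phi (phi y) = phi (phibracket phi y) by exact: phibracket_comm.
have comm' y : phibracket phi' (phi' y) = phi'
  (phibracket phi' y) by exact: phibracket_comm.
apply: (pderiv_inj charK0 (n := n)).
set U := dpow (phibracket phi) n x; set U' := dpow (phibracket phi') n (kappa x).
have EU : n.+1%:R *: dpow (phibracket phi) n.+1 x = phibracket phi U by exact: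
  pderiv_dpow.
have EU' : n.+1%:R *: dpow (phibracket phi') n.+1
  (kappa x) = phibracket phi' U' by exact: pderiv_dpow.
have EW y : n.+1%:R *: hflow n.+1 y =
  phibracket phi' (hflow n y) + lam_comm (dpow
    (phibracket phi) n y) by exact: pderiv_hflow.
rewrite scalerBr scalerDr EU' EW -[X in X - _]linearZ -[X in _ = X + _]linearZ EU EW.
have -> : dpow (phibracket phi) n (phi x) = phi U.
  by rewrite [RHS](dpow_intertwine _ _ (D' := phibracket phi)).
(* The induction hypothesis enters here, eliminating U' in favour of U and [hflow]. *)
have -> : phibracket phi' U' = phibracket phi' (kappa U) - phibracket phi' (phi'
  (hflow n x))
    - phibracket phi' (hflow n (phi x)).
  by rewrite -addrA -opprD -linearD -IH linearB /= opprB addrC subrK.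
rewrite comm' !linearD /= !lam_commE phibracketE phibracketE !linearB !linearD /=
  !kappa_comm.
by rewrite !opprK [LHS](AC (2*4) ((5*(1*3))*(6*(2*4)))).
Qed.

(** [hflow] covers the coalgebra flow exp(t [Q, l]), with the grading involution appearing because
    its degree is odd. *)
Lemma coact_hflow n x : coact V N (hflow n x) =
  \sum_(j < n.+1) tmap (ssgn V \oL dpow Qbracket j) (hflow (n - j)%N) (coact V M x).
Proof.
elim: n => [|n IH].
  rewrite big_ord1 /= zerolinE linear0 -(zerolinE _ (coact V M x)).
  move: (coact V M x); apply: tens_lin_ext => a z.
  by rewrite tmapE !zerolinE tpure0r.
apply: (pderiv_inj charK0 (n := n)).
pose R n t := \sum_(j < n.+1) tmap (ssgn V \oL dpow Qbracket j) (hflow (n - j)%N) t.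
change (n.+1%:R *: coact V N (hflow n.+1 x) = pderiv (fun n => R n (coact V M x)) n).
rewrite -linearZ -[X in coact V N X]/(pderiv (fun n => hflow n x) n) pderiv_hflow.
rewrite linearD /= coact_phibracket // coact_lam_comm (coact_dpow phi_coact).
rewrite /R (@pderiv_tens _ _ _ _ _ (fun n => ssgn V \oL dpow Qbracket n) hflow
  (fun n => ssgn V \oL (Qbracket \oL dpow Qbracket n)) (fun n => addlin
    (phibracket phi' \oL hflow n) (lam_comm \oL dpow (phibracket phi) n))).
- rewrite IH !linear_sum -!big_split; apply: eq_bigr => j _ /=.
  rewrite tmapDr !tmap_comp -addrA; congr (_ + (_ + _)); apply: eq_tmap => y;
  by rewrite !complinE ?idlinE // Qbracket_ssgn.
- move=> m a; rewrite /pderiv !complinE -linearZ; congr (ssgn V _).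
  exact: pderiv_dpow.
- by move=> m y; rewrite pderiv_hflow addlinE !complinE.
Qed.

End Intertwiners.
End Flow.

(** * Compositions and twists of power series *)

Lemma triple_sum (Z : Type) (C : zmodType) (f : nat -> nat -> Z -> C) w n :
  \sum_(m < n.+1) \sum_(i < m.+1) f i (m - i)%N (w (n - m)%N) =
  \sum_(i < n.+1) \sum_(j < (n - i).+1) f i j (w (n - i - j)%N).
Proof.
transitivity (\sum_(m < n.+1) \sum_(i < m.+1) f i (m - i)%N (w (n - (i + (m - i)))%N)).
  by apply: eq_bigr => m _; apply: eq_bigr => i _; rewrite (subnKC (leq_ord i)).
rewrite (triangle_suml (fun i j => f i j (w (n - (i + j))%N))).
apply: eq_bigr => i _; rewrite (subSn (leq_ord i)).
by apply: eq_bigr => j _; rewrite subnDA.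
Qed.

Section Compositions.
Variable K : fieldType.

Lemma cauchy_prod_ps_comp (A B C : lmodType K) (S : nat -> {linear B -> C})
    (T : nat -> {linear A -> B}) u n :
  cauchy_prod (@ap _ A C) (ps_comp S T) u n =
  cauchy_prod (@ap _ B C) S (cauchy_prod (@ap _ A B) T u) n.
Proof.
rewrite /cauchy_prod /ap.
transitivity (\sum_(m < n.+1) \sum_(i < m.+1) S i (T (m - i)%N (u (n - m)%N))).
  by apply: eq_bigr => m _; rewrite ps_compE.
rewrite (triple_sum (fun i j x => S i (T j x))).
by apply: eq_bigr => i _; rewrite linear_sum.
Qed.

Lemma tmap_ps_comp (A B : lmodType K) (S T : nat -> {linear A -> A}) n (x : tens A B) :
  tmap (ps_comp S T n) (idlin B) x =
  \sum_(i < n.+1) tmap (S i) (idlin B) (tmap (T (n - i)%N) (idlin B) x).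
Proof.
transitivity (sumlin n.+1 (fun i => tmap (S i \oL T (n - i)%N) (idlin B)) x); last first.
  rewrite sumlinE; apply: eq_bigr => i _; rewrite tmap_comp.
  by apply: eq_tmap => y //; rewrite complinE !idlinE.
move: x; apply: tens_lin_ext => a b; rewrite tmapE sumlinE ps_compE.
rewrite (additive_sum _ _ _ (tpure_additivel _)).
by apply: eq_bigr => i _; rewrite tmapE complinE.
Qed.

Lemma grouplike_comp (V : gvect K) (F G : nat -> {linear Sym V -> Sym V}) :
  grouplike F -> grouplike G -> grouplike (ps_comp F G).
Proof.
move=> [Fd Fe] [Gd Ge]; split=> n a; last first.
  rewrite ps_compE /cauchy_prod linear_sum /= big_ord_recl big1 => [|i _].
    by rewrite Fe subn0 Ge addr0.
  by rewrite Fe.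
rewrite ps_compE /cauchy_prod linear_sum /=.
transitivity (\sum_(m < n.+1) \sum_(i < m.+1) tmap (F i) (F (m - i)%N)
    (\sum_(j < (n - m).+1) tmap (G j) (G (n - m - j)%N) (sdelta V a))).
  by apply: eq_bigr => m _; rewrite Fd Gd.
rewrite (triple_sum (fun i j x => tmap (F i) (F j) x)
  (fun k => \sum_(j < k.+1) tmap (G j) (G (k - j)%N) (sdelta V a))).
move: (sdelta V a) => t.
pose l k := sumlin k.+1 (fun j => tmap (G j) (G (k - j)%N)).
transitivity (sumlin n.+1 (fun i => sumlin (n - i).+1
    (fun j => tmap (F i) (F j) \oL l (n - i - j)%N)) t).
  rewrite sumlinE; apply: eq_bigr => i _; rewrite sumlinE; apply: eq_bigr => j _.
  by rewrite complinE sumlinE.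
rewrite -[RHS](sumlinE _ (fun m => tmap (ps_comp F G m) (ps_comp F G (n - m)%N))).
move: t; apply: tens_lin_ext => b c; rewrite !sumlinE.
pose tp := fun x y : Sym V => tpure x y.
pose z := cauchy_prod tp (fun n => G n b) (fun n => G n c).
(* The two copies of F act on the left and on the right factor separately; the right one can then
   pass the series of vectors G b. *)
transitivity (cauchy_prod (fun f x => tmap f (idlin _) x) F
  (cauchy_prod (fun f x => tmap (idlin _) f x) F z) n).
  apply: eq_bigr => i _; rewrite sumlinE linear_sum; apply: eq_bigr => j _.
  have zE k : l k (tpure b c) = z k.
    by rewrite sumlinE; apply: eq_bigr => k' _; rewrite tmapE.
  rewrite complinE zE /= tmap_comp.
  by apply: eq_tmap => y; rewrite complinE idlinE.
transitivity (cauchy_prod (fun f x => tmap f (idlin _) x) F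
  (cauchy_prod tp (fun n => G n b) (cauchy_prod (@ap _ _ _) F (fun n => G n c))) n).
  apply: eq_cauchy_prod => // m.
  apply: cauchy_prod_leftcomm => [f|x|f x y].
  - by move=> x y; rewrite linearD.
  - exact: tpure_additiver.
  - by rewrite tmapE idlinE.
rewrite -(@cauchy_prod_assoc _ _ _ _ _ _ tp (@ap _ _ _) _ tp) => [|y|f|f x y].
- by apply: eq_bigr => i _; rewrite tmapE !ps_compE.
- exact: tpure_additivel.
- by move=> x y; rewrite linearD.
- by rewrite tmapE idlinE.
Qed.

Lemma ps_exp_ann (A B : lmodType K) (f : {linear A -> B}) (T : nat -> {linear A -> A})
    n a : (forall i b, f (T i b) = 0) -> f (ps_exp T n a) = psC (f a) n.
Proof.
move=> fT; rewrite ps_expE linear_sum big_ord_recl big1 => [|j _]; last first.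
  rewrite linearZ /= /bump /= add1n ps_powS /cauchy_prod linear_sum big1 ?scaler0
    // => i _.
  exact: fT.
rewrite addr0 fact0 invr1 scale1r ps_pow0; case: n => [|n] //=.
by rewrite linear0.
Qed.

Lemma eq_ps_exp (A : lmodType K) (T T' : nat -> {linear A -> A}) n a :
  (forall i b, T i b = T' i b) -> ps_exp T n a = ps_exp T' n a.
Proof.
move=> TT.
have E j m : ps_pow T j m a = ps_pow T' j m a.
  elim: j m => [|k IH] m; first by rewrite !ps_pow0.
  by rewrite !ps_powS; apply: eq_bigr => i _; rewrite /ap TT IH.
by rewrite !ps_expE; apply: eq_bigr => j _; rewrite E.
Qed.

Lemma ps_twistE (X : Type) (A B : lmodType K) (vA : X -> {linear A -> A})
    (vB : X -> {linear B -> B}) p (f : {linear A -> B}) n a :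
  ps_twist vA vB p f n a = \sum_(i < n.+1)
    ps_exp (fun n => scalelin (-1) (vB (p n))) i (f (ps_exp (fun n => vA (p n))
      (n - i)%N a)).
Proof.
rewrite ps_compE; apply: eq_bigr => i _; rewrite /ap; congr (ps_exp _ _ _).
rewrite ps_compE /cauchy_prod big_ord_recl /= subn0 big1 ?addr0 // => j _.
by rewrite /ap /= zerolinE.
Qed.

(** The condition on g says that corestriction does not see the left exponential. It holds on
    modules since [prM] kills multiples of a letter, and on Sym(V) since the counit of [Q]
    vanishes. *)
Lemma twist_corestriction (X : Type) (A B C : lmodType K) (vA : X -> {linear A -> A})
    (vB : X -> {linear B -> B}) p (f : {linear A -> B}) (g : {linear B -> C}) n a :
  (forall i b, g (ps_exp (fun n => scalelin (-1) (vB (p n))) i (f b)) = psC (g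
    (f b)) i) ->
  g (ps_twist vA vB p f n a) = g (f (ps_exp (fun n => vA (p n)) n a)).
Proof.
move=> h; rewrite ps_twistE linear_sum big_ord_recl big1 => [|i _]; last exact: h.
by rewrite h addr0 subn0.
Qed.

End Compositions.

(** * Maps covering a coalgebra flow *)

Section Transport.
Variables (K : fieldType) (V : gvect K) (M N : lmodType K) (d : int).
Local Notation S := (Sym V).
Variables (G : nat -> {linear S -> S}) (R : nat -> {linear tens S M -> tens S N}).
Hypothesis G_sgn : forall j a, sgn_pow d (G j a) = G j (sgn_pow d a).
Hypothesis R_coact : forall n x, coact V N (R n x) =
  \sum_(j < n.+1) tmap (sgn_pow d \oL G j) (R (n - j)%N) (coact V M x).

(* Coaction along G means that R factors as (G (x) id) after a comodule map. *)
Lemma transport n x : R n x = \sum_(j < n.+1)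
  tmap (G j) (idlin N) (idtens d (prM V N \oL R (n - j)%N) (coact V M x)).
Proof.
rewrite -[LHS]tmap_prM_coact R_coact linear_sum; apply: eq_bigr => j _ /=.
rewrite tmap_comp idtensE tmap_comp; apply: eq_tmap => y.
  by rewrite !complinE idlinE G_sgn.
by rewrite !complinE idlinE.
Qed.

End Transport.

Section StructureMaps.
Variables (K : fieldType) (L : fgvect K) (Q : linf L).

Lemma linf_coderE a : sdelta _ (Q a) =
  tmap Q (idlin _) (sdelta _ a) + tmap (ssgn _) Q (sdelta _ a).
Proof. exact: linf_coder. Qed.

Lemma linf_ssgn a : Q (ssgn _ a) = - ssgn _ (Q a).
Proof. by rewrite (ssgn_degree_map _ (linf_deg Q)) scaleN1r. Qed.

Lemma lmodule_coactE (M : fgvect K) (phi : lmodule Q M) x : coact _ M (phi x) =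
  tmap (ssgn _) phi (coact _ M x) + tmap Q (idlin _) (coact _ M x).
Proof. exact: lmodule_coact. Qed.

End StructureMaps.

(** * Word lengths under coalgebra morphisms *)

Section SymLengths.
Variables (K : fieldType) (V : gvect K).
Local Notation S := (Sym V).

Definition len_le (n : nat) : S -> Prop :=
  lspan (fun a => exists w, (size w <= n)%N /\ a = word w).

Lemma spr_word_eq w : spr V (size w) (word w) = word w.
Proof. by rewrite sym_liftE /spr_word eqxx. Qed.

Lemma len_le_spr n a : len_le n a ->
  \sum_(1 <= k < n.+1) spr V k a = a - (seps V a : K) *: sym1 V.
Proof.
rewrite big_add1 /= big_mkord => ha.
rewrite -(sumlinE n (fun k => spr V k.+1)).
elim: ha => [|_ [w [le ->]]|c b b' _ IHa _ IHb].
- by rewrite !linear0 scale0r subr0.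
- rewrite sumlinE sym_liftE; case: w le => [|x w] le.
    rewrite /= scale1r subrr big1 // => i _; exact: sym_liftE.
  rewrite scale0r subr0 (bigD1 (Ordinal le)) //= big1 ?addr0.
    by rewrite sym_liftE /spr_word eqxx.
  move=> i ni; rewrite sym_liftE /spr_word /= eqSS; case: eqP => // E.
  by case/negP: ni; apply/eqP/val_inj.
- by rewrite !linearP /= IHa IHb scalerDl scalerBr opprD addrACA -scalerA.
Qed.

Variable charK0 : [pchar K] =i pred0.

(** Without a Taylor coefficient in arity 0, a coalgebra morphism cannot lengthen words. Hence the
    sum over 1 <= k <= i in the equation for Phi_t misses only the component in Sym^0. *)
Lemma grouplike_len (F : nat -> {linear S -> S}) : grouplike F ->
  (forall n, spr1 V (F n (sym1 V)) = 0) -> forall w n, len_le (size w) (F n (word w)).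
Proof.
move=> [Fd Fe] F1 w; elim: {w}(size w).+1 {-2}w (ltnSn (size w)) => // m IH w lt n.
rewrite [F n _](sym_recon charK0); apply: lspanD.
  by apply: lspanZ; apply: lspan_gen; exists [::].
rewrite Fd !linear_sum; apply: lspan_sum => j _; rewrite tmap_comp /=.
suff : len_le (size w) ((@inv_len K V \oL (@vee_tens K V \oL
    tmap (spr1 V \oL F j) (idlin S \oL F (n - j)%N))) (sdelta V (word w))).
  by rewrite !complinE.
apply: lspan_map (sdelta_split w) => _ [[c ->]|[b [w' [lt' ->]]]];
  rewrite 2!complinE tmapE vee_tensE.
  by rewrite complinE F1 vee0 linear0; exact: lspan0.
rewrite !complinE idlinE.
suff : len_le (size w) ((@inv_len K V \oL vee (spr1 V (F j b))) (F (n - j)%N (word w'))).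
  by rewrite complinE.
apply: lspan_map (IH w' (leq_trans lt' lt) (n - j)%N) => _ [u [le ->]].
rewrite complinE veeE sym_liftE; apply: lspanZ; apply: lspan_gen.
exists (spr1 V (F j b) :: u); split=> //=; exact: leq_ltn_trans le lt'.
Qed.

End SymLengths.

(** * Identification of Phi_t and Psi_t with the flows *)

Section FlowOfMaurerCartan.
Variables (K : fieldType) (charK0 : [pchar K] =i pred0) (L : fgvect K).
Local Notation V := (fshift 1 L).
Local Notation S := (SymL L).
Variables (Q : linf L) (p : L) (pt : nat -> L) (lambda : L).
Local Notation lamV := (lambda : fshift 1 L).
Hypothesis Hpt : mc_homotopic0 Q p pt (psC lambda).
Variable Phi : nat -> {linear S -> S}.
Hypothesis HPhi : is_Phi Q pt lambda Phi.

Local Notation P := (ps_exp (fun n => veeL (pt n))).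

Lemma pt_hom n : @hom K V 0 (pt n).
Proof. by case: Hpt => [[/(_ n) [h _]] _] _ _ _ _; exact: h. Qed.

Lemma pt_fil n : fil V 1 (pt n).
Proof. by case: Hpt => [[/(_ n) [_ h]] _] _ _ _ _; exact: h. Qed.

Lemma pt0 : pt 0%N = 0.
Proof. by case: Hpt. Qed.

Lemma lambda_hom : @hom K V (-1) lambda.
Proof. by case: Hpt => _ [/(_ 0%N) [h _] _] _ _ _; exact: h. Qed.

Lemma lambda_fil : fil V 1 lambda.
Proof. by case: Hpt => _ [/(_ 0%N) [_ h] _] _ _ _; exact: h. Qed.

Lemma Phi_grouplike : grouplike Phi.
Proof. by case: HPhi => [[_ h1 h2] _ _ _]; split. Qed.

(** For i = 0 the sum over k is empty, so this Taylor coefficient keeps its initial value 0. *)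
Lemma spr1_Phi_sym1 n : spr1 V (Phi n (sym1 V)) = 0.
Proof.
case: HPhi => _ _ h0 hS; case: n => [|n].
  by have := h0 (sym1 V); rewrite (spr1E [::]).
apply: (pderiv_inj charK0 (n := n)); rewrite scaler0.
have E : spr V 0 (sym1 V) = sym1 V by exact: (spr_word_eq [::]).
by rewrite (hS n 0%N _ E) big_nil.
Qed.

Lemma spr1_twist n b : spr1 V (linf_twist_t Q pt n b) = spr1 V (Q (P n b)).
Proof.
apply: twist_corestriction => i a.
have -> : ps_exp (fun n => scalelin (-1) (veeL (pt n))) i (Q a) =
    ps_exp (fun n => vee (- pt n : V)) i (Q a).
  apply: eq_ps_exp => j c; rewrite scalelinE scaleN1r.
  by rewrite -[in RHS]scaleN1r veeZ scaleN1r.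
rewrite spr1_ps_exp //.
- by rewrite (seps_coder (linf_coderE Q)) scale0r addr0.
- by move=> j; rewrite /hom linearN /= pt_hom.
- by rewrite pt0 oppr0.
Qed.

Lemma ps_exp_lambda n b : P n (@vee K V lambda b) = @vee K V lambda (P n b).
Proof. exact: (ps_exp_vee_comm pt_hom). Qed.

Lemma pderiv_pt n : pderiv (pt : nat -> V) n = spr1 V (Q (@vee K V lambda (P n
  (sym1 V)))).
Proof.
case: Hpt => _ _ h _ _; rewrite [LHS]h big_ord_recl big1 ?addr0 ?subn0 //= => i _.
by rewrite /veeL vee0 !linear0.
Qed.

(** The defining sum omits k = 0, where Phi_t a has the component counit(a) 1; this produces the
    subtracted term. *)
Lemma pderiv_spr1_Phi n a : n.+1%:R *: spr1 V (Phi n.+1 a) =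
  spr1 V (Q (@vee K V lambda (ps_comp P Phi n a))) -
  (seps V a : K) *: spr1 V (Q (@vee K V lambda (P n (sym1 V)))).
Proof.
pose f := spr1 V \oL (Q \oL @vee K V lambda).
have fE b : spr1 V (Q (@vee K V lambda b)) = f b by rewrite !complinE.
rewrite !fE.
elim/pres_ind: a => [|c a b ha hb|w]; first by rewrite !linear0 scale0r ?scaler0 ?subr0.
  rewrite !linearP /= ha hb.
  by rewrite scalerBr scalerDl opprD addrACA scalerA.
change (n.+1%:R *: spr1 V (Phi n.+1 (word w)) = f (ps_comp P Phi n (word w)) -
  (seps V (word w) : K) *: f (P n (sym1 V))).
case: HPhi => _ _ _ /(_ n _ _ (spr_word_eq w)) ->.
rewrite exchange_big /=.
transitivity (\sum_(j < n.+1) (f (P j (Phi (n - j)%N (word w))) -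
    (psC (seps V (word w)) (n - j)%N : K) *: f (P j (sym1 V)))).
  apply: eq_bigr => j _; set X := Phi _ _.
  rewrite -Phi_grouplike.2 -/X.
  transitivity (f (P j (\sum_(1 <= k < (size w).+1) spr V k X))).
    rewrite !linear_sum; apply: eq_bigr => k _.
    by rewrite spr1_twist -fE -ps_exp_lambda.
  rewrite len_le_spr; last exact: (grouplike_len charK0 Phi_grouplike spr1_Phi_sym1).
  by rewrite !linearB !linearZ.
rewrite sumrB; congr (_ - _); first by rewrite ps_compE /cauchy_prod linear_sum.
rewrite big_ord_recr big1 /= ?add0r ?subnn // => i _.
by have := ltn_ord i; rewrite -subn_gt0; case: (n - i)%N => // k _; rewrite scale0r.
Qed.

Lemma Phi_flow n a : ps_comp P Phi n a = dpow (Qbracket Q lambda) n a.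
Proof.
have Qc := linf_coderE Q; have Qs := linf_ssgn Q; have lh := lambda_hom.
have HP : grouplike P by apply: ps_exp_grouplike => //; [exact: pt_hom|exact: pt0].
have HG := grouplike_comp HP Phi_grouplike.
have sP m b : spr1 V (P m b) = psC (spr1 V b) m + (seps V b : K) *: pt m.
  by apply: (spr1_ps_exp charK0 pt_hom pt0).
have HE : grouplike (dpow (Qbracket Q lambda)).
  split=> m b.
    by apply: dpow_coder => // c; exact: sdelta_Qbracket.
  case: m => [|m]; first by rewrite dpow0.
  by rewrite scalelinE powlinS linearZ /= (seps_Qbracket lamV Qc) scaler0.
(* The extra term counit(b) pi(t) has exactly the derivative that is subtracted in
   [pderiv_spr1_Phi]. *)
have sG m b : spr1 V (ps_comp P Phi m b) = spr1 V (Phi m b) + (seps V b : K) *: pt m.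
  rewrite ps_compE /cauchy_prod /ap linear_sum /=.
  under eq_bigr do rewrite sP.
  rewrite big_split /=; congr (_ + _).
    by rewrite big_ord_recl big1 ?addr0 ?subn0 // => i _.
  rewrite big_ord_recr big1 /= => [|i _].
    by rewrite add0r subnn Phi_grouplike.2.
  rewrite Phi_grouplike.2; have := ltn_ord i; rewrite -subn_gt0.
  by case: (m - i)%N => // k _; rewrite scale0r.
apply: (grouplike_uniq charK0 HG HE) n a.
- by rewrite sG pt0 scaler0 addr0 spr1_Phi_sym1.
- by rewrite dpow0 (spr1E [::]).
case=> [_ a|n IH]; first by rewrite dpow0 sG pt0 scaler0 addr0; case: HPhi.
move=> {}a; rewrite sG; apply: (pderiv_inj charK0 (n := n)).
rewrite scalerDr scalerA mulrC -scalerA -[_ *: pt _]/(pderiv (pt : nat -> V) n).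
rewrite pderiv_spr1_Phi pderiv_pt subrK IH //.
rewrite -(spr1_Qbracket _ Qc) -(pderiv_dpow charK0).
by rewrite -linearZ.
Qed.

Section ModuleFlow.
Variables (M : fgvect K) (phi : lmodule Q M).
Variable Psi : nat -> {linear SymLM L M -> SymLM L M}.
Hypothesis HPsi : is_Psi phi pt lambda Phi Psi.

Lemma prM_twist n x : prM V M (lmodule_twist_t phi pt n x) =
  prM V M (phi (ps_exp (fun n => veeLM M (pt n)) n x)).
Proof.
apply: twist_corestriction => i y; apply: ps_exp_ann => j z.
by rewrite scalelinE linearZ /= prM_veeM scaler0.
Qed.

(** Corestriction removes Q (x) id, since the counit of [Q] vanishes, and the left exponential of
    the twist. What remains involves G, which commutes with lambda \/. *)
Lemma prM_pullback n x : prM V M (pullback_t phi pt Phi n (veeLM M lambda x)) =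
  prM V M (phi (veeLM M lambda (tmap (dpow (Qbracket Q lambda) n) (idlin M) x))).
Proof.
rewrite addlinE linearD /= complinE prM_idtens_coact.
have -> : prM V M (ps_const (tmap Q (idlin M)) n (veeLM M lambda x)) = 0.
  case: n => [|n] /=; last by rewrite zerolinE linear0.
  exact: prM_tmap0 (seps_coder (linf_coderE Q)).
rewrite add0r complinE ps_compE /cauchy_prod linear_sum /=.
transitivity (prM V M (phi (\sum_(i < n.+1)
    tmap (P i) (idlin M) (tmap (Phi (n - i)%N) (idlin M) (veeLM M lambda x))))).
  rewrite !linear_sum; apply: eq_bigr => i _; rewrite /ap prM_twist.
  by rewrite (@ps_exp_tmap _ _ M (fun n => veeL (pt n))).
congr (prM V M (phi _)).
rewrite -tmap_ps_comp /veeLM !tmap_comp; apply: eq_tmap => y;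
  rewrite !complinE ?idlinE //.
rewrite Phi_flow -(dpow_intertwine (D := Qbracket Q lambda)) // => z.
by rewrite (Qbracket_lam charK0 Q lambda_hom).
Qed.

Lemma flow_transport n x : dpow (phibracket lamV phi) n x = \sum_(j < n.+1)
  tmap (dpow (Qbracket Q lambda) j) (idlin M)
    (idtens 0 (prM V M \oL dpow (phibracket lamV phi) (n - j)%N) (coact V M x)).
Proof.
apply: (transport (d := 0)) => [j a|m y]; first by rewrite !sgn_pow0.
rewrite (coact_dpow charK0 lambda_hom (linf_ssgn Q) (@lmodule_coactE _ _ _ _ phi)).
by apply: eq_bigr => j _; apply: eq_tmap => z //; rewrite complinE sgn_pow0.
Qed.

(** The corestriction of exp(t [phi, l]) has derivative pr phi l exp(t [phi, l]); splitting off G by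
    [flow_transport] turns this into the equation that defines Psi_t. *)
Lemma prM_Psi n x : prM V M (Psi n x) = prM V M (dpow (phibracket lamV phi) n x).
Proof.
case: HPsi => _ Psi_coact _ Psi0 PsiS.
elim/ltn_ind: n x => -[|n] IH x; first by rewrite dpow0 Psi0.
apply: (pderiv_inj charK0 (n := n)); rewrite PsiS.
transitivity (prM V M (phi (veeLM M lambda (dpow (phibracket lamV phi) n x)))).
  rewrite flow_transport !linear_sum; apply: eq_bigr => j _ /=.
  rewrite prM_pullback (is_comod_recon _ (Psi_coact _)) !idtensE.
  congr (prM V M (phi (veeLM M lambda (tmap _ _ _)))); apply: eq_tmap => y //.
  by rewrite !complinE IH // ltnS leq_subr.
by rewrite -(prM_phibracket _ phi) -(pderiv_dpow charK0) -linearZ.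
Qed.

Lemma Psi_flow n x : dpow (phibracket lamV phi) n x = \sum_(j < n.+1)
    tmap (dpow (Qbracket Q lambda) j) (idlin M) (Psi (n - j)%N x).
Proof.
case: HPsi => _ Psi_coact _ _ _; rewrite flow_transport; apply: eq_bigr => j _.
rewrite (is_comod_recon _ (Psi_coact _)) !idtensE; congr (tmap _ _ _).
by apply: eq_tmap => y //; rewrite !complinE prM_Psi.
Qed.

End ModuleFlow.

End FlowOfMaurerCartan.

(** * Degree and filtration of the flows *)

Section RaisingMaps.
Variable K : fieldType.
Implicit Types A B : lmodType K.

Lemma powlin_raise A (fA : int -> A -> Prop) (D : {linear A -> A}) d n :
  degree_map fA fA d D -> degree_map fA fA (n%:Z * d) (powlin D n).
Proof.
move=> hD; elim: n => [|n IH] k x hx; first by rewrite mul0r addr0 idlinE.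
by rewrite powlinS intS mulrDl mul1r addrCA addrC; apply: hD; exact: IH.
Qed.

Lemma dpow_raise A (fA : int -> A -> Prop) (D : {linear A -> A}) d n :
  (forall k c x, fA k x -> fA k (c *: x)) ->
  degree_map fA fA d D -> degree_map fA fA (n%:Z * d) (dpow D n).
Proof. by move=> fZ hD k x hx; rewrite scalelinE; apply: fZ; exact: powlin_raise. Qed.

Lemma degree_map_add A B (fA : int -> A -> Prop) (fB : int -> B -> Prop) d
    (f g : {linear A -> B}) :
  (forall k x y, fB k x -> fB k y -> fB k (x + y)) ->
  degree_map fA fB d f -> degree_map fA fB d g -> degree_map fA fB d (addlin f g).
Proof. by move=> fD hf hg k x hx; rewrite addlinE; apply: fD; [exact: hf|exact: hg]. Qed.

Lemma degree_map_scale A B (fA : int -> A -> Prop) (fB : int -> B -> Prop) d c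
    (f : {linear A -> B}) :
  (forall k x, fB k x -> fB k (c *: x)) ->
  degree_map fA fB d f -> degree_map fA fB d (scalelin c f).
Proof. by move=> fZ hf k x hx; rewrite scalelinE; apply: fZ; exact: hf. Qed.

Lemma degree_map_eq A B (fA : int -> A -> Prop) (fB : int -> B -> Prop) d e
    (f : {linear A -> B}) : degree_map fA fB d f -> d = e -> degree_map fA fB e f.
Proof. by move=> hf <-. Qed.

End RaisingMaps.

Section FlowDegrees.
Variables (K : fieldType) (V : gvect K) (lam : V) (d e : int).
Local Notation S := (Sym V).

(** Weaker than [is_filtration]: monotonicity is dropped so that gradings qualify too. *)
Definition subspaces (A : lmodType K) (fA : int -> A -> Prop) :=
  (forall k, fA k 0) /\ (forall k c x y, fA k x -> fA k y -> fA k (c *: x + y)).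

Lemma subspacesD (A : lmodType K) (fA : int -> A -> Prop) k x y :
  subspaces fA -> fA k x -> fA k y -> fA k (x + y).
Proof. by move=> [_ fl] hx hy; rewrite -[x]scale1r; exact: fl. Qed.

Lemma subspacesZ (A : lmodType K) (fA : int -> A -> Prop) k c x :
  subspaces fA -> fA k x -> fA k (c *: x).
Proof. by move=> [f0 fl] hx; rewrite -[_ *: _]addr0; exact: fl. Qed.

Lemma phibracket_degree (M : lmodType K) (f : int -> tens S M -> Prop)
    (phi : {linear tens S M -> tens S M}) : subspaces f ->
  degree_map f f d phi -> degree_map f f e (veeM M lam) ->
  degree_map f f (d + e) (phibracket lam phi).
Proof.
move=> Hf hphi hl; apply: degree_map_add.
- by move=> k x y; exact: subspacesD.
- by rewrite addrC; exact: degree_map_comp hl hphi.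
- exact: degree_map_comp hphi hl.
Qed.

(** Here d is the shift of the differentials and e that of lambda \/. With d = 1, e = -1 this gives
    degrees; with d = 0, e = 1 it gives filtrations, where growth with n forces convergence. *)
Lemma hflow_degree (M N : lmodType K) (fM : int -> tens S M -> Prop)
    (fN : int -> tens S N -> Prop)
    (phi : {linear tens S M -> tens S M}) (phi' : {linear tens S N -> tens S N})
    (kappa : {linear tens S M -> tens S N}) n :
  subspaces fM -> subspaces fN ->
  degree_map fM fM d phi -> degree_map fN fN d phi' -> degree_map fM fN 0 kappa ->
  degree_map fM fM e (veeM M lam) -> degree_map fN fN e (veeM N lam) ->
  degree_map fM fN (n%:Z * (d + e) - d) (hflow lam phi phi' kappa n).
Proof.
move=> HM HN hphi hphi' hk hlM hlN.
have fMZ k c x : fM k x -> fM k (c *: x) by exact: subspacesZ.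
have fNZ k c x : fN k x -> fN k (c *: x) by exact: subspacesZ.
have fND k x y : fN k x -> fN k y -> fN k (x + y) by exact: subspacesD.
elim: n => [|n IH]; first by move=> k x _; rewrite /= zerolinE; case: HN.
apply: degree_map_scale => [k x|]; first exact: fNZ.
apply: degree_map_add => //.
  apply: degree_map_eq (degree_map_comp IH (phibracket_degree HN hphi' hlN)) _.
  by rewrite intS mulrDl mul1r; lia.
apply: degree_map_eq (degree_map_comp (dpow_raise n fMZ (phibracket_degree HM hphi hlM))
  (_ : degree_map fM fN e _)) _; last by rewrite intS mulrDl mul1r; lia.
apply: degree_map_add => //; first by rewrite -[e]addr0; exact: degree_map_comp hlM hk.
apply: degree_map_scale => [k x|]; first exact: fNZ.
by rewrite -[e]add0r; exact: degree_map_comp hk hlN.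
Qed.

End FlowDegrees.

(** * Limits in a complete filtered space *)

Section LimitsInFiltered.
Variables (K : fieldType) (N : fgvect K).
Local Notation HN := (fil_filtration N).

Lemma fil_unique (u : nat -> N) l m :
  converges (fil N) u l -> converges (fil N) u m -> l = m.
Proof. exact: converges_unique HN _ _ _ (@fil_separated K N). Qed.

(** Projection to degree i respects the filtration and fixes the sequence, so the projected limit is
    a limit as well. *)
Lemma converges_hom i (u : nat -> N) l :
  (forall n, hom i (u n)) -> converges (fil N) u l -> hom i l.
Proof.
move=> hu cu; rewrite /hom; apply: (fil_unique _ cu) => k.
have [n0 h] := cu k; exists n0 => n /h /(fil_graded i).
by rewrite linearB /= hu.
Qed.

Lemma converges_fil k (u : nat -> N) l :
  (forall n, fil N k (u n)) -> converges (fil N) u l -> fil N k l.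
Proof.
move=> hu cu; have [n0 h] := cu k.
rewrite -[l](subKr (u n0)); apply: (filtrB HN) => //; exact: h.
Qed.

Lemma tends0_cauchy (u : nat -> N) : tends0 (fil N) u -> cauchy (fil N) (series u).
Proof.
move=> hu k; have [n0 h] := hu k; exists n0.
have le m n : (n0 <= n)%N -> (n <= m)%N -> fil N k (series u m - series u n).
  move=> n0n nm; rewrite /series -!(big_mkord xpredT u).
  rewrite (@big_cat_nat _ _ _ n 0 m) //= addrAC subrr add0r big_nat.
  apply: (filtr_sum HN) => i /andP[ni _]; apply: h; exact: leq_trans ni.
move=> m n hm hn; case: (leqP n m) => [|/ltnW] nm; first exact: le.
rewrite -opprB; apply: (filtrN HN); exact: le.
Qed.

(** Terms tending to 0 suffice, as in any non-Archimedean setting. Homogeneity enters because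
    completeness is degreewise. *)
Lemma tends0_summable i (u : nat -> N) : (forall n, hom i (u n)) ->
  tends0 (fil N) u -> exists l, converges (fil N) (series u) l.
Proof.
move=> hu /tends0_cauchy cu; apply: (fil_complete (i := i)) cu => n.
by rewrite /hom /series linear_sum; apply: eq_bigr => j _; exact: hu.
Qed.

End LimitsInFiltered.

Section LinearLimits.
Variables (K : fieldType) (A : lmodType K) (N : fgvect K).
Variable f : nat -> {linear A -> N}.

Lemma limit_linear (g : A -> N) :
  (forall x, converges (fil N) (series (fun n => f n x)) (g x)) -> linear g.
Proof.
move=> cg c x y; apply: fil_unique (cg _) _.
apply: (eq_tends0 _ (converges_lin (fil_filtration N) c (cg x) (cg y))) => n.
by rewrite -series_lin; congr (_ - _); apply: eq_bigr => i _; rewrite linearP.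
Qed.

Lemma exists_linear_limit :
  (forall x, exists l, converges (fil N) (series (fun n => f n x)) l) ->
  exists g : {linear A -> N},
    forall x, converges (fil N) (series (fun n => f n x)) (g x).
Proof.
move=> ex; pose g x := projT1 (cid (ex x)).
have gP x : converges (fil N) (series (fun n => f n x)) (g x) by exact: projT2
  (cid (ex x)).
by exists (mklin (limit_linear gP)) => x; rewrite mklinE.
Qed.

End LinearLimits.

(** * Approximation on tensor products *)

Section ApproximateValues.
Variables (K : fieldType) (L : fgvect K).
Local Notation V := (fshift 1 L).
Local Notation S := (Sym V).
Local Notation filS := (@sym_fil K V).
Local Notation HS := (sym_fil_filtration V).

Lemma tends0_tens (A B A' : lmodType K) fA' fB (HA' : is_filtration fA')
    (HB : is_filtration fB) (f : nat -> {linear A -> A'}) t :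
  (forall a, tends0 fA' (fun n => f n a)) ->
  tends0 (tens_fil fA' fB) (fun n => tmap (f n) (idlin B) t).
Proof.
move=> f0; have H := tens_fil_filtration HA' HB.
elim/pres_ind: t => [|c s t IHs IHt|[a b]].
- by apply: (eq_tends0 _ (tends0_cst0 H)) => n; rewrite linear0.
- apply: (eq_tends0 _ (tends0D H (tends0Z H c IHs) IHt)) => n.
  by rewrite linearP.
change (pres_gen (@tens_rel K A B) (a, b)) with (tpure a b) => k.
have [j hb] := filtr_exh HB b; have [n0 h] := f0 a (k - j).
exists n0 => n /h hn; rewrite tmapE idlinE.
by apply: (tpure_fil (i := k - j)) hn hb _; rewrite subrK.
Qed.

Lemma approx_tens (A B A' : lmodType K) fA' fB (HA' : is_filtration fA')
    (HB : is_filtration fB) (f1 f : nat -> {linear A -> A'}) t :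
  (forall a, tends0 fA' (fun n => f1 n a - series (fun i => f i a) n)) ->
  tends0 (tens_fil fA' fB) (fun n => tmap (f1 n) (idlin B) t -
    series (fun i => tmap (f i) (idlin B) t) n).
Proof.
move=> f0; pose g n := addlin (f1 n) (scalelin (-1) (sumlin n f)).
have g0 a : tends0 fA' (fun n => g n a).
  by apply: (eq_tends0 _ (f0 a)) => n; rewrite addlinE scalelinE sumlinE scaleN1r.
apply: (eq_tends0 _ (tends0_tens HA' HB t g0)) => n; rewrite tmapDl; congr (_ + _).
rewrite -[RHS]scaleN1r -[series _ _](sumlinE _ (fun i => tmap (f i) (idlin B))).
rewrite -scalelinE; move: t; apply: tens_lin_ext => a b.
rewrite scalelinE tmapE !sumlinE !scalelinE sumlinE tpureZl idlinE; congr (_ *: _).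
rewrite (additive_sum _ _ _ (tpure_additivel b)).
by apply: eq_bigr => i _; rewrite tmapE idlinE.
Qed.

Lemma converges_tens (A B A' : lmodType K) fA' fB (HA' : is_filtration fA')
    (HB : is_filtration fB) (f : nat -> {linear A -> A'}) (f1 : {linear A -> A'}) t :
  (forall a, converges fA' (series (fun n => f n a)) (f1 a)) ->
  converges (tens_fil fA' fB) (series (fun n => tmap (f n) (idlin B) t))
    (tmap f1 (idlin B) t).
Proof.
move=> cf; have H := tens_fil_filtration HA' HB.
have c0 a : tends0 fA' (fun n => f1 a - series (fun i => f i a) n).
  by apply: (eq_tends0 _ (tends0N HA' (cf a))) => n; exact: opprB.
apply: (eq_tends0 _ (tends0N H (approx_tens HA' HB (f1 := fun=> f1) t c0))) => n.
exact: opprB.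
Qed.

Lemma converges_idtens (A B : lmodType K) fB (HB : is_filtration fB) d
    (f : nat -> {linear A -> B}) (f1 : {linear A -> B}) t :
  (forall a, converges fB (series (fun n => f n a)) (f1 a)) ->
  converges (tens_fil filS fB) (series (fun n => @idtens K V _ _ d (f n) t))
    (@idtens K V _ _ d f1 t).
Proof.
move=> cf; have H := tens_fil_filtration HS HB.
elim/pres_ind: t => [|c s t IHs IHt|[a b]].
- apply: (eq_tends0 _ (tends0_cst0 H)) => n.
  by rewrite linear0 subr0 /series big1 // => i _; rewrite linear0.
- apply: (eq_tends0 _ (converges_lin H c IHs IHt)) => n.
  rewrite -series_lin; congr (_ - _); last by rewrite linearP.
  by apply: eq_bigr => i _; rewrite linearP.
change (pres_gen (@tens_rel K S A) (a, b)) with (tpure a b) => k.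
have [j ha] := filtr_exh HS (sgn_pow d a); have [n0 h] := cf b (k - j).
exists n0 => n /h hn; rewrite idtensE tmapE.
have -> : series (fun n => idtens d (f n) (tpure a b)) n =
    tpure (sgn_pow d a) (series (fun n => f n b) n).
  rewrite /series (additive_sum _ _ _ (tpure_additiver _)).
  by apply: eq_bigr => i _; rewrite idtensE tmapE.
rewrite -tpureNr -tpure_additiver.
by apply: (tpure_fil (i := j)) ha hn _; rewrite addrC subrK.
Qed.

Lemma twist_limit (M N : fgvect K) (p : L) (f g : SymLM L M -> SymLM L N) x :
  is_twist (@filSM K L N) (@veeLM K L M) (@veeLM K L N) p f g ->
  converges (fil N) (fun n => prM V N (f (exp_trunc (veeLM M p) n x))) (prM V N (g x)).
Proof.
move=> tw; have := converges_map (prM_fil (fil_filtration N)) (tw x).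
(* A truncation of length 0 is the zero map, so the left exponential disappears under [prM] only
   from n = 1 on. *)
move=> /(tends0_shift 1) h; apply: (tends0_unshift (m := 1)).
apply: (eq_tends0 _ h) => n; congr (_ - _); rewrite addn1 exp_truncE linear_sum.
rewrite big_ord_recl big1 => [|j _].
  by rewrite addr0 fact0 invr1 scale1r idlinE.
rewrite linearZ /= powlinS scalelinE linearZ /= prM_veeM.
by rewrite !scaler0.
Qed.

End ApproximateValues.

(** * Values of the flows at t = 1 *)

Section ConvergenceAtOne.
Variables (K : fieldType) (charK0 : [pchar K] =i pred0) (L : fgvect K).
Local Notation V := (fshift 1 L).
Local Notation S := (SymL L).
Local Notation filS := (@sym_fil K (fshift 1 L)).
Local Notation HS := (sym_fil_filtration (fshift 1 L)).
Variables (Q : linf L) (p : L) (pt : nat -> L) (lambda : L).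
Local Notation lamV := (lambda : fshift 1 L).
Hypothesis p_fil : fil L 1 p.
Hypothesis Hpt : mc_homotopic0 Q p pt (psC lambda).
Variable Phi : nat -> {linear S -> S}.
Hypothesis HPhi : is_Phi Q pt lambda Phi.
Variables (Qp : linf L) (Phi1 : linf_mor Q Qp).
Hypothesis HPhi1 : is_Phi1 Phi Phi1.

Local Notation P := (ps_exp (fun n => veeL (pt n))).

Lemma pt_sum : converges (fil V) (series (pt : nat -> V)) p.
Proof. by case: Hpt. Qed.

Lemma Qbracket_fil : degree_map filS filS 1 (Qbracket Q lamV).
Proof.
have hQ : degree_map filS filS 0 Q by apply/filtered_degree0; exact: linf_fil.
have hl := vee_fil (lambda_fil Hpt).
apply: degree_map_add.
- by move=> k x y; exact: filtrD HS _ _ _.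
- exact: degree_map_eq (degree_map_comp hl hQ) (addr0 1).
- exact: degree_map_eq (degree_map_comp hQ hl) (add0r 1).
Qed.

(** The bound is obtained by solving P Phi = exp(t [Q, l]) for the top coefficient of Phi, as P has
    constant term the identity. *)
Lemma Phi_fil n : degree_map filS filS 0 (Phi n).
Proof.
elim/ltn_ind: n => n IH k a ha; rewrite addr0.
have -> : Phi n a = dpow (Qbracket Q lamV) n a - \sum_(i < n) P i.+1 (Phi (n - i.+1)%N a).
  rewrite -(Phi_flow charK0 Hpt HPhi) ps_compE /cauchy_prod big_ord_recl /=.
  by rewrite /ap ps_exp0 subn0 addrK.
apply: (filtrB HS).
  apply: (filtr_mono HS (k' := k + n%:Z * 1)); first by rewrite lerDl mulr1.
  by apply: dpow_raise Qbracket_fil _ _ ha => *; exact: (filtrZ HS).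
apply: (filtr_sum HS) => i _; rewrite -[k]addr0.
have PF := ps_exp_fil (V := fshift 1 L) (p := pt) (pt_fil Hpt); apply: (PF i.+1).
by rewrite -[k]addr0; apply: IH => //; rewrite ltn_subrL; case: (n) i => [[]|].
Qed.

Lemma Phi1_fil : degree_map filS filS 0 Phi1.
Proof. by apply/filtered_degree0; exact: linf_mor_fil. Qed.

Lemma spr1_Phi_sum a : converges (fil V) (series (fun n => spr1 V (Phi n a)))
  (spr1 V (Phi1 a)).
Proof. exact: HPhi1. Qed.

(** [is_Phi1] speaks of Taylor coefficients only; [sym_recon] and induction on length carry
    convergence over to the whole maps. *)
Lemma Phi_sum a : converges filS (series (fun n => Phi n a)) (Phi1 a).
Proof.
have HV := fil_filtration V.
elim/sym_len_ind: a => [|c a b ha hb|w IH].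
- apply: (eq_tends0 _ (tends0_cst0 HS)) => n.
  by rewrite linear0 subr0 /series big1 // => i _; rewrite linear0.
- apply: (eq_tends0 _ (converges_lin HS c ha hb)) => n.
  rewrite -series_lin; congr (_ - _); last by rewrite linearP.
  by apply: eq_bigr => i _; rewrite linearP.
(* [X m] and [X1] reconstruct the images of [word w] from its coproduct, up to division by lengths
   and the counit part. *)
pose X m := @vee_tens K V \oL sumlin m.+1 (fun j =>
  tmap (spr1 V \oL Phi j) (Phi (m - j)%N)).
pose X1 := @vee_tens K V \oL tmap (spr1 V \oL Phi1) Phi1.
have [Pd Pe] := Phi_grouplike HPhi.
have EX m : Phi m (word w) = (psC (seps V (word w)) m : K) *: sym1 V +
    @inv_len K V (X m (sdelta V (word w))).
  rewrite [LHS](sym_recon charK0) Pe Pd; congr (_ + inv_len _ _).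
  rewrite complinE sumlinE !linear_sum; apply: eq_bigr => j _ /=.
  by rewrite tmap_comp; apply: (congr1 (vee_tens V)); apply: eq_tmap => // y;
    rewrite complinE idlinE.
have EX1 : Phi1 (word w) = (seps V (word w) : K) *: sym1 V +
    @inv_len K V (X1 (sdelta V (word w))).
  rewrite [LHS](sym_recon charK0) linf_mor_counit linf_mor_comul; congr (_ + inv_len _ _).
  rewrite complinE tmap_comp; apply: (congr1 (vee_tens V)).
  by apply: eq_tmap => // y; rewrite complinE idlinE.
suff cX : converges filS (series (fun m => X m (sdelta V (word w)))) (X1 (sdelta V
  (word w))).
  have := converges_map (@inv_len_fil K V) cX.
  move=> /(tends0_shift 1) h; apply: (tends0_unshift (m := 1)).
  apply: (eq_tends0 _ h) => n; rewrite addn1 EX1 linear_series.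
  have -> : series (fun n => Phi n (word w)) n.+1 = (seps V (word w) : K) *: sym1 V +
     series (fun m => @inv_len K V (X m (sdelta V (word w)))) n.+1.
    rewrite /series; under eq_bigr do rewrite EX.
    rewrite big_split /=; congr (_ + _).
    by rewrite big_ord_recl big1 ?addr0 // => i _; rewrite scale0r.
  by rewrite opprD addrACA subrr add0r.
elim: (sdelta_split w) => [|t ht|c s t _ hs _ ht].
- apply: (eq_tends0 _ (tends0_cst0 HS)) => n.
  by rewrite linear0 subr0 /series big1 // => i _; rewrite linear0.
- case: ht => [[c ->]|[b [w' [lt ->]]]].
    have s1 : spr1 V (Phi1 (sym1 V)) = 0.
      apply: fil_unique (spr1_Phi_sum _) _; apply: (eq_tends0 _ (tends0_cst0 HV)) => n.
      by rewrite subr0 /series big1 // => i _; exact: (spr1_Phi_sym1 charK0 HPhi).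
    apply: (eq_tends0 _ (tends0_cst0 HS)) => n.
    rewrite complinE tmapE complinE s1 tpure0l linear0 subr0 /series big1 // => i _.
    rewrite complinE sumlinE big1 ?linear0 // => j _.
    by rewrite tmapE complinE (spr1_Phi_sym1 charK0 HPhi) tpure0l.
  (* The letters pr Phi_n(b) need a filtration bound independent of n for their Cauchy product with
     the values on the shorter word w'. *)
  have [k0 hb] := filtr_exh HS b.
  have hu n : fil V k0 (spr1 V (Phi n b)).
    rewrite -[k0]addr0; apply: spr1_fil; rewrite -[k0]addr0; exact: Phi_fil.
  have hu1 : fil V k0 (spr1 V (Phi1 b)).
    rewrite -[k0]addr0; apply: spr1_fil; rewrite -[k0]addr0; exact: Phi1_fil.
  have := converges_cauchy_prod HS HS (fun n => vee_fil (hu n)) (vee_fil hu1)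
    (fun a => converges_vee a (spr1_Phi_sum b)) (IH w' lt).
  move=> h; apply: (eq_tends0 _ h) => n; congr (_ - _).
    apply: eq_bigr => m _; rewrite complinE sumlinE linear_sum; apply: eq_bigr => j _ /=.
    by rewrite tmapE vee_tensE complinE.
  by rewrite complinE tmapE vee_tensE complinE.
- apply: (eq_tends0 _ (converges_lin HS c hs ht)) => n.
  rewrite -series_lin; congr (_ - _); last by rewrite linearP.
  by apply: eq_bigr => i _; rewrite linearP.
Qed.

Section Evaluation.
Variables (M N : fgvect K).
Local Notation filN := (tens_fil filS (fil N)).
Variables (F : nat -> {linear SymLM L M -> SymLM L N}).
Variables (F1 : SymLM L M -> SymLM L N) (R : nat -> SymLM L M -> SymLM L N).
Hypothesis F_sum : forall x, converges filN (series (fun n => F n x)) (F1 x).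
Hypothesis F_flow : forall n x, R n x = \sum_(j < n.+1)
  tmap (dpow (Qbracket Q lamV) j) (idlin N) (F (n - j)%N x).

(** Two Cauchy products are evaluated: Phi with F converges to (Phi_1 (x) id) F_1, whereas the outer
    exponential is only approximated by its truncations. Together with [twist_limit] this evaluates
    twisted maps at t = 1. *)
Lemma flow_value x : tends0 filN (fun n =>
  exp_trunc (veeLM N p) n (tmap Phi1 (idlin N) (F1 x)) - series (fun n => R n x) n).
Proof.
have HN := fil_filtration N; have HSN := tens_fil_filtration HS HN.
pose PN n := tmap (P n) (idlin N); pose PhiN n := tmap (Phi n) (idlin N).
have id0 : degree_map (fil N) (fil N) 0 (idlin N) by exact: degree_map_id.
have RE m : R m x = cauchy_prod (@ap _ _ _) PN (cauchy_prod (@ap _ _ _) PhiN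
  (fun k => F k x)) m.
  rewrite -cauchy_prod_ps_comp F_flow; apply: eq_bigr => j _; rewrite /ap.
  transitivity (tmap (ps_comp P Phi j) (idlin N) (F (m - j)%N x)).
    by apply: eq_tmap => // a; rewrite (Phi_flow charK0 Hpt HPhi).
  by rewrite tmap_ps_comp ps_compE.
have PhiN_fil n : degree_map filN filN 0 (PhiN n).
  by rewrite -[0]addr0; apply: tmap_fil => //; exact: Phi_fil.
have Phi1N_fil : degree_map filN filN 0 (tmap Phi1 (idlin N)).
  by rewrite -[0]addr0; apply: tmap_fil => //; exact: Phi1_fil.
have c1 := converges_cauchy_prod HSN HSN PhiN_fil Phi1N_fil
  (fun t => converges_tens HS HN t Phi_sum) (F_sum x).
have PN_fil n : degree_map filN filN 0 (PN n).
  rewrite -[0]addr0; apply: tmap_fil => //.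
  have PF := ps_exp_fil (V := fshift 1 L) (p := pt) (pt_fil Hpt); exact: PF.
have P1N_fil n : degree_map filN filN 0 (tmap (exp_trunc (veeL p) n) (idlin N)).
  rewrite -[0]addr0; apply: tmap_fil => //; exact: (@exp_trunc_fil K V).
have p_fil' : fil V 1 p by [].
have appr t := approx_tens HS HN t (ps_exp_approx (V := fshift 1 L) (p := pt)
  (pt0 Hpt) (pt_fil Hpt) p_fil' pt_sum).
have PN0 t := tends0_tens HS HN t (ps_exp_tends0 (V := fshift 1 L) (p := pt)
  (pt0 Hpt) (pt_fil Hpt) p_fil' pt_sum).
have := series_cauchy_prod HSN HSN PN_fil P1N_fil appr PN0 c1.
move=> h; apply: (eq_tends0 _ h) => n; congr (_ - _); first by rewrite exp_trunc_tmap.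
by apply: eq_bigr => m _; rewrite RE.
Qed.

End Evaluation.
End ConvergenceAtOne.

(** * Comodule maps and boundaries *)

Section ComodulePairs.
Variables (K : fieldType) (V : gvect K).
Local Notation S := (Sym V).
Variables (M N : lmodType K).

Lemma is_comod_eq d (F F' : {linear tens S M -> tens S N}) :
  is_comod d F -> is_comod d F' ->
  (forall x, prM V N (F x) = prM V N (F' x)) -> F =1 F'.
Proof.
move=> cF cF' E x; rewrite (is_comod_recon _ cF) (is_comod_recon _ cF') !idtensE.
by apply: eq_tmap => // y; rewrite !complinE.
Qed.

Lemma is_comod0_sub (F F' : {linear tens S M -> tens S N}) :
  is_comod 0 F -> is_comod 0 F' -> is_comod 0 (addlin F (scalelin (-1) F')).
Proof.
move=> cF cF' x; rewrite addlinE scalelinE linearD linearZ /= cF cF' !idtensE.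
rewrite tmapDr; congr (_ + _); rewrite -scalelinE; move: (coact V M x).
by apply: tens_lin_ext => a y; rewrite scalelinE !tmapE scalelinE tpureZr.
Qed.

Lemma is_comod_comp (P : lmodType K) d (F : {linear tens S M -> tens S N})
    (H : {linear tens S N -> tens S P}) :
  is_comod d F -> is_comod 0 H -> is_comod d (H \oL F).
Proof.
move=> cF cH x; rewrite (complinE H F) cH cF !idtensE tmap_comp.
by apply: eq_tmap => a; rewrite !complinE ?sgn_pow0.
Qed.

Variables (Q : {linear S -> S}).
Hypothesis Q_ssgn : forall a, Q (ssgn V a) = - ssgn V (Q a).
Variables (phi : {linear tens S M -> tens S M}) (phi' : {linear tens S N -> tens S N}).
Hypothesis phi_coact : forall x, coact V M (phi x) =
  tmap (ssgn V) phi (coact V M x) + tmap Q (idlin _) (coact V M x).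
Hypothesis phi'_coact : forall x, coact V N (phi' x) =
  tmap (ssgn V) phi' (coact V N x) + tmap Q (idlin _) (coact V N x).

(** The terms with [Q] on the left factor cancel, because [Q] anticommutes with the grading sign
    carried by an odd map. *)
Lemma is_comod_boundary d (H : {linear tens S M -> tens S N}) : odd `|d| ->
  is_comod d H -> is_comod 0 (addlin (phi' \oL H) (H \oL phi)).
Proof.
move=> od cH x; rewrite addlinE (complinE phi' H)
  (complinE H phi) linearD /= phi'_coact !cH phi_coact !idtensE.
rewrite (sgn_pow_odd V od) linearD /= !tmap_comp tmapDr.
move: (coact V M x) => y.
have -> : tmap (Q \oL ssgn V) (idlin (tens S N) \oL H) y =
    - tmap (ssgn V \oL Q) (H \oL idlin (tens S M)) y.
  rewrite -scaleN1r -scalelinE; move: y; apply: tens_lin_ext => a z.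
  by rewrite scalelinE !tmapE !complinE !idlinE Q_ssgn tpureNl scaleN1r.
rewrite addrACA addNr addr0.
by congr (_ + _); apply: eq_tmap => a //; rewrite complinE ssgnK sgn_pow0.
Qed.

End ComodulePairs.

(** Serves to extend limits from homogeneous elements, the only ones to which completeness
    applies. *)
Lemma tens_hom_span (K : fieldType) (V M : gvect K) (x : tens (Sym V) M) :
  lspan (fun y => exists i, tens_hom (@sym_hom K V) (@hom K M) i y) x.
Proof.
elim/pres_ind: x => [|c a b|[a m]]; [exact: lspan0|exact: lspan_lin|].
change (pres_gen (@tens_rel K (Sym V) M) (a, m)) with (tpure a m).
rewrite -(mklinE (tpure_linearl m)); apply: lspan_map (sym_hom_span a) => {}a [i ha].
rewrite mklinE; elim/gvect_ind: m => [|m m' hm hm'|j m hm].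
- by rewrite tpure0r; exact: lspan0.
- by rewrite tpure_additiver; exact: lspanD.
- by apply: lspan_gen; exists (i + j); exact: tpure_hom ha hm erefl.
Qed.

(** * The corestricted homotopy at t = 1 *)

Section HomotopyLimit.
Variables (K : fieldType) (L : fgvect K) (lambda : L).
Local Notation V := (fshift 1 L).
Local Notation lamV := (lambda : fshift 1 L).
Hypothesis lam_hom : @hom K V (-1) lambda.
Hypothesis lam_fil : fil V 1 lambda.
Variables (Q : linf L) (M N : fgvect K) (phi : lmodule Q M) (phi' : lmodule Q N).
Variable kappa : lmorph phi phi'.
Local Notation W := (hflow lamV phi phi' kappa).

Lemma subspaces_lspan (A : lmodType K) (P : int -> A -> Prop) :
  subspaces (fun k => lspan (P k)).
Proof. by split=> *; [exact: lspan0|exact: lspan_lin]. Qed.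

Lemma veeM_fil (P : fgvect K) : degree_map (@filSM K L P) (@filSM K L P) 1 (veeM P lamV).
Proof.
exact: degree_map_eq (tmap_fil (vee_fil lam_fil) (@degree_map_id _ _ (fil P))) (addr0 1).
Qed.

Lemma veeM_hom (P : fgvect K) : degree_map (@homSM K L P) (@homSM K L P) (-1)
  (veeM P lamV).
Proof.
have h : degree_map (@sym_hom K V) (@sym_hom K V) (-1) (vee lamV).
  by move=> i a ha; rewrite addrC; exact: sym_hom_vee.
exact: degree_map_eq (tmap_hom h (@degree_map_id _ _ (@hom K P))) (addr0 _).
Qed.

Lemma hflow_fil n : degree_map (@filSM K L M) (@filSM K L N) n%:Z (W n).
Proof.
have E : n%:Z * (0 + 1) - 0 = n%:Z by rewrite add0r mulr1 subr0.
apply: (degree_map_eq _ E); apply: hflow_degree; try exact: subspaces_lspan.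
- by apply/filtered_degree0; exact: lmodule_fil.
- by apply/filtered_degree0; exact: lmodule_fil.
- by apply/filtered_degree0; exact: lmorph_fil.
- exact: veeM_fil.
- exact: veeM_fil.
Qed.

Lemma hflow_hom n : degree_map (@homSM K L M) (@homSM K L N) (-1) (W n).
Proof.
have E : n%:Z * (1 + -1) - 1 = -1 by rewrite subrr mulr0 add0r.
apply: (degree_map_eq _ E); apply: hflow_degree; try exact: subspaces_lspan.
- exact: lmodule_deg.
- exact: lmodule_deg.
- exact: lmorph_deg.
- exact: veeM_hom.
- exact: veeM_hom.
Qed.

(** Limits exist on homogeneous elements by completeness and extend along spans; linearity then
    comes from uniqueness of limits. *)
Lemma hflow_limit : exists eta : {linear SymLM L M -> N},
  [/\ forall x, converges (fil N) (series (fun n => prM V N (W n x))) (eta x),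
      degree_map (@homSM K L M) (@hom K N) (-1) eta &
      filtered_map (@filSM K L M) (fil N) eta].
Proof.
have HN := fil_filtration N.
have HSM := tens_fil_filtration (sym_fil_filtration V) (fil_filtration M).
have W_hom n : degree_map (@homSM K L M) (@hom K N) (-1) (prM V N \oL W n).
  exact: degree_map_eq (degree_map_comp (@hflow_hom n) (@prM_hom _ _ _)) (addr0 _).
have W_fil n : degree_map (@filSM K L M) (fil N) n%:Z (prM V N \oL W n).
  exact: degree_map_eq (degree_map_comp (@hflow_fil n) (prM_fil HN)) (addr0 _).
have W0 x : tends0 (fil N) (fun n => (prM V N \oL W n) x).
  move=> k; have [j hx] := filtr_exh HSM x; exists `|k - j|%N => n le.
  by apply: (filtr_mono HN) (W_fil n _ _ hx); lia.
have [eta eta_lim] : exists g : {linear SymLM L M -> N},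
    forall x, converges (fil N) (series (fun n => (prM V N \oL W n) x)) (g x).
  apply: exists_linear_limit => x;
    elim: (tens_hom_span x) => [|y [i hy]|c y z _ [l hl] _ [m hm]].
  - exists 0; apply: (eq_tends0 _ (tends0_cst0 HN)) => n.
    by rewrite subr0 /series big1 // => j _; rewrite linear0.
  - by apply: (tends0_summable (i := i - 1)) => // n; exact: W_hom.
  - exists (c *: l + m); apply: (eq_tends0 _ (converges_lin HN c hl hm)) => n.
    by rewrite -series_lin; congr (_ - _); apply: eq_bigr => j _; rewrite linearP.
exists eta; split.
- move=> x; apply: (eq_tends0 _ (eta_lim x)) => n; congr (_ - _).
  by apply: eq_bigr => j _; rewrite complinE.
- move=> i x hx; apply: converges_hom (eta_lim x) => n.
  by rewrite /hom /series linear_sum; apply: eq_bigr => j _; exact: W_hom.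
- move=> k x hx; apply: converges_fil (eta_lim x) => n.
  apply: (filtr_sum HN) => j _; apply: (filtr_mono HN) (W_fil j _ _ hx).
  by rewrite lerDl.
Qed.

End HomotopyLimit.

(** * Evaluation of the formal homotopy at t = 1 *)

Theorem proposition7p22
    (K : fieldType) (charK0 : [pchar K] =i pred0)
    (L M N : fgvect K) (Q : linf L)
    (phi : lmodule Q M) (phi' : lmodule Q N) (kappa : lmorph phi phi')
    (p : L) (pt : nat -> L) (lambda : L)
    (Hp : maurer_cartan Q p) (Hpt : mc_homotopic0 Q p pt (psC lambda))
    (Qp : linf L) (HQp : twisted_linf Q p Qp)
    (phip : lmodule Qp M) (Hphip : twisted_lmodule phi p phip)
    (phip' : lmodule Qp N) (Hphip' : twisted_lmodule phi' p phip')
    (kappap : lmorph phip phip') (Hkappap : twisted_lmorph kappa p kappap)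
    (Phi : nat -> {linear SymL L -> SymL L}) (HPhi : is_Phi Q pt lambda Phi)
    (Phi1 : linf_mor Q Qp) (HPhi1 : is_Phi1 Phi Phi1)
    (psi : lmodule Q M) (Hpsi : pullback_lmodule Phi1 phip psi)
    (psi' : lmodule Q N) (Hpsi' : pullback_lmodule Phi1 phip' psi')
    (kappa1 : lmorph psi psi') (Hkappa1 : pullback_lmorph Phi1 kappap kappa1)
    (PsiM : nat -> {linear SymLM L M -> SymLM L M})
    (HPsiM : is_Psi phi pt lambda Phi PsiM)
    (PsiN : nat -> {linear SymLM L N -> SymLM L N})
    (HPsiN : is_Psi phi' pt lambda Phi PsiN)
    (PsiM1 : lmorph phi psi) (HPsiM1 : is_Psi1 PsiM PsiM1)
    (PsiN1 : lmorph phi' psi') (HPsiN1 : is_Psi1 PsiN PsiN1)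
    (PsiN1inv : lmorph psi' phi')
    (HPsiN1l : cancel PsiN1 PsiN1inv) (HPsiN1r : cancel PsiN1inv PsiN1) :
  homotopic kappa (lmorph_comp PsiN1inv (lmorph_comp kappa1 PsiM1)).
Proof.
pose V := fshift 1 L; pose lam : V := lambda.
have HN := fil_filtration N; have HM := fil_filtration M.
have p_fil : fil L 1 p by case: Hp.
have lh := lambda_hom Hpt; have lf := lambda_fil Hpt.
have [eta [eta_lim eta_hom eta_fil]] := hflow_limit lh lf kappa.
set W := hflow _ phi phi' kappa in eta_lim.
(* [H] will be a homotopy for the pulled-back structure psi' on [N]. Its degree is written 0 - 1 to
   match [hom_diff] at d = 0. *)
pose H := idtens (0 - 1) eta \oL coact V M.
have cH : is_comod (0 - 1) H by exact: is_comod_cofree.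
have Qs := linf_ssgn Q.
have kappa_coact x : coact V N (kappa x) = tmap (idlin _) kappa (coact V M x).
  exact: lmorph_coact.
have cPsiM x : converges (@filSM K L M) (series (fun n => PsiM n x)) (PsiM1 x).
  have [_ ch _ _ _] := HPsiM.
  have c1 : is_comod 0 PsiM1 by exact: lmorph_coact.
  have cf y : converges (fil M) (series (fun n => (prM V M \oL PsiM n) y))
    ((prM V M \oL PsiM1) y).
    apply: (eq_tends0 _ (HPsiM1 y)) => n; rewrite complinE; congr (_ - _).
    by apply: eq_bigr => i _; rewrite complinE.
  apply: (eq_tends0 _ (converges_idtens (L := L) HM 0 (coact V M x) cf)) => n.
  rewrite -(is_comod_recon _ c1); congr (_ - _); apply: eq_bigr => i _.
  by rewrite -(is_comod_recon _ (ch i)).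
have cH1 x : converges (@filSM K L N)
    (series (fun n => (idtens (0 - 1) (prM V N \oL W n) \oL coact V M) x)) (H x).
  have cf y : converges (fil N) (series (fun n => (prM V N \oL W n) y)) (eta y).
    apply: (eq_tends0 _ (eta_lim y)) => n; congr (_ - _).
    by apply: eq_bigr => i _; rewrite complinE.
  apply: (eq_tends0 _ (converges_idtens (L := L) HN (0 - 1) (coact V M x) cf)) => n.
  by rewrite /H complinE; congr (_ - _); apply: eq_bigr => i _; rewrite complinE.
(* The difference between [u n] and the partial sums stays small under g and [prM], so both
   sequences have the same limit in [N]. *)
have corestr (X : fgvect K) (g : {linear SymLM L X -> SymLM L N}) l u v :
    filtered_map (@filSM K L X) (@filSM K L N) g ->
    converges (fil N) (fun n => prM V N (g (u n))) l ->
    tends0 (@filSM K L X) (fun n => u n - series v n) ->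
    converges (fil N) (series (fun n => prM V N (g (v n)))) l.
  move=> /filtered_degree0 hg cu uv.
  have := tends0_map (prM_fil HN) (tends0_map hg uv) => h.
  apply: (eq_tends0 _ (tends0B HN cu h)) => n.
  have -> : prM V N (g (u n - series v n)) =
      prM V N (g (u n)) - series (fun n => prM V N (g (v n))) n.
    by rewrite linearB linearB /= linear_series linear_series.
  by rewrite opprB addrC addrA subrK.
(* The terms of [hflow_homotopy] are evaluated after corestriction: kappa exp(t [phi, l]) gives
   kappa1 Psi_M, phi' W gives psi' H, and exp(t [phi', l]) kappa gives Psi_N kappa; W phi is covered
   by [eta_lim]. *)
pose U n x := dpow (phibracket lam phi) n x.
have limA x : converges (fil N) (series (fun n => prM V N (kappa (U n x))))
    (prM V N (kappa1 (PsiM1 x))).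
  rewrite Hkappa1; apply: corestr (lmorph_fil kappa) (twist_limit _ Hkappap) _.
  exact: (flow_value charK0 p_fil Hpt HPhi HPhi1 cPsiM (Psi_flow charK0 Hpt HPhi HPsiM)).
(* Removing the covering flow from W leaves comodule maps with the corestrictions of W, and these
   sum to [H]. *)
have W_flow n x : W n x = \sum_(j < n.+1) tmap (dpow (Qbracket Q lam) j) (idlin N)
    ((idtens (0 - 1) (prM V N \oL W (n - j)%N) \oL coact V M) x).
  rewrite (@transport _ _ _ _ (0 - 1) (dpow (Qbracket Q lam)) W) => [|j a|m y].
  - by apply: eq_bigr => j _; rewrite complinE.
  - rewrite sgn_pow_odd //; apply: dpow_intertwine => b.
    by rewrite Qbracket_ssgn.
  - rewrite sgn_pow_odd //.
    exact: (coact_hflow charK0 lh Qs (lmodule_coactE phi)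
      (lmodule_coactE phi') kappa_coact).
have limC x : converges (fil N) (series (fun n => prM V N (phi' (W n x))))
    (prM V N (psi' (H x))).
  rewrite Hpsi'; apply: corestr (lmodule_fil phi') (twist_limit _ Hphip') _.
  exact: (flow_value charK0 p_fil Hpt HPhi HPhi1 cH1 W_flow).
have limB x : converges (fil N) (series (fun n => prM V N (dpow
  (phibracket lam phi') n (kappa x))))
    (prM V N (PsiN1 (kappa x))).
  apply: (eq_tends0 _ (HPsiN1 (kappa x))) => n; congr (_ - _).
  by apply: eq_bigr => i _; rewrite (prM_Psi charK0 Hpt HPhi HPsiN).
have corestriction x : prM V N (kappa1 (PsiM1 x)) - prM V N (PsiN1 (kappa x)) =
    prM V N (psi' (H x)) + eta (phi x).
  apply: fil_unique (_ : converges _ (series (fun n => prM V N (phi' (W n x)) +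
    prM V N (W n (phi x)))) _); last first.
    apply: (eq_tends0 _ (tends0D HN (limC x) (eta_lim (phi x)))) => n.
    by rewrite /series big_split /= opprD addrACA.
  apply: (eq_tends0 _ (tends0B HN (limA x) (limB x))) => n.
  have -> : series (fun n => prM V N (phi' (W n x)) + prM V N (W n (phi x))) n =
      series (fun n => prM V N (kappa (U n x))) n -
      series (fun n => prM V N (dpow (phibracket lam phi') n (kappa x))) n.
    rewrite /series -sumrB; apply: eq_bigr => i _; rewrite -linearB -linearD.
    by rewrite (hflow_homotopy charK0 lam (lmodule_sq phi) (lmodule_sq phi')
      (lmorph_comm kappa)).
  by rewrite !opprB [LHS](AC (2*2) ((1*4)*(3*2))).
(* Both sides are comodule maps of degree 0, so equality of corestrictions is enough. *)
have cohomologous x : kappa1 (PsiM1 x) - PsiN1 (kappa x) = psi' (H x) + H (phi x).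
  have c1 : is_comod 0 (addlin (kappa1 \oL PsiM1) (scalelin (-1) (PsiN1 \oL kappa))).
    by apply: is_comod0_sub; apply: is_comod_comp; exact: lmorph_coact.
  have c2 : is_comod 0 (addlin (psi' \oL H) (H \oL phi)).
    exact: (is_comod_boundary Qs (lmodule_coactE phi) (lmodule_coactE psi') (d := 0 - 1)).
  have := is_comod_eq c1 c2 _ x.
  rewrite !addlinE !scalelinE (complinE kappa1) (complinE PsiN1) (complinE psi' H).
  rewrite (complinE H phi) scaleN1r; apply => {}x.
  rewrite !addlinE !scalelinE (complinE kappa1) (complinE PsiN1) (complinE psi' H).
  rewrite (complinE H phi) scaleN1r linearB linearD /= corestriction; congr (_ + _).
  by rewrite (complinE _ (coact V M)) prM_idtens_coact.
(* The inverse of Psi_N commutes with the structure maps, so it turns the boundary for psi' into one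
   for phi'. *)
pose J := PsiN1inv \oL H.
have cJ : is_comod (0 - 1) J by apply: is_comod_comp => //; exact: lmorph_coact.
(* The sign is needed because [homotopic] subtracts [hom_diff], whereas the transported morphism is
   kappa plus the boundary of [J]. *)
exists (scalelin (-1) (prM V N \oL J)); split.
- apply: degree_map_scale => [k y hy|]; first by rewrite /hom linearZ /= hy.
  have dH : degree_map (@homSM K L M) (@homSM K L N) (0 + -1) H.
    exact: degree_map_comp (@coact_hom _ V M (@hom K M)) (idtens_hom _ eta_hom).
  exact: (degree_map_comp (degree_map_comp dH (lmorph_deg PsiN1inv)) (@prM_hom _ V N)).
- apply/filtered_degree0; apply: degree_map_scale => [k y|]; first exact: (filtrZ HN).
  have /filtered_degree0 de := eta_fil; have /filtered_degree0 dP := lmorph_fil PsiN1inv.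
  have dH : degree_map (@filSM K L M) (@filSM K L N) (0 + 0) H.
    exact: degree_map_comp (@coact_fil _ V M _ HM) (idtens_fil _ de).
  exact: (degree_map_comp (degree_map_comp dH dP) (@prM_fil _ V _ _ HN)).
- move=> x; rewrite /hom_diff scalelinE.
  have -> : idtens (0 - 1) (scalelin (-1) (prM V N \oL J)) (coact V M x) = - J x.
    rewrite (is_comod_recon _ cJ) -scaleN1r -scalelinE !idtensE; move: (coact V M x).
    by apply: tens_lin_ext => a y; rewrite scalelinE !tmapE scalelinE tpureZr.
  have -> : lmorph_comp PsiN1inv (lmorph_comp kappa1 PsiM1) x =
      kappa x + (phi' (J x) + J (phi x)).
    rewrite (complinE PsiN1inv) (complinE kappa1) -[kappa1 _](subrK (PsiN1 (kappa x))).
    rewrite cohomologous linearD linearD /= HPsiN1l lmorph_comm addrC.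
    by rewrite !(complinE PsiN1inv H).
  rewrite scale1r scaleN1r (complinE (prM V N) J) (linearN phi') (linearN (prM V N)).
  by rewrite -opprD opprK !(linearD (prM V N)).
Qed.
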